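(* Let $p\ge2$, $\lambda>0$, and let $\boldsymbol{X}_1,\boldsymbol{X}_2,\dots$ be iid copies of a random vector $\boldsymbol{X}$ on $\mathcal{S}^{p-1}$ with density $q\in L^2(\mathcal{S}^{p-1})$ with respect to $\nu_{p-1}$. Let $$T_n(\lambda)=n\Big\|\frac1n\sum_{j=1}^n\Delta_{\mathcal{S}^{p-1}}e^{\lambda\boldsymbol{t}^\top\boldsymbol{X}_j}\Big\|^2_{L^2(\mathcal{S}^{p-1})},\quad z(\boldsymbol{s})=\Delta_{\mathcal{S}^{p-1}}M_{\boldsymbol{X}}(\lambda\boldsymbol{s}),\quad\tau=\|z\|^2_{L^2(\mathcal{S}^{p-1})},$$ where $M_{\boldsymbol{X}}(\boldsymbol{t})=\mathbb{E}[e^{\boldsymbol{t}^\top\boldsymbol{X}}]$. Then, as $n\to\infty$, $$\sqrt n\Big(\frac{T_n(\lambda)}{n}-\tau\Big)\xrightarrow{d}\mathcal{N}(0,\sigma^2),$$ with $$\begin{aligned}\sigma^2&=4\int_{\mathcal{S}^{p-1}}\int_{\mathcal{S}^{p-1}}K'(\boldsymbol{s},\boldsymbol{t})\,z(\boldsymbol{s})\,z(\boldsymbol{t})\,\mathrm{d}\nu_{p-1}(\boldsymbol{s})\,\mathrm{d}\nu_{p-1}(\boldsymbol{t})\\&=4\,\mathbb{E}\bigg[\bigg(\sum_{k=1}^\infty\sum_{r=1}^{d_{k,p}}\gamma_{k,p}\,c_{k,p}(\lambda)\,\beta_{r,k}\big(Y_{r,k}(\boldsymbol{X})-\beta_{r,k}\big)\bigg)^2\bigg],\end{aligned}$$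 where $K'(\boldsymbol{s},\boldsymbol{t})=\Delta_{\mathcal{S}^{p-1},\boldsymbol{s}}\Delta_{\mathcal{S}^{p-1},\boldsymbol{t}}M_{\boldsymbol{X}}\big(\lambda(\boldsymbol{s}+\boldsymbol{t})\big)-z(\boldsymbol{s})z(\boldsymbol{t})$ and $\beta_{r,k}=\int_{\mathcal{S}^{p-1}}q\,Y_{r,k}\,\mathrm{d}\nu_{p-1}$.
   Context: $\mathcal{S}^{p-1}$ is the unit sphere in $\mathbb{R}^p$, $\nu_{p-1}$ the uniform probability measure on it, and $L^2(\mathcal{S}^{p-1})$ has inner product $\langle h,k\rangle=\int_{\mathcal{S}^{p-1}}hk\,\mathrm{d}\nu_{p-1}$. $\Delta_{\mathcal{S}^{p-1}}$ is the Laplace--Beltrami operator, and $\Delta_{\mathcal{S}^{p-1},\boldsymbol{t}}$ denotes it acting in the variable $\boldsymbol{t}\in\mathcal{S}^{p-1}$; $\Delta_{\mathcal{S}^{p-1}}e^{\lambda\boldsymbol{t}^\top\boldsymbol{X}_j}$ is it applied to $\boldsymbol{x}\mapsto e^{\lambda\boldsymbol{t}^\top\boldsymbol{x}}$ and evaluated at $\boldsymbol{X}_j$ (equivalently, applied in $\boldsymbol{t}$), the norm being in $\boldsymbol{t}$; $z$ is it applied to $\boldsymbol{s}\mapsto M_{\boldsymbol{X}}(\lambda\boldsymbol{s})$. For each $k$, $\{Y_{r,k}:r=1,\dots,d_{k,p}\}$ is an arbitrary (real) orthonormal basis, in $L^2(\mathcal{S}^{p-1})$, of the space of spherical harmonics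 of degree $k$; for $k\ge1$ its dimension is $d_{k,p}=\binom{p+k-3}{p-2}+\binom{p+k-2}{p-2}$. $\gamma_{k,2}=(1+1_{\{k=0\}})/2$ and $\gamma_{k,p}=(p-2)/(2k+p-2)$ for $p>2$. With $\mathcal{I}_\alpha$ the modified Bessel function of the first kind of order $\alpha$, for $k\in\mathbb{N}$, $$c_{k,p}(\lambda)=\begin{cases}2k^4\,\mathcal{I}_k(\lambda)^2,&p=2,\\[2pt] 2^{p-3}\lambda^{2-p}(p-2)\big(k+\tfrac{p-2}{2}\big)\Big(\Gamma\big(\tfrac{p-2}{2}\big)\,k(k+p-2)\,\mathcal{I}_{(p-2)/2+k}(\lambda)\Big)^2,&p>2.\end{cases}$$ $\mathcal{N}(0,0)$ is understood as the point mass at $0$. *)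

(* Defs.v *)
From HB Require Import structures.
From mathcomp Require Import all_boot all_order all_algebra.
From mathcomp Require Import all_classical all_reals all_analysis.
(* Not imported: its notations clash with those of mathcomp-analysis. *)
From mathcomp Require mpoly.

Set Implicit Arguments.
Unset Strict Implicit.
Unset Printing Implicit Defensive.

Import Order.TTheory GRing.Theory Num.Theory.
Import numFieldTopology.Exports numFieldNormedType.Exports.

Local Open Scope classical_set_scope.
Local Open Scope ring_scope.

(* R^p is 'rV[R]_p, with its Borel sigma-algebra. *)
Section borel_rV.
Context {R : realType} {p : nat}.

HB.instance Definition _ :=
  @isMeasurable.Build (sigma_display (@open 'rV[R]_p)) 'rV[R]_p
    <<s (@open 'rV[R]_p) >>
    (@sigma_algebra0 _ setT (@open 'rV[R]_p))
    (@sigma_algebraC 'rV[R]_p (@open 'rV[R]_p))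
    (@sigma_algebra_bigcup _ setT (@open 'rV[R]_p)).

End borel_rV.

Section sphere.
Context {R : realType} {p : nat}.

Definition dotp (x y : 'rV[R]_p) : R := \sum_i x 0 i * y 0 i.

(* The library's norm on 'rV[R]_p is the sup norm. *)
Definition enorm (x : 'rV[R]_p) : R := Num.sqrt (dotp x x).

Definition sphere : set 'rV[R]_p := [set x | enorm x = 1].

(* The rotation-invariant probability measure on the sphere, as a measure on
   the ambient space. *)
Definition uniform_on_sphere (nu : probability 'rV[R]_p R) : Prop :=
  nu sphere = 1%E /\
  forall O : 'M[R]_p, O *m O^T = 1%:M ->
  forall A : set 'rV[R]_p, measurable A ->
    nu ((fun x : 'rV[R]_p => x *m O) @^-1` A) = nu A.

(* At points of the sphere, the Laplace-Beltrami operator is the Euclidean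
   Laplacian of the extension of f | sphere that is constant along rays. *)
Definition laplace_beltrami (f : 'rV[R]_p -> R) (x : 'rV[R]_p) : R :=
  let F (u : 'rV[R]_p) : R := f ((enorm u)^-1 *: u) in
  \sum_(i < p) 'D_(delta_mx 0 i) (fun y => 'D_(delta_mx 0 i) F y) x.

Definition harmonic_poly (Q : mpoly.mpoly p R) : Prop :=
  \sum_(i < p) mpoly.mderiv i (mpoly.mderiv i Q) = 0.

(* Functions are only compared on the sphere: f may be arbitrary elsewhere. *)
Definition spherical_harmonic (k : nat) (f : 'rV[R]_p -> R) : Prop :=
  exists Q : mpoly.mpoly p R,
    [/\ all (fun m => mpoly.mdeg m == k) (mpoly.msupp Q), harmonic_poly Q &
        forall x, sphere x -> f x = mpoly.meval (fun i => x 0 i) Q].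

Definition is_orthonormal_sph_basis (nu : probability 'rV[R]_p R) (k d : nat)
    (Y : 'I_d -> 'rV[R]_p -> R) : Prop :=
  [/\ forall r, spherical_harmonic k (Y r),
      forall r s, \int[nu]_(x in sphere) (Y r x * Y s x) = (r == s)%:R &
      forall f, spherical_harmonic k f -> exists a : 'I_d -> R,
        forall x, sphere x -> f x = \sum_r a r * Y r x].

End sphere.

(* For p >= 2 and k >= 1 the truncated subtractions are exact. *)
Definition sph_dim (p k : nat) : nat :=
  if k == 0 then 1 else 'C(p + k - 3, p - 2) + 'C(p + k - 2, p - 2).

Section special_functions.
Context {R : realType}.

Definition Gamma (a : R) : R :=
  \int[@lebesgue_measure R]_(t in `]0, +oo[) (t `^ (a - 1) * expR (- t)).

Definition besselI (a x : R) : R :=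
  limn (series (fun m : nat =>
    (x / 2) `^ (m%:R *+ 2 + a) / (m`!%:R * Gamma (m%:R + a + 1)))).

Definition gamma_coef (p k : nat) : R :=
  if p == 2 then (1 + (k == 0)%:R) / 2
  else (p%:R - 2) / (k%:R *+ 2 + p%:R - 2).

Definition c_coef (p k : nat) (lambda : R) : R :=
  if p == 2 then 2 * k%:R ^+ 4 * besselI k%:R lambda ^+ 2
  else
    let alpha : R := (p%:R - 2) / 2 in
    2 ^+ (p - 3) * lambda ^- (p - 2) * (p%:R - 2) * (k%:R + alpha) *
    (Gamma alpha * (k%:R * (k%:R + p%:R - 2)) *
     besselI (alpha + k%:R) lambda) ^+ 2.

End special_functions.

Section probability.
Context {d : measure_display} {Omega : measurableType d} {R : realType}.
Variable P : probability Omega R.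

Definition same_law {d'} {E : measurableType d'} (X Y : {RV P >-> E}) : Prop :=
  forall A, measurable A -> distribution P X A = distribution P Y A.

Definition independent_seq {d'} {E : measurableType d'}
    (X : nat -> {RV P >-> E}) : Prop :=
  forall (J : seq nat) (A : nat -> set E),
    uniq J -> (forall j, measurable (A j)) ->
    P (\bigcap_(j in [set` J]) (X j @^-1` A j)) =
    (\prod_(j <- J) P (X j @^-1` A j))%E.

Definition has_density {d'} {E : measurableType d'} (nu : probability E R)
    (D : set E) (X : {RV P >-> E}) (q : E -> R) : Prop :=
  [/\ measurable_fun D q, forall x, D x -> 0 <= q x &
      forall A, measurable A ->
        distribution P X A = (\int[nu]_(x in A `&` D) (q x)%:E)%E].

Definition cvg_in_distribution (Z : nat -> Omega -> R)
    (mu : probability (measurableTypeR R) R) : Prop :=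
  (forall n, measurable_fun setT (Z n)) /\
  forall f : R -> R, continuous f -> (exists M : R, forall x, `|f x| <= M) ->
    ('E_P[fun w => f (Z n w)] @[n --> \oo] --> \int[mu]_x (f x)%:E)%E.

(* The library's normal_prob takes the standard deviation, and is a uniform
   law by convention when it is 0. *)
Definition centered_normal (v : R) : probability (measurableTypeR R) R :=
  if v == 0 then (\d_(0 : measurableTypeR R) : probability _ R)
  else (normal_prob 0 (Num.sqrt v) : probability _ R).

Context {p : nat}.
Variables (nu : probability 'rV[R]_p R) (lambda : R).

Definition sqnormL2 (h : 'rV[R]_p -> R) : R :=
  \int[nu]_(t in sphere) (h t ^+ 2).

Definition T_stat (Xs : nat -> {RV P >-> 'rV[R]_p}) (n : nat) (w : Omega) : R :=
  n%:R * sqnormL2 (fun t =>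
    n%:R^-1 * \sum_(j < n)
      laplace_beltrami (fun x => expR (lambda * dotp t x)) (Xs j w)).

Variable X : {RV P >-> 'rV[R]_p}.

Definition mgf (t : 'rV[R]_p) : R := fine ('E_P[fun w => expR (dotp t (X w))])%E.

Definition z_fun (s : 'rV[R]_p) : R :=
  laplace_beltrami (fun u => mgf (lambda *: u)) s.

Definition K'_fun (s t : 'rV[R]_p) : R :=
  laplace_beltrami (fun s' =>
    laplace_beltrami (fun t' => mgf (lambda *: (s' + t'))) t) s
  - z_fun s * z_fun t.

End probability.

(* Main.v *)
(* Let [G u] be the value of the Laplacian of [exp (lambda t.x)] when [t.x = u].
   Differentiating under the expectation gives [z s = E G (s.X)], and [T_n / n] is the
   squared norm of [W_n + z], where [W_n] is the centered empirical mean of the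
   functions [G (s.X_j)]. Hence, with [zeta x = <G (x.), z>],
     [T_n / n - tau = 2/n sum_j (zeta X_j - tau) + |W_n|^2]  and  [E |W_n|^2 = O(1/n)],
   so that the limit is the one of a sum of bounded iid variables, and its variance is
   [4 Var (zeta X)]. Fubini turns this into the double integral of [K' z z].
   For the series, the Funk-Hecke formula says that [G (t.)] has coefficient
   [A_k Y_rk t] on [Y_rk], with [A_k^2 = gamma_k c_k]; hence [z] has coefficient
   [A_k beta_rk], and Parseval gives [zeta = sum A_k^2 beta_rk Y_rk] and
   [tau = sum A_k^2 beta_rk^2]. Completeness of the harmonics is only needed for
   polynomials in [t.x], for which the expansion is explicit; their moments against
   harmonic polynomials come from Stein's identity on the sphere, a consequence of
   rotation invariance.
   The central limit theorem is proved for [E cos (a S_n + b)] by Lindeberg's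
   recursion, and these expectations determine the limit in law because trigonometric
   polynomials approximate bounded continuous functions on intervals. *)
Require Import Defs.
From HB Require Import structures.
From mathcomp Require Import all_boot all_order all_algebra.
From mathcomp Require Import reals.
From mathcomp Require mpoly.
From mathcomp Require Import ring lra zify.

Set Implicit Arguments.
Unset Strict Implicit.
Unset Printing Implicit Defensive.

(** * Homogeneous and harmonic polynomials *)

(* The notations of mpoly and of mathcomp-analysis clash: mpoly is imported
   only inside this module, which ends before mathcomp-analysis is loaded. *)
Module HomogeneousPolynomials.
Import mpoly.
Import Order.TTheory GRing.Theory Num.Theory.
Local Open Scope ring_scope.

Section homogeneous.
Context {R : realType} {p : nat}.
Implicit Types (Q W : {mpoly R[p]}) (t x : 'rV[R]_p).

(** Apart from the density, all the functions involved are bounded on the sphere, so everything is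
    stated for bounded measurable functions ([bmf]) under probability measures, where linearity and
    Fubini cost nothing more. Functions on the sphere are made total by [sproj]. Statements about
    all bounded functions of a random vector are reduced to indicators by [bmf_functional_eq0]. The
    obstacle in the series is that the basis [Y] is arbitrary in each degree. The Taylor truncations
    of [G] converge uniformly on [[-1, 1]] and lie in finite spans of harmonics, by means of zonal
    polynomials; the error in Parseval's formula is controlled by the distance to the span, hence
    the series for [zeta t] converges uniformly in [t]. This uniformity is what allows it to be
    integrated into the series for [tau]. In the central limit theorem, one step costs [O(|c|^3)] at
    frequency [c]; with [c = a / sqrt n] the [n] errors add up to [O(1 / sqrt n)]. The remainder
    [sqrt n |W_n|^2] has mean [O(1 / sqrt n)] and disappears because cosine is Lipschitz. *)

Definition ev Q x : R := Q.@[fun i => x 0 i].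

Lemma evD Q W x : ev (Q + W) x = ev Q x + ev W x.
Proof. exact: mevalD. Qed.

Lemma evB Q W x : ev (Q - W) x = ev Q x - ev W x.
Proof. exact: mevalB. Qed.

Lemma evM Q W x : ev (Q * W) x = ev Q x * ev W x.
Proof. exact: mevalM. Qed.

Lemma evC c x : ev c%:MP x = c.
Proof. exact: mevalC. Qed.

Lemma evZ c Q x : ev (c *: Q) x = c * ev Q x.
Proof. exact: mevalZ. Qed.

Lemma ev0 x : ev 0 x = 0.
Proof. exact: meval0. Qed.

Lemma evX i x : ev 'X_i x = x 0 i.
Proof. exact: mevalXU. Qed.

Lemma ev_sum I (s : seq I) (P : pred I) (F : I -> {mpoly R[p]}) x :
  ev (\sum_(i <- s | P i) F i) x = \sum_(i <- s | P i) ev (F i) x.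
Proof. exact: (big_morph _ (fun Q W => evD Q W x) (ev0 x)). Qed.

Lemma ev_exp Q n x : ev (Q ^+ n) x = ev Q x ^+ n.
Proof.
elim: n => [|n IH]; first by rewrite !expr0 -mpolyC1 evC.
by rewrite !exprS evM IH.
Qed.

(** Boundedness on the sphere, measurability and the expansion under small rotations all pass to
    sums and products, so they are proved by this induction rather than on monomials. *)
Lemma mpoly_alg_ind (P : {mpoly R[p]} -> Prop) :
  (forall c, P c%:MP) -> (forall i, P 'X_i) ->
  (forall Q W, P Q -> P W -> P (Q + W)) ->
  (forall Q W, P Q -> P W -> P (Q * W)) -> forall Q, P Q.
Proof.
move=> PC PX PD PM; apply: mpolyind => [|c m Q _ _ PQ]; first exact: PC.
apply: (PD) => //; rewrite -mul_mpolyC; apply: (PM) => //.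
rewrite mpolyXE_id; apply: (big_ind P) => [||i _]; [exact: PC|exact: PM|].
elim: (m i) => [|n IH]; first exact: PC.
by rewrite exprS; exact: PM.
Qed.

Lemma mderivXU (i j : 'I_p) : ('X_j)^`M(i) = (i == j)%:R%:MP :> {mpoly R[p]}.
Proof.
rewrite mderivX mnm1E eq_sym; case: eqVneq => [->|_]; last first.
  by rewrite scale0r mpolyC0.
by rewrite scale1r -[X in (X - _)%MM]add0m addmK mpolyX0 mpolyC1.
Qed.

Definition hom (k : nat) Q := all (fun m => mdeg m == k) (msupp Q).

Lemma homE k Q : hom k Q = (Q \is k.-homog).
Proof. by rewrite dhomogE. Qed.

Lemma homD k Q W : hom k Q -> hom k W -> hom k (Q + W).
Proof. by rewrite !homE; exact: dhomogD. Qed.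

Lemma homZ k c Q : hom k Q -> hom k (c *: Q).
Proof. by rewrite !homE; exact: dhomogZ. Qed.

Lemma hom_0 k : hom k 0.
Proof. by rewrite homE; exact: dhomog0. Qed.

Lemma homM k l Q W : hom k Q -> hom l W -> hom (k + l) (Q * W).
Proof. by rewrite !homE; exact: dhomogM. Qed.

Lemma hom_exp k n Q : hom k Q -> hom (k * n) (Q ^+ n).
Proof. by rewrite !homE; exact: dhomogMn. Qed.

Lemma homXU i : hom 1 'X_i.
Proof. by rewrite homE dhomogX/= mdeg1. Qed.

Lemma hom_sum k I (s : seq I) (P : pred I) (F : I -> {mpoly R[p]}) :
  (forall i, P i -> hom k (F i)) -> hom k (\sum_(i <- s | P i) F i).
Proof.
by move=> hF; apply: (big_ind (hom k)) => //; [exact: hom_0|exact: homD].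
Qed.

Lemma hom_deg k Q m : hom k Q -> m \in msupp Q -> mdeg m = k.
Proof. by move=> /allP h /h /eqP. Qed.

Lemma mderiv_expand i Q :
  Q^`M(i) = \sum_(m <- msupp Q) Q@_m *: ((m i)%:R *: 'X_[m - U_(i)]).
Proof.
rewrite {1}[Q]mpolyE linear_sum/=.
by apply: eq_bigr => m _; rewrite mderivZ mderivX.
Qed.

Lemma hom_deriv k i Q : hom k.+1 Q -> hom k Q^`M(i).
Proof.
move=> hQ; rewrite mderiv_expand big_seq_cond; apply: hom_sum => m.
rewrite andbT => /(hom_deg hQ) dm; apply: homZ.
(* The subtraction of exponents is truncated when [X_i] does not occur in [m], but the coefficient
   [m i] is then 0. *)
have [->|mi] := eqVneq (m i) 0%N; first by rewrite scale0r hom_0.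
apply: homZ; rewrite homE dhomogX/= -(eqn_add2r 1) -{1}(mdeg1 i) -mdegD.
by rewrite submK ?lep1mP// dm addn1.
Qed.

Lemma hom0_const Q : hom 0 Q -> exists c, Q = c%:MP.
Proof.
move=> hQ; exists Q@_0; rewrite {1}[Q]mpolyE big_seq.
rewrite (eq_bigr (fun m => (Q@_m * (m == 0%MM)%:R)%:MP)); last first.
  move=> m /(hom_deg hQ) /eqP; rewrite mdeg_eq0 => /eqP ->.
  by rewrite mpolyX0 eqxx mulr1 -mul_mpolyC mulr1.
rewrite -big_seq -rmorph_sum/=; congr (_%:MP).
have [h|h] := boolP (0%MM \in msupp Q); last first.
  have -> : Q@_0 = 0 by apply/eqP; rewrite -[_ == _]negbK -mcoeff_msupp.
  rewrite big_seq big1// => m mQ.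
  by have [m0|_] := eqVneq m 0%MM; rewrite ?mulr0//; rewrite -m0 mQ in h.
rewrite (bigD1_seq 0%MM)//= ?msupp_uniq// eqxx mulr1 big1 ?addr0// => m.
by move=> /negbTE ->; rewrite mulr0.
Qed.

Lemma hom0_deriv i Q : hom 0 Q -> Q^`M(i) = 0.
Proof. by move=> /hom0_const [c ->]; rewrite mderivC. Qed.

Lemma euler k Q : hom k Q -> \sum_i 'X_i * Q^`M(i) = k%:R *: Q.
Proof.
move=> hQ; rewrite [in RHS](mpolyE Q) scaler_sumr.
under eq_bigr do rewrite mderiv_expand mulr_sumr.
rewrite exchange_big/= big_seq [RHS]big_seq; apply: eq_bigr => m /(hom_deg hQ) dm.
rewrite (eq_bigr (fun i => (Q@_m * (m i)%:R) *: 'X_[m])); last first.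
  move=> i _; rewrite -!scalerAr scalerA; have [->|mi] := eqVneq (m i) 0%N.
    by rewrite mulr0 !scale0r.
  by rewrite -mpolyXD addmC submK ?lep1mP.
by rewrite -scaler_suml -mulr_sumr -natr_sum -mdegE dm scalerA mulrC.
Qed.

Definition lap Q := \sum_(i < p) (Q^`M(i))^`M(i).

Lemma lapD Q W : lap (Q + W) = lap Q + lap W.
Proof. by rewrite -big_split/=; apply: eq_bigr => i _; rewrite !mderivD. Qed.

Lemma lapZ c Q : lap (c *: Q) = c *: lap Q.
Proof. by rewrite /lap scaler_sumr; apply: eq_bigr => i _; rewrite !mderivZ. Qed.

Lemma lap0 : lap 0 = 0.
Proof. by rewrite /lap big1// => i _; rewrite !linear0. Qed.

Lemma lap_sum I (s : seq I) (P : pred I) (F : I -> {mpoly R[p]}) :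
  lap (\sum_(i <- s | P i) F i) = \sum_(i <- s | P i) lap (F i).
Proof. exact: (big_morph _ lapD lap0). Qed.

Lemma lap_deriv i Q : lap Q^`M(i) = (lap Q)^`M(i).
Proof.
rewrite /lap linear_sum; apply: eq_bigr => j _.
by rewrite (mderiv_comm i) [in LHS](mderiv_comm i).
Qed.

(** The derivative in the direction of [t]. *)
Definition dird t Q := \sum_(i < p) t 0 i *: Q^`M(i).

Lemma hom_dird k t Q : hom k.+1 Q -> hom k (dird t Q).
Proof.
by move=> hQ; apply: hom_sum => i _; apply: homZ; exact: hom_deriv.
Qed.

Lemma lap_dird t Q : lap Q = 0 -> lap (dird t Q) = 0.
Proof.
by move=> h; rewrite lap_sum big1// => i _; rewrite lapZ lap_deriv h linear0 scaler0.
Qed.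

Lemma lapM Q W : lap (Q * W) =
  lap Q * W + 2 *: (\sum_i Q^`M(i) * W^`M(i)) + Q * lap W.
Proof.
rewrite /lap mulr_suml mulr_sumr scaler_sumr -!big_split/=; apply: eq_bigr => i _.
rewrite !mderivM !mderivD !mderivM scaler_nat mulr2n; ring.
Qed.

Definition lin t : {mpoly R[p]} := \sum_i t 0 i *: 'X_i.
Definition rho : {mpoly R[p]} := \sum_i 'X_i * 'X_i.

Lemma hom_lin t : hom 1 (lin t).
Proof. by apply: hom_sum => i _; apply: homZ; exact: homXU. Qed.

Lemma hom_rho : hom 2 rho.
Proof. by apply: hom_sum => i _; apply: (@homM 1 1); exact: homXU. Qed.

Lemma ev_lin t x : ev (lin t) x = dotp t x.
Proof. by rewrite ev_sum; apply: eq_bigr => i _; rewrite evZ evX. Qed.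

Lemma ev_rho x : ev rho x = dotp x x.
Proof. by rewrite ev_sum; apply: eq_bigr => i _; rewrite evM evX. Qed.

Lemma mderiv_lin i t : (lin t)^`M(i) = (t 0 i)%:MP.
Proof.
rewrite /lin linear_sum (bigD1 i)//= big1 => [|j ji].
  by rewrite mderivZ mderivXU eqxx addr0 -mul_mpolyC mulr1.
by rewrite mderivZ mderivXU eq_sym (negbTE ji) mpolyC0 scaler0.
Qed.

Lemma mderiv_rho i : rho^`M(i) = 2 *: 'X_i.
Proof.
rewrite /rho linear_sum (bigD1 i)//= big1 => [|j ji].
  by rewrite mderivM mderivXU eqxx addr0 mul1r mulr1 scaler_nat mulr2n.
by rewrite mderivM mderivXU eq_sym (negbTE ji) mpolyC0 mul0r mulr0 addr0.
Qed.

Lemma mderiv_exp i Q n : (Q ^+ n)^`M(i) = n%:R *: (Q ^+ n.-1 * Q^`M(i)).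
Proof.
elim: n => [|n IH]; first by rewrite expr0 -mpolyC1 mderivC scale0r.
rewrite exprS mderivM IH/= -scalerAr; case: n {IH} => [|n].
  by rewrite scale0r addr0 !expr0 mulr1 mul1r scale1r.
by rewrite mulrA -exprS (mulrC Q^`M(i)) -[n.+2%:R]/(1 + n.+1%:R) scalerDl scale1r.
Qed.

Lemma lap_lin_exp t a : dotp t t = 1 ->
  lap (lin t ^+ a) = (a * a.-1)%:R *: lin t ^+ a.-2.
Proof.
move=> ht; rewrite /lap.
rewrite (eq_bigr (fun i => (t 0 i * t 0 i) *: ((a * a.-1)%:R *: lin t ^+ a.-2))).
  by rewrite -scaler_suml -/(dotp t t) ht scale1r.
move=> i _; rewrite mderiv_exp mderivZ mderivM mderiv_lin mderivC mulr0 addr0.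
rewrite mderiv_exp mderiv_lin -!(mulrC _%:MP) !mul_mpolyC !scalerA natrM.
by rewrite -?scalerAr ?scalerA; congr (_ *: _); ring.
Qed.

Lemma lap_rho_exp b :
  lap (rho ^+ b.+1) = (2 * b.+1%:R * (p%:R + 2 * b%:R)) *: rho ^+ b.
Proof.
rewrite /lap; under eq_bigr => i _.
  rewrite mderiv_exp mderivZ mderivM mderiv_rho mderivZ mderivXU eqxx mpolyC1.
  rewrite mderiv_exp mderiv_rho/=.
  over.
rewrite -scaler_sumr big_split/=.
rewrite (eq_bigr (fun i => (4 * b%:R) *: (rho ^+ b.-1 * ('X_i * 'X_i)))); last first.
  move=> i _; rewrite -!(scalerAl, scalerAr) !scalerA mulrA; congr (_ *: _); ring.
rewrite -scaler_sumr -mulr_sumr -/rho sumr_const card_ord -scalerAr mulr1.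
have -> : (4 * b%:R) *: (rho ^+ b.-1 * rho) = (4 * b%:R) *: rho ^+ b.
  by case: b => [|b]; [rewrite mulr0 !scale0r|rewrite -exprSr].
by rewrite -scaler_nat scalerA -scalerDl scalerA; congr (_ *: _); ring.
Qed.

(** The gradients of [lin t] and [rho] have scalar product [2 lin t], so the cross term is again a
    multiple of [lin t ^+ a * rho ^+ b]. Only two products occur, which makes the recursion of
    [gegen_coef] possible. *)
Lemma lap_lin_rho t a b : dotp t t = 1 ->
  lap (lin t ^+ a * rho ^+ b.+1) =
  (a * a.-1)%:R *: (lin t ^+ a.-2 * rho ^+ b.+1) +
  (2 * b.+1%:R * (2 * a%:R + p%:R + 2 * b%:R)) *: (lin t ^+ a * rho ^+ b).
Proof.
move=> ht; rewrite lapM lap_lin_exp// lap_rho_exp -scalerAl -addrA; congr (_ + _).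
rewrite -scalerAr (eq_bigr (fun i =>
    (2 * a%:R * b.+1%:R) *: (lin t ^+ a.-1 * rho ^+ b * (t 0 i *: 'X_i)))); last first.
  move=> i _; rewrite !mderiv_exp mderiv_lin mderiv_rho/= (mulrC _ (_%:MP)).
  rewrite mul_mpolyC -!(scalerAl, scalerAr) !scalerA mulrA; congr (_ *: _); ring.
rewrite -scaler_sumr -mulr_sumr -/(lin t) scalerA.
have -> : (2 * (2 * a%:R * b.+1%:R)) *: (lin t ^+ a.-1 * rho ^+ b * lin t) =
   (2 * (2 * a%:R * b.+1%:R)) *: (lin t ^+ a * rho ^+ b).
  case: a => [|a]; first by rewrite mulr0 mul0r mulr0 !scale0r.
  by rewrite /= [_ * rho ^+ b * _]mulrAC -exprSr.
by rewrite -scalerDl; congr (_ *: _); ring.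
Qed.

(** Each coefficient is chosen so that the lower-order part of the Laplacian of its term cancels the
    first part of the Laplacian of the previous term. *)
Fixpoint gegen_coef (m j : nat) : R :=
  if j is i.+1 then
    - gegen_coef m i * ((m - i.*2) * (m - i.*2).-1)%:R /
      (2 * i.+1%:R * (2 * (m - i.+1.*2)%:R + p%:R + 2 * i%:R))
  else 1.

(** Up to a factor, the zonal harmonic with pole [t]: the homogenization of the Gegenbauer
    polynomial of degree [m] in [t.x] (Chebyshev for [p = 2]), with leading coefficient 1. *)
Definition zonal (m : nat) t : {mpoly R[p]} :=
  \sum_(j < m./2.+1) gegen_coef m j *: (lin t ^+ (m - j.*2) * rho ^+ j).

Lemma hom_zonal m t : hom m (zonal m t).
Proof.
apply: hom_sum => j _; apply: homZ.
have jm : (j.*2 <= m)%N.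
  have := ltn_ord j; rewrite ltnS -leq_double => /leq_trans; apply.
  by rewrite -[leqRHS]odd_double_half leq_addl.
have e : (1 * (m - j.*2) + 2 * j = m)%N by rewrite mul1n mul2n subnK.
rewrite -[X in hom X _]e.
by apply: homM; apply: hom_exp; [exact: hom_lin|exact: hom_rho].
Qed.

Lemma lap_zonal m t : (0 < p)%N -> dotp t t = 1 -> lap (zonal m t) = 0.
Proof.
move=> p0 ht; rewrite /zonal lap_sum.
pose f j := (gegen_coef m j * ((m - j.*2) * (m - j.*2).-1)%:R) *:
   (lin t ^+ (m - j.*2).-2 * rho ^+ j).
rewrite big_ord_recl/= subn0 expr0 mulr1 scale1r lap_lin_exp//.
(* The sum telescopes, and only the last [f] is left. *)
rewrite (eq_bigr (fun i : 'I_m./2 => f i.+1 - f i)).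
  have -> : (m * m.-1)%:R *: lin t ^+ m.-2 = f 0%N.
    by rewrite /f subn0 mul1r expr0 mulr1.
  rewrite sumrB addrA.
  have -> : f 0%N + \sum_(i < m./2) f i.+1 = \sum_(i < m./2.+1) f i.
    by rewrite big_ord_recl.
  rewrite big_ord_recr/= addrAC subrr add0r /f.
  (* The last exponent of [lin t] is 0 or 1, so its second derivative vanishes. *)
  have -> : (m - m./2.*2 = odd m)%N by rewrite -{1}(odd_double_half m) addnK.
  by case: (odd m); rewrite !(muln0, mul0n) mulr0 scale0r.
move=> i _; rewrite lapZ /bump leq0n add1n lap_lin_rho// scalerDr !scalerA.
rewrite {1}/f; congr (_ + _); rewrite /f -scaleNr.
have -> : (m - i.+1.*2 = (m - i.*2).-2)%N by rewrite doubleS -addn2 subnDA subn2.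
congr (_ *: _); rewrite -mulNr /= add0n.
rewrite divfK// mulf_neq0// ?mulf_neq0 ?pnatr_eq0// gt_eqF//.
by rewrite ltr_wpDr ?mulr_ge0// ltr_wpDl ?mulr_ge0// ltr0n.
Qed.

Lemma ev_zonal m t x : sphere x ->
  ev (zonal m t) x = dotp t x ^+ m +
    \sum_(j < m./2) gegen_coef m j.+1 * dotp t x ^+ (m - j.+1.*2).
Proof.
move=> hx; have xx : dotp x x = 1.
  rewrite -[LHS]sqr_sqrtr; last by apply: sumr_ge0 => i _; rewrite -expr2 sqr_ge0.
  by rewrite -/(enorm x) (hx : enorm x = 1) expr1n.
rewrite /zonal ev_sum big_ord_recl; congr (_ + _).
  by rewrite evZ evM !ev_exp ev_lin subn0 expr0 mulr1 mul1r.
apply: eq_bigr => j _; rewrite evZ evM !ev_exp ev_lin ev_rho xx expr1n mulr1.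
by rewrite /= /bump leq0n add1n.
Qed.

End homogeneous.

(** * Finite sums of spherical harmonics *)

Section spans_of_harmonics.
Context {R : realType} {p : nat}.
Implicit Types (f : 'rV[R]_p -> R) (x t : 'rV[R]_p).

Lemma spherical_harmonicP k f : spherical_harmonic k f <->
  exists Q : {mpoly R[p]}, [/\ hom k Q, lap Q = 0 & forall x, sphere x -> f x = ev Q x].
Proof. by []. Qed.

(** One harmonic per degree is enough, since those of a given degree are closed under sums. The
    equality holds on the sphere only, where [rho] is 1. *)
Definition harmonic_span (N : nat) f := exists g : nat -> 'rV[R]_p -> R,
  (forall k, spherical_harmonic k (g k)) /\
  forall x, sphere x -> f x = \sum_(k < N) g k x.

Lemma spherical_harmonic0 k : spherical_harmonic k (fun _ : 'rV[R]_p => 0 : R).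
Proof.
apply/spherical_harmonicP; exists 0; split; [exact: hom_0|exact: lap0|].
by move=> x _; rewrite ev0.
Qed.

Lemma harmonic_spanD N f g : harmonic_span N f -> harmonic_span N g ->
  harmonic_span N (fun x => f x + g x).
Proof.
move=> [a [ha fa]] [b [hb gb]]; exists (fun k x => a k x + b k x); split.
  move=> k; have /spherical_harmonicP[Q [Q1 Q2 Q3]] := ha k.
  have /spherical_harmonicP[W [W1 W2 W3]] := hb k.
  apply/spherical_harmonicP; exists (Q + W); split; first exact: homD.
    by rewrite lapD Q2 W2 addr0.
  by move=> x hx; rewrite evD Q3// W3.
by move=> x hx; rewrite fa// gb// big_split.
Qed.

Lemma harmonic_spanZ N c f : harmonic_span N f ->
  harmonic_span N (fun x => c * f x).
Proof.
move=> [a [ha fa]]; exists (fun k x => c * a k x); split.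
  move=> k; have /spherical_harmonicP[Q [Q1 Q2 Q3]] := ha k.
  apply/spherical_harmonicP; exists (c *: Q); split; first exact: homZ.
    by rewrite lapZ Q2 scaler0.
  by move=> x hx; rewrite evZ Q3.
by move=> x hx; rewrite fa// mulr_sumr.
Qed.

Lemma harmonic_span0 N : harmonic_span N (fun=> 0).
Proof.
exists (fun _ _ => 0); split; first exact: spherical_harmonic0.
by move=> x _; rewrite big1.
Qed.

Lemma harmonic_span_sum N I (s : seq I) (P : pred I) (F : I -> 'rV[R]_p -> R) :
  (forall i, P i -> harmonic_span N (F i)) ->
  harmonic_span N (fun x => \sum_(i <- s | P i) F i x).
Proof.
move=> hF; elim: s => [|i s [g [hg1 hg2]]].
  have [g [hg1 hg2]] := harmonic_span0 N; exists g; split => // x hx.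
  by rewrite big_nil; exact: hg2.
have [Pi|Pi] := boolP (P i).
  have [g' [hg1' hg2']] := harmonic_spanD (hF i Pi) (ex_intro _ g (conj hg1 hg2)).
  by exists g'; split => // x hx; rewrite big_cons Pi hg2'.
by exists g; split => // x hx; rewrite big_cons (negbTE Pi) hg2.
Qed.

Lemma harmonic_spanW N M f : (N <= M)%N -> harmonic_span N f -> harmonic_span M f.
Proof.
move=> NM [g [hg1 hg2]].
exists (fun k => if (k < N)%N then g k else fun=> 0); split.
  by move=> k; case: ifP => // _; exact: spherical_harmonic0.
move=> x hx; rewrite hg2//.
rewrite (big_ord_widen M (fun k => g k x) NM) big_mkcond/=.
by apply: eq_bigr => k _; case: ifP.
Qed.

(** Strong induction on [m]: on the sphere, [(t.x)^m] is the zonal polynomial minus lower powers of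
    [t.x]. *)
Lemma harmonic_span_dotp (m : nat) t : (0 < p)%N -> dotp t t = 1 ->
  harmonic_span m.+1 (fun x => dotp t x ^+ m).
Proof.
move=> p0 ht; elim/ltn_ind: m => m IH.
have hZ : harmonic_span m.+1 (ev (zonal m t)).
  exists (fun k => if k == m then ev (zonal m t) else fun=> 0); split.
    move=> k; case: eqVneq => [->|_]; last exact: spherical_harmonic0.
    apply/spherical_harmonicP; exists (zonal m t).
    by split => //; [exact: hom_zonal|exact: lap_zonal].
  move=> x hx; rewrite big_ord_recr/= eqxx big1 ?add0r// => k _.
  by rewrite ltn_eqF.
have hS : harmonic_span m.+1 (fun x =>
    \sum_(j < m./2) @gegen_coef R p m j.+1 * dotp t x ^+ (m - j.+1.*2)).
  apply: (@harmonic_span_sum _ _ _ _ (fun (j : 'I_m./2) x =>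
    @gegen_coef R p m j.+1 * dotp t x ^+ (m - j.+1.*2))) => j _.
  apply: harmonic_spanZ.
  have m0 : (0 < m)%N by case: m {IH hZ} j => // -[].
  apply: (@harmonic_spanW (m - j.+1.*2).+1); first by rewrite ltnS leq_subr.
  by apply: IH; rewrite -subn_gt0 subKn// -[leqRHS]odd_double_half
     (leq_trans _ (leq_addl _ _))// leq_double.
have [g [hg1 hg2]] := harmonic_spanD hZ (harmonic_spanZ (-1) hS).
exists g; split => // x hx; rewrite -hg2// ev_zonal// mulN1r addrK//.
Qed.

End spans_of_harmonics.
End HomogeneousPolynomials.

Import -(notations) mpoly.
From mathcomp Require Import all_classical all_reals all_analysis.
From mathcomp Require Import measurable_realfun.
Import Order.TTheory GRing.Theory Num.Theory.
Import numFieldTopology.Exports numFieldNormedType.Exports.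
Local Open Scope classical_set_scope.
Local Open Scope ring_scope.

(** * Bounded measurable functions *)

Section bounded_measurable.
Context {d : measure_display} {T : measurableType d} {R : realType}.

(** Bounded everywhere and not only almost everywhere, so that products, compositions and sections
    of such functions are of the same kind. *)
Definition bmf (f : T -> R) :=
  measurable_fun setT f /\ exists M, forall x, `|f x| <= M.

Lemma bmf_cst (c : R) : bmf (fun=> c).
Proof. by split; [exact: measurable_cst|exists `|c|]. Qed.

Lemma bmfD (f g : T -> R) : bmf f -> bmf g -> bmf (fun x => f x + g x).
Proof.
move=> [mf [M hM]] [mg [N hN]]; split; first exact: measurable_funD.
by exists (M + N) => x; rewrite (le_trans (ler_normD _ _))// lerD.
Qed.

Lemma bmfN (f : T -> R) : bmf f -> bmf (fun x => - f x).
Proof.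
move=> [mf [M hM]]; split; first exact: measurableT_comp.
by exists M => x; rewrite normrN.
Qed.

Lemma bmfB (f g : T -> R) : bmf f -> bmf g -> bmf (fun x => f x - g x).
Proof. by move=> hf hg; apply: bmfD => //; exact: bmfN. Qed.

Lemma bmfM (f g : T -> R) : bmf f -> bmf g -> bmf (fun x => f x * g x).
Proof.
move=> [mf [M hM]] [mg [N hN]]; split; first exact: measurable_funM.
by exists (M * N) => x; rewrite normrM ler_pM.
Qed.

Lemma bmfZ (c : R) (f : T -> R) : bmf f -> bmf (fun x => c * f x).
Proof. by move=> hf; apply: bmfM => //; exact: bmf_cst. Qed.

Lemma bmfX (f : T -> R) (n : nat) : bmf f -> bmf (fun x => f x ^+ n).
Proof.
move=> hf; elim: n => [|n IH]; first exact: bmf_cst.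
by under eq_fun do rewrite exprS; exact: bmfM.
Qed.

Lemma bmf_sum I (s : seq I) (Q : pred I) (f : I -> T -> R) :
  (forall i, Q i -> bmf (f i)) -> bmf (fun x => \sum_(i <- s | Q i) f i x).
Proof.
move=> hf; elim: s => [|i s IH].
  by under eq_fun do rewrite big_nil; exact: bmf_cst.
under eq_fun do rewrite big_cons.
by have [Qi|//] := boolP (Q i); apply: bmfD => //; exact: hf.
Qed.

Lemma bmf_prod I (s : seq I) (Q : pred I) (f : I -> T -> R) :
  (forall i, Q i -> bmf (f i)) -> bmf (fun x => \prod_(i <- s | Q i) f i x).
Proof.
move=> hf; elim: s => [|i s IH].
  by under eq_fun do rewrite big_nil; exact: bmf_cst.
under eq_fun do rewrite big_cons.
by have [Qi|//] := boolP (Q i); apply: bmfM => //; exact: hf.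
Qed.

Lemma bmf_norm (f : T -> R) : bmf f -> bmf (fun x => `|f x|).
Proof.
move=> [mf [M hM]]; split; first exact: measurableT_comp.
by exists M => x; rewrite normr_id.
Qed.

Lemma bmf_indic (A : set T) : measurable A -> bmf (\1_A : T -> R).
Proof.
move=> mA; split; first exact: measurable_indic.
by exists 1 => x; rewrite indicE; case: (_ \in _); rewrite ?normr1 ?normr0.
Qed.

Lemma continuous_bounded_on (g : R -> R) (M : R) : continuous g ->
  exists N, forall y, `|y| <= M -> `|g y| <= N.
Proof.
move=> cg.
have [M0|M0] := leP 0 M; last first.
  by exists 0 => y yM; move: (le_lt_trans yM M0); rewrite ltNge normr_ge0.
have MM : - M <= M by rewrite (le_trans _ M0)// oppr_le0.
have cgn : {within `[-M, M], continuous (fun y => `|g y|)}.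
  by apply: continuous_subspaceT => x; apply: continuous_comp; [exact: cg|exact: norm_continuous].
have [c _ hc] := @EVT_max R (fun y => `|g y|) (-M) M MM cgn.
by exists `|g c| => y; rewrite ler_norml => yM; apply: hc; rewrite in_itv.
Qed.

Lemma bmf_continuous (g : R -> R) (f : T -> R) :
  continuous g -> bmf f -> bmf (fun x => g (f x)).
Proof.
move=> cg [mf [M hM]]; split.
  by apply: measurableT_comp => //; exact: continuous_measurable_fun.
by have [N hN] := @continuous_bounded_on g M cg; exists N => x; exact: hN.
Qed.

End bounded_measurable.

Section bounded_integral.
Context {d : measure_display} {T : measurableType d} {R : realType}.
Variable P : probability T R.

Lemma bmf_integrable (f : T -> R) : bmf f -> P.-integrable setT (EFin \o f).
Proof.
move=> [mf [M hM]]; apply: (@le_integrable _ _ _ P setT _ _ (EFin \o cst M)) => //.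
- exact/measurable_EFinP.
- by move=> x _ /=; rewrite lee_fin (le_trans (hM x))// ler_norm.
- exact: finite_measure_integrable_cst.
Qed.

Lemma bintE (f : T -> R) : bmf f ->
  (\int[P]_x (f x)%:E)%E = (\int[P]_x f x)%:E.
Proof.
move=> hf; rewrite /Rintegral fineK//.
exact: integrable_fin_num (bmf_integrable hf).
Qed.

Lemma bint_cst (c : R) : \int[P]_x c = c.
Proof.
have PT : (P : {measure set T -> \bar R}) setT = 1%E := probability_setT P.
by rewrite Rintegral_cst// PT/= mulr1.
Qed.

Lemma bintD (f g : T -> R) : bmf f -> bmf g ->
  \int[P]_x (f x + g x) = \int[P]_x f x + \int[P]_x g x.
Proof. by move=> hf hg; rewrite RintegralD//; exact: bmf_integrable. Qed.

Lemma bintB (f g : T -> R) : bmf f -> bmf g ->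
  \int[P]_x (f x - g x) = \int[P]_x f x - \int[P]_x g x.
Proof. by move=> hf hg; rewrite RintegralB//; exact: bmf_integrable. Qed.

Lemma bintZ (c : R) (f : T -> R) : bmf f ->
  \int[P]_x (c * f x) = c * \int[P]_x f x.
Proof. by move=> hf; rewrite RintegralZl//; exact: bmf_integrable. Qed.

Lemma bintZr (c : R) (f : T -> R) : bmf f ->
  \int[P]_x (f x * c) = \int[P]_x f x * c.
Proof. by move=> hf; rewrite RintegralZr//; exact: bmf_integrable. Qed.

Lemma bint_sum I (s : seq I) (Q : pred I) (f : I -> T -> R) :
  (forall i, Q i -> bmf (f i)) ->
  \int[P]_x (\sum_(i <- s | Q i) f i x) = \sum_(i <- s | Q i) \int[P]_x f i x.
Proof.
move=> hf; elim: s => [|i s IH].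
  by under eq_Rintegral do rewrite big_nil; rewrite bint_cst big_nil.
rewrite big_cons; under eq_Rintegral do rewrite big_cons.
have [Qi|//] := boolP (Q i).
by rewrite bintD ?IH//; [exact: hf|exact: bmf_sum].
Qed.

Lemma bint_le (f g : T -> R) : bmf f -> bmf g -> (forall x, f x <= g x) ->
  \int[P]_x f x <= \int[P]_x g x.
Proof. by move=> hf hg fg; apply: le_Rintegral => //; exact: bmf_integrable. Qed.

Lemma bint_norm (f : T -> R) : bmf f ->
  `|\int[P]_x f x| <= \int[P]_x `|f x|.
Proof. by move=> hf; apply: le_normr_Rintegral => //; exact: bmf_integrable. Qed.

Lemma bint_norm_le (f : T -> R) (M : R) : bmf f -> (forall x, `|f x| <= M) ->
  `|\int[P]_x f x| <= M.
Proof.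
move=> hf hM; rewrite (le_trans (bint_norm hf))//.
rewrite -[leRHS]bint_cst; apply: bint_le => //; first exact: bmf_norm.
exact: bmf_cst.
Qed.

Lemma bint_ge0 (f : T -> R) : (forall x, 0 <= f x) -> 0 <= \int[P]_x f x.
Proof. by move=> f0; exact: Rintegral_ge0. Qed.

End bounded_integral.

Section bounded_fubini.
Context {d1 d2 : measure_display} {T1 : measurableType d1}
  {T2 : measurableType d2} {R : realType}.
Variables (P1 : probability T1 R) (P2 : probability T2 R).
Variable h : T1 -> T2 -> R.
Hypothesis hh : bmf (fun xy : T1 * T2 => h xy.1 xy.2).

Lemma bmf_sec1 y : bmf (fun x => h x y).
Proof.
case: hh => mh [M hM]; split; last by exists M => x; exact: (hM (x, y)).
exact: (measurableT_comp mh (pair2_measurable y)).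
Qed.

Lemma bmf_sec2 x : bmf (h x).
Proof.
case: hh => mh [M hM]; split; last by exists M => y; exact: (hM (x, y)).
exact: (measurableT_comp mh (pair1_measurable x)).
Qed.

Let hP := bmf_integrable (P1 \x P2)%E hh.

Lemma bmf_int2 : bmf (fun x => \int[P2]_y h x y).
Proof.
split; last first.
  case: hh => mh [M hM]; exists M => x; apply: bint_norm_le => [|y].
    exact: bmf_sec2.
  exact: (hM (x, y)).
have := measurable_fubini_F hP; rewrite /fubini_F /= => m.
apply/measurable_EFinP; apply: eq_measurable_fun m => x _ /=.
exact/bintE/bmf_sec2.
Qed.

Lemma bmf_int1 : bmf (fun y => \int[P1]_x h x y).
Proof.
split; last first.
  case: hh => mh [M hM]; exists M => y; apply: bint_norm_le => [|x].
    exact: bmf_sec1.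
  exact: (hM (x, y)).
have := measurable_fubini_G hP; rewrite /fubini_G /= => m.
apply/measurable_EFinP; apply: eq_measurable_fun m => y _ /=.
exact/bintE/bmf_sec1.
Qed.

Lemma bfubini :
  \int[P1]_x \int[P2]_y h x y = \int[P2]_y \int[P1]_x h x y.
Proof.
have := Fubini hP => /=.
under eq_integral do rewrite (bintE _ (bmf_sec2 _)).
under [RHS]eq_integral do rewrite (bintE _ (bmf_sec1 _)).
by rewrite (bintE _ bmf_int2) (bintE _ bmf_int1) => -[].
Qed.

End bounded_fubini.

(** * The sphere as a Borel set *)

Section layer_cake.
Context {R : realType}.

(** The sum is the integer part of [t]. *)
Lemma layer_count (m : nat) (t : R) : 0 <= t <= m%:R ->
  `|t - \sum_(k < m) (k.+1%:R <= t)%R%:R| <= 1.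
Proof.
elim: m => [|m IH] /andP[t0 tm].
  rewrite big_ord0 subr0; have -> : t = 0 by apply/le_anti; rewrite t0 tm.
  by rewrite normr0 ler01.
rewrite big_ord_recr/=; have [tm'|mt] := leP t m%:R.
  have /negbTE-> : ~~ (m.+1%:R <= t).
    by rewrite -ltNge (le_lt_trans tm')// ltr_nat.
  by rewrite addr0; apply: IH; rewrite t0.
rewrite (eq_bigr (fun=> 1)); last first.
  move=> k _; suff -> : k.+1%:R <= t by [].
  by rewrite (le_trans _ (ltW mt))// ler_nat.
rewrite sumr_const card_ord; case: (leP m.+1%:R t) => h.
  have -> : t = m.+1%:R by apply/le_anti; rewrite tm h.
  by rewrite -natrD addn1 subrr normr0 ler01.
by rewrite addr0 ger0_norm ?lerBlDr ?subr_ge0 -?(natrD _ 1 m) ?add1n// ltW.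
Qed.

Context {d : measure_display} {T : measurableType d}.

(** [(f - c) / e] is rounded down to an integer, which counts the level sets that contain the
    point. *)
Lemma bmf_layer (f : T -> R) (e : R) : bmf f -> 0 < e ->
  exists m c (A : nat -> set T), (forall k, measurable (A k)) /\
  forall x, `|f x - (c + e * \sum_(k < m) \1_(A k) x)| <= e.
Proof.
move=> [mf [M hM]] e0.
(* Since [N e >= M], the function [f - c] with [c = - N e] takes its values in [[0, 2 N e]], hence
   [N + N] levels. *)
pose N := (Num.truncn (M / e)).+1.
have MN : M <= N%:R * e.
  rewrite -ler_pdivrMr//; have [h|h] := leP 0 (M / e).
    by rewrite ltW// truncnS_gt.
  by rewrite (le_trans (ltW h)).
pose c := - (N%:R * e).
pose A k := [set x | c + e * k.+1%:R <= f x].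
exists (N + N)%N, c, A; split.
  move=> k; rewrite /A -[X in measurable X]setTI.
  have -> : [set x | c + e * k.+1%:R <= f x] = f @^-1` `[c + e * k.+1%:R, +oo[.
    by apply/seteqP; split => x /=; rewrite in_itv/= andbT.
  by apply: mf.
move=> x; set t := (f x - c) / e.
have fx : f x = c + e * t by rewrite /t mulrCA divff ?gt_eqF// mulr1 addrC subrK.
have := hM x; rewrite ler_norml => /andP[h1 h2].
have t01 : 0 <= t <= (N + N)%:R.
  apply/andP; split.
    by rewrite divr_ge0 ?(ltW e0)// subr_ge0 /c; lra.
  by rewrite ler_pdivrMr// lerBlDr /c natrD; nra.
have -> : \sum_(k < N + N) \1_(A k) x = \sum_(k < N + N) (k.+1%:R <= t)%R%:R :> R.
  apply: eq_bigr => k _; rewrite indicE; congr (_%:R : R); congr nat_of_bool.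
  apply/idP/idP => [/set_mem|h]; first by rewrite /A/= fx lerD2l ler_pM2l.
  by apply/mem_set; rewrite /A/= fx lerD2l ler_pM2l.
have -> : f x - (c + e * \sum_(k < N + N) (k.+1%:R <= t)%R%:R) =
          e * (t - \sum_(k < N + N) (k.+1%:R <= t)%R%:R) by rewrite fx; ring.
by rewrite normrM (gtr0_norm e0) -[leRHS]mulr1 ler_pM2l// layer_count.
Qed.

(** Finite sums of indicators are uniformly dense, and [L] is continuous for the uniform norm. This
    plays the part of a monotone class theorem: [L] will be the difference of the two sides of an
    identity, for laws, densities and independence. *)
Lemma bmf_functional_eq0 (L : (T -> R) -> R) (C : R) :
  (forall f g, bmf f -> bmf g -> L (fun x => f x + g x) = L f + L g) ->
  (forall c f, bmf f -> L (fun x => c * f x) = c * L f) ->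
  (forall f e, bmf f -> (forall x, `|f x| <= e) -> `|L f| <= C * e) ->
  (forall A, measurable A -> L (\1_A) = 0) ->
  forall f, bmf f -> L f = 0.
Proof.
move=> LD LZ Lb L1 f hf.
have C0 : 0 <= C.
  have := Lb (fun=> 0) 1 (bmf_cst 0).
  by rewrite mulr1 => /(_ _)/(le_trans (normr_ge0 _)); apply => x; rewrite normr0.
have Lc c : L (fun=> c) = 0.
  have -> : (fun=> c) = (fun x : T => c * \1_(@setT T) x).
    by apply/funext => x; rewrite indicE in_setT mulr1.
  by rewrite LZ ?L1 ?mulr0//; exact: bmf_indic.
have Ls m (A : nat -> set T) : (forall k, measurable (A k)) ->
    L (fun x => \sum_(k < m) \1_(A k) x) = 0.
  move=> mA; elim: m => [|m IH].
    by rewrite -(Lc 0); congr L; apply/funext => x; rewrite big_ord0.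
  under eq_fun do rewrite big_ord_recr/=.
  rewrite LD ?IH ?L1 ?addr0//; last exact: bmf_indic.
  by apply: bmf_sum => k _; exact: bmf_indic.
apply/eqP; rewrite -normr_le0; apply/ler_addgt0Pl => e e0; rewrite addr0.
(* The [+ 1] keeps the divisor positive when [C] is 0. *)
pose e' := e / (C + 1).
have C1 : 0 < C + 1 by rewrite ltr_wpDl.
have e'0 : 0 < e' by rewrite divr_gt0.
have [m [c [A [mA hA]]]] := bmf_layer hf e'0.
pose g x := c + e' * \sum_(k < m) \1_(A k) x.
have bs : bmf (fun x => \sum_(k < m) \1_(A k) x : R).
  by apply: bmf_sum => k _; exact: bmf_indic.
have hg : bmf g by apply: bmfD; [exact: bmf_cst|exact: bmfZ].
have Lg : L g = 0.
  by rewrite /g LD ?Lc ?LZ ?Ls ?mulr0 ?addr0//; [exact: bmf_cst|exact: bmfZ].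
have -> : L f = L (fun x => f x - g x).
  have -> : (fun x => f x - g x) = (fun x => f x + (-1) * g x).
    by apply/funext => x; rewrite mulN1r.
  by rewrite LD ?LZ ?Lg ?mulr0 ?addr0//; exact: bmfZ.
rewrite (le_trans (Lb _ _ (bmfB hf hg) hA))//.
rewrite /e' mulrCA -[leRHS]mulr1 ler_pM2l// ler_pdivrMr// mul1r lerDl ler01 //.
Qed.

End layer_cake.

Section borel_row_vectors.
Context {R : realType} {p : nat}.

Lemma continuous_measurable_rV (f : 'rV[R]_p -> R) :
  continuous f -> measurable_fun setT f.
Proof.
move=> /continuousP cf; apply: (measurability _ (RGenOpens.measurableE R)) => //.
move=> _ [B [a [b Bab] ] <-]; rewrite setTI.
by apply: sub_sigma_algebra; apply: cf; rewrite Bab; exact: interval_open.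
Qed.

Lemma measurable_coord (i : 'I_p) : measurable_fun setT (fun x : 'rV[R]_p => x 0 i).
Proof. by apply: continuous_measurable_rV; exact: coord_continuous. Qed.

Lemma measurable_map_rV (f : 'rV[R]_p -> 'rV[R]_p) :
  continuous f -> measurable_fun setT f.
Proof.
move=> /continuousP cf.
apply: (measurability (@open 'rV[R]_p)) => // _ [B oB <-]; rewrite setTI.
by apply: sub_sigma_algebra; exact: cf.
Qed.

Lemma mulmx_continuous (O : 'M[R]_p) : continuous (fun x : 'rV[R]_p => x *m O).
Proof.
have -> : (fun x : 'rV[R]_p => x *m O) = (fun x => \sum_i x 0 i *: row i O).
  by apply/funext => x; rewrite mulmx_sum_row.
apply: continuous_big => [|i _ x]; first exact: add_continuous.
apply: cvgZr_tmp; first exact: (nbhs_filter x).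
exact: coord_continuous.
Qed.

Lemma measurable_dotp {d} {T : measurableType d} (f g : T -> 'rV[R]_p) :
  measurable_fun setT f -> measurable_fun setT g ->
  measurable_fun setT (fun w => dotp (f w) (g w)).
Proof.
move=> mf mg; apply: measurable_sum => i; apply: measurable_funM.
  exact: (measurableT_comp (measurable_coord i) mf).
exact: (measurableT_comp (measurable_coord i) mg).
Qed.

Lemma measurable_enorm : measurable_fun setT (@enorm R p).
Proof.
have ms : measurable_fun setT (Num.sqrt : R -> R).
  by apply: continuous_measurable_fun; exact: sqrt_continuous.
have md : measurable_fun setT (fun x : 'rV[R]_p => dotp x x).
  exact: measurable_dotp.
exact: (measurableT_comp ms md).
Qed.

Lemma measurable_sphere : measurable (@sphere R p).
Proof.
have := measurable_enorm measurableT (@measurable_set1 _ (1:R)).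
by rewrite setTI.
Qed.

Lemma dotpC (x y : 'rV[R]_p) : dotp x y = dotp y x.
Proof. by apply: eq_bigr => i _; rewrite mulrC. Qed.

Lemma dotp_ge0 (x : 'rV[R]_p) : 0 <= dotp x x.
Proof. by apply: sumr_ge0 => i _; rewrite -expr2 sqr_ge0. Qed.

Lemma sphereP (x : 'rV[R]_p) : sphere x <-> dotp x x = 1.
Proof.
rewrite /sphere/= /enorm; split => [h|->]; last by rewrite sqrtr1.
by rewrite -(sqr_sqrtr (dotp_ge0 x)) h expr1n.
Qed.

(** Cauchy-Schwarz for unit vectors: expand [|x - e y|^2 >= 0] for [e = 1] and [e = -1]. *)
Lemma dotp_norm_le (x y : 'rV[R]_p) : sphere x -> sphere y -> `|dotp x y| <= 1.
Proof.
move=> /sphereP hx /sphereP hy.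
have key (e : R) : e ^+ 2 = 1 -> e * dotp x y <= 1.
  move=> e1; have : 0 <= \sum_i (x 0 i - e * y 0 i) ^+ 2.
    by apply: sumr_ge0 => i _; rewrite sqr_ge0.
  have -> : \sum_i (x 0 i - e * y 0 i) ^+ 2 =
      dotp x x - 2 * (e * dotp x y) + e ^+ 2 * dotp y y.
    rewrite /dotp !mulr_sumr -sumrB -big_split/=.
    by apply: eq_bigr => i _; ring.
  by rewrite e1 hx hy; lra.
rewrite ler_norml; apply/andP; split; last first.
  by have := key 1 (expr1n _ _); rewrite mul1r.
by have := key (-1); rewrite sqrrN expr1n mulN1r => /(_ erefl); lra.
Qed.

Lemma coord_norm_le (x : 'rV[R]_p) i : sphere x -> `|x 0 i| <= 1.
Proof.
move=> /sphereP hx; rewrite -(ler_sqr (x := `|x 0 i|)) ?nnegrE// expr1n.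
rewrite real_normK ?num_real// -hx /dotp (bigD1 i)//= expr2 lerDl.
by apply: sumr_ge0 => j _; rewrite -expr2 sqr_ge0.
Qed.

End borel_row_vectors.

Section sphere_projection.
Context {R : realType} {p : nat}.
Hypothesis p_gt0 : (0 < p)%N.

Definition pole : 'rV[R]_p := delta_mx 0 (Ordinal p_gt0).

Lemma sphere_pole : sphere pole.
Proof.
apply/sphereP; rewrite /dotp (bigD1 (Ordinal p_gt0))//= mxE !eqxx mulr1.
by rewrite big1 ?addr0// => i /negbTE h; rewrite mxE h andbF mulr0.
Qed.

(** Not the radial projection: the complement of the sphere, a null set, is sent to one point. Then
    [f \o sproj] is bounded as soon as [f] is bounded on the sphere, and its integral is that of [f]
    over the sphere. *)
Definition sproj (x : 'rV[R]_p) := if x \in sphere then x else pole.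

Lemma sphere_sproj x : sphere (sproj x).
Proof. by rewrite /sproj; case: ifPn => [/set_mem//|_]; exact: sphere_pole. Qed.

Lemma sproj_id x : sphere x -> sproj x = x.
Proof. by move=> /mem_set hx; rewrite /sproj hx. Qed.

Lemma measurable_sproj : measurable_fun setT sproj.
Proof.
apply: measurable_fun_ifT => //.
apply: (measurable_fun_bool true) => //=.
rewrite setTI; have -> : mem sphere @^-1` [set true] = @sphere R p.
  by apply/seteqP; split => x /=; [move/set_mem|move/mem_set].
exact: measurable_sphere.
Qed.

Variable nu : probability 'rV[R]_p R.
Hypothesis nu_sphere : nu sphere = 1%E.

Lemma sphere_RintegralT (f : 'rV[R]_p -> R) : bmf f ->
  \int[nu]_(x in sphere) f x = \int[nu]_x f x.
Proof.
move=> hf; have mS := @measurable_sphere R p.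
rewrite -(setUv (@sphere R p)) Rintegral_setU//; last 3 first.
- exact: measurableC.
- by rewrite setUv; exact: bmf_integrable hf.
- by apply/disj_setPS => x [].
have nuC : nu (~` sphere) = 0%E.
  by have := probability_setC nu mS; rewrite nu_sphere subee.
rewrite [X in _ = _ + X](_ : _ = 0) ?addr0//.
rewrite /Rintegral (_ : (\int[nu]_(x in ~` sphere) (f x)%:E)%E = 0%E)//.
apply: null_set_integral => //; first exact: measurableC.
by apply/measurable_EFinP; apply: measurable_funTS; case: hf.
Qed.

Lemma sphere_Rintegral (f : 'rV[R]_p -> R) : bmf (f \o sproj) ->
  \int[nu]_(x in sphere) f x = \int[nu]_x f (sproj x).
Proof.
move=> hf; rewrite -(sphere_RintegralT hf).
by apply: eq_Rintegral => x /set_mem hx; rewrite /= sproj_id.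
Qed.

End sphere_projection.

Lemma bmf_comp {d d'} {T : measurableType d} {E : measurableType d'}
    {R : realType} (X : T -> E) (f : E -> R) :
  measurable_fun setT X -> bmf f -> bmf (fun w => f (X w)).
Proof.
move=> mX [mf [M hM]]; split; first exact: measurableT_comp.
by exists M => w; exact: hM.
Qed.

(** * Integrals determined by laws and densities *)

Section laws.
Context {d d' : measure_display} {Omega : measurableType d}
  {E : measurableType d'} {R : realType}.
Variable P : probability Omega R.

Lemma int_indic_preimage (X : Omega -> E) (A : set E) :
  measurable_fun setT X -> measurable A ->
  \int[P]_w (\1_A (X w) : R) = fine (P (X @^-1` A)).
Proof.
move=> mX mA; rewrite /Rintegral; congr fine.
have mXA : measurable (X @^-1` A).
  by rewrite -[X in measurable X]setTI; exact: mX.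
by have := integral_indic P measurableT mXA; rewrite setIT => <-.
Qed.

Lemma same_law_int (X Y : Omega -> E) (f : E -> R) :
  measurable_fun setT X -> measurable_fun setT Y ->
  (forall A, measurable A -> P (X @^-1` A) = P (Y @^-1` A)) -> bmf f ->
  \int[P]_w f (X w) = \int[P]_w f (Y w).
Proof.
move=> mX mY XY hf; apply/eqP; rewrite -subr_eq0; apply/eqP.
pose L (g : E -> R) := \int[P]_w g (X w) - \int[P]_w g (Y w).
apply: (@bmf_functional_eq0 _ _ _ L 2) hf => [g h hg hh|c g hg|g e hg ge|A mA].
- by rewrite /L !bintD; do ?[exact: bmf_comp]; ring.
- by rewrite /L !bintZ; do ?[exact: bmf_comp]; ring.
- rewrite mulrDl mul1r (le_trans (ler_normB _ _))// lerD//;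
    apply: bint_norm_le => //; exact: bmf_comp.
- by rewrite /L !int_indic_preimage// XY// subrr.
Qed.

(** [mu] is an arbitrary measure, so that this serves both for the density on the sphere and for the
    normal density with respect to Lebesgue measure. *)
Lemma density_int (mu : {measure set E -> \bar R}) (D : set E) (X : Omega -> E)
    (q f : E -> R) : measurable D -> measurable_fun setT X ->
  (forall x, D x -> 0 <= q x) -> mu.-integrable D (EFin \o q) ->
  (forall A, measurable A ->
    P (X @^-1` A) = (\int[mu]_(x in A `&` D) (q x)%:E)%E) -> bmf f ->
  \int[mu]_(x in D) (q x * f x) = \int[P]_w f (X w).
Proof.
move=> mD mX q0 iq hq hf; apply/eqP; rewrite -subr_eq0; apply/eqP.
have iqf g : bmf g -> mu.-integrable D (EFin \o (fun x => q x * g x)).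
  move=> [mg [M hM]].
  rewrite (_ : EFin \o _ = ((EFin \o q) \* (EFin \o g))%E); last first.
    by apply/funext => x /=; rewrite EFinM.
  apply: integrableMl => //; first exact: measurable_funTS.
  exists M; split; first exact: num_real.
  by move=> N MN x _ /=; rewrite (le_trans (hM x))// ltW.
pose L (g : E -> R) := \int[mu]_(x in D) (q x * g x) - \int[P]_w g (X w).
have q1 : 0 <= \int[mu]_(x in D) q x by exact: Rintegral_ge0.
apply: (@bmf_functional_eq0 _ _ _ L (\int[mu]_(x in D) q x + 1)) hf
  => [g h hg hh|c g hg|g e hg ge|A mA].
- rewrite /L bintD; do ?[exact: bmf_comp].
  under eq_Rintegral do rewrite mulrDr.
  by rewrite RintegralD//; do ?[exact: iqf]; ring.
- rewrite /L bintZ; do ?[exact: bmf_comp].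
  under eq_Rintegral do rewrite mulrCA.
  by rewrite RintegralZl//; do ?[exact: iqf]; ring.
- rewrite mulrDl mul1r (le_trans (ler_normB _ _))// lerD//; last first.
    by apply: bint_norm_le => //; exact: bmf_comp.
  rewrite (le_trans (le_normr_Rintegral mD (iqf _ hg)))// -RintegralZr//.
  apply: le_Rintegral => //.
  + exact: (integrable_norm (iqf _ hg)).
  + have -> : EFin \o (fun x => q x * e) = (fun x => (e%:E * (EFin \o q) x)%E).
      by apply/funext => x /=; rewrite -EFinM mulrC.
    exact: integrableZl.
  + by move=> x Dx; rewrite normrM (ger0_norm (q0 x Dx)) ler_wpM2l// q0.
- rewrite /L int_indic_preimage// hq//.
  rewrite -/(Rintegral mu (A `&` D) q) setIC Rintegral_mkcondr.
  apply/eqP; rewrite subr_eq0; apply/eqP/eq_Rintegral => x _.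
  by rewrite patchE indicE; case: (x \in A); rewrite ?mulr1 ?mulr0.
Qed.

Lemma has_density_int (nu : probability E R) (D : set E) (X : {RV P >-> E})
    (q f : E -> R) : measurable D -> has_density nu D X q -> bmf f ->
  \int[nu]_(x in D) (q x * f x) = \int[P]_w f (X w).
Proof.
move=> mD [mq q0 hq] hf; apply: density_int => //.
apply/integrableP; split; first exact/measurable_EFinP.
rewrite (eq_integral (EFin \o q)); last first.
  by move=> x /set_mem Dx; rewrite /= ger0_norm// q0.
have := hq setT measurableT; rewrite setTI => <-.
by rewrite (le_lt_trans (probability_le1 _ _))// ltry.
Qed.

End laws.

(** * Moments of harmonic polynomials on the sphere *)

Import HomogeneousPolynomials.

Section rotations.
Context {R : realType} {p : nat}.
Implicit Types (i j : 'I_p) (c s : R) (x : 'rV[R]_p).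

(* The rotation by the angle with cosine [c] and sine [s] in the plane [i, j]. *)
Definition rot i j c s : 'M[R]_p :=
  1%:M + (c - 1) *: (delta_mx i i + delta_mx j j)
       + s *: (delta_mx i j - delta_mx j i).

Lemma mul_row_delta x i j k : (x *m delta_mx i j) 0 k = x 0 i *+ (k == j).
Proof.
rewrite mxE (bigD1 i)//= mxE eqxx/= big1 ?addr0 ?mulr_natr// => l /negbTE li.
by rewrite mxE li mulr0.
Qed.

Lemma mul_rot x i j c s k : (x *m rot i j c s) 0 k =
  x 0 k + (c - 1) * (x 0 i *+ (k == i) + x 0 j *+ (k == j))
        + s * (x 0 i *+ (k == j) - x 0 j *+ (k == i)).
Proof.
rewrite /rot !mulmxDr mulmx1 -!scalemxAr mulmxDr mulmxBr.
have addE (A B : 'rV[R]_p) l : (A + B) 0 l = A 0 l + B 0 l by rewrite mxE.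
have oppE (A : 'rV[R]_p) l : (- A) 0 l = - A 0 l by rewrite mxE.
have sclE a (A : 'rV[R]_p) l : (a *: A) 0 l = a * A 0 l by rewrite mxE.
by rewrite !(addE, oppE, sclE) !mul_row_delta.
Qed.

(** With [P] the projection on the plane and [J] a quarter turn in it, the matrix is
    [1 + (c - 1) P + s J], and the claim follows from [P P = P], [P J = J P = J], [J J = - P] and
    the transposes. *)
Lemma rot_orthogonal i j c s : i != j -> c ^+ 2 + s ^+ 2 = 1 ->
  rot i j c s *m (rot i j c s)^T = 1%:M.
Proof.
move=> ij cs.
set P : 'M[R]_p := delta_mx i i + delta_mx j j.
set J : 'M[R]_p := delta_mx i j - delta_mx j i.
have ji : j == i = false by rewrite eq_sym (negbTE ij).
have PP : P *m P = P.
  rewrite mulmxDl !mulmxDr !mul_delta_mx_cond !eqxx (negbTE ij) ji.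
  by rewrite !mulr1n !mulr0n addr0 add0r.
have PJ : P *m J = J.
  rewrite mulmxDl !mulmxBr !mul_delta_mx_cond !eqxx (negbTE ij) ji.
  by rewrite !mulr1n !mulr0n subr0 sub0r.
have JP : J *m P = J.
  rewrite mulmxBl !mulmxDr !mul_delta_mx_cond !eqxx (negbTE ij) ji.
  by rewrite !mulr1n !mulr0n addr0 add0r.
have JJ : J *m J = - P.
  rewrite mulmxBl !mulmxBr !mul_delta_mx_cond !eqxx (negbTE ij) ji.
  by rewrite !mulr1n !mulr0n subr0 sub0r opprD.
have JT : J^T = - J by rewrite linearB/= !trmx_delta opprB.
have PT : P^T = P by rewrite linearD/= !trmx_delta.
have -> : rot i j c s = 1%:M + (c - 1) *: P + s *: J by [].
clearbody P J.
rewrite !linearD/= !linearZ/= trmx1 PT JT.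
rewrite !(mulmxDl, mulmxDr) !mul1mx !mulmx1 -!(scalemxAl, scalemxAr) !mulmxN.
rewrite PP PJ JP JJ !scalerN.
have cs' : s ^+ 2 = 1 - c ^+ 2 by rewrite -cs addrC addKr.
apply/matrixP => a b; rewrite !mxE.
ring: cs'.
Qed.

End rotations.

(** * Rotation invariance and Stein's identity *)

Section integration_of_polynomials.
Context {R : realType} {p : nat}.
Local Notation Xi i := (@mpoly.mpolyX p R (mpoly.mnm1 i)).
Implicit Types (Q W F : mpoly p R) (x t : 'rV[R]_p).

Lemma ev_sphere_bound Q : exists2 M, 0 <= M & forall x, sphere x -> `|ev Q x| <= M.
Proof.
move: Q; apply: mpoly_alg_ind => [c|i|Q W [M M0 hM] [N N0 hN]|Q W [M M0 hM] [N N0 hN]].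
- by exists `|c| => // x _; rewrite evC.
- by exists 1 => // x hx; rewrite evX coord_norm_le.
- exists (M + N); first exact: addr_ge0.
  by move=> x hx; rewrite evD (le_trans (ler_normD _ _))// lerD ?hM ?hN.
- exists (M * N); first exact: mulr_ge0.
  by move=> x hx; rewrite evM normrM ler_pM ?hM ?hN.
Qed.

Lemma measurable_ev Q : measurable_fun setT (ev Q).
Proof.
move: Q; apply: mpoly_alg_ind => [c|i|Q W mQ mW|Q W mQ mW].
- by apply: (eq_measurable_fun (fun=> c)) => [x _|//]; rewrite evC.
- apply: (eq_measurable_fun (fun x : 'rV[R]_p => x 0 i)) => [x _|].
    by rewrite evX.
  exact: measurable_coord.
- apply: (eq_measurable_fun (fun x => ev Q x + ev W x)) => [x _|].
    by rewrite evD.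
  exact: measurable_funD.
- apply: (eq_measurable_fun (fun x => ev Q x * ev W x)) => [x _|].
    by rewrite evM.
  exact: measurable_funM.
Qed.

(** The infinitesimal generator of the rotations [rot i j]. *)
Definition rotder i j F := Xi i * mderiv j F - Xi j * mderiv i F.

Lemma sphere_rot i j c s x : i != j -> c ^+ 2 + s ^+ 2 = 1 ->
  sphere x -> sphere (x *m rot i j c s).
Proof.
move=> ij cs /sphereP hx; apply/sphereP.
have dotpE (y z : 'rV[R]_p) : dotp y z = (y *m z^T) 0 0.
  by rewrite mxE; apply: eq_bigr => k _; rewrite mxE.
by rewrite dotpE trmx_mul mulmxA -(mulmxA x) rot_orthogonal// mulmx1 -dotpE.
Qed.

(** A first-order Taylor formula at the identity rotation, uniform on the sphere. It is obtained
    algebraically, from the coordinates by sums and products, since [rotder] is a derivation. *)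
Lemma rot_expand i j F : i != j -> exists2 C, 0 <= C &
  forall x c s, sphere x -> 0 <= c -> 0 <= s <= 1 -> c ^+ 2 + s ^+ 2 = 1 ->
  `|ev F (x *m rot i j c s) - ev F x - s * ev (rotder i j F) x| <= C * s ^+ 2.
Proof.
move=> ij; move: F; apply: mpoly_alg_ind => [a|k|Q W [M M0 hM] [N N0 hN]|Q W [M M0 hM] [N N0 hN]].
- exists 0 => // x c s _ _ _ _.
  rewrite /rotder !mpoly.mderivC !mulr0 subr0 ev0 !evC subrr sub0r mulr0.
  by rewrite oppr0 normr0 mul0r.
- exists 2 => // x c s hx c0 /andP[s0 s1] cs.
  (* [1 - c = s^2 / (1 + c)], with [c >= 0]. *)
  have c1 : `|c - 1| <= s ^+ 2.
    by rewrite ler_norml; apply/andP; split; nra.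
  rewrite /rotder !mderivXU evB !evM !evC !evX mul_rot.
  have -> : x 0 k + (c - 1) * (x 0 i *+ (k == i) + x 0 j *+ (k == j)) +
      s * (x 0 i *+ (k == j) - x 0 j *+ (k == i)) - x 0 k -
      s * (x 0 i * (j == k)%:R - x 0 j * (i == k)%:R) =
      (c - 1) * (x 0 i *+ (k == i) + x 0 j *+ (k == j)).
    by rewrite (eq_sym j) (eq_sym i); do 2!case: (k == _); rewrite ?mulr1n ?mulr0n; ring.
  rewrite normrM mulrC ler_pM// (le_trans (ler_normD _ _))// -[2]/(1 + 1).
  by rewrite lerD// normrMn; case: eqP => _; rewrite ?mulr1n ?coord_norm_le ?mulr0n.
- exists (M + N) => [|x c s hx c0 s01 cs]; first exact: addr_ge0.
  have -> : ev (rotder i j (Q + W)) x = ev (rotder i j Q) x + ev (rotder i j W) x.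
    by rewrite /rotder !mpoly.mderivD !(evB, evM, evD); ring.
  rewrite !(evD Q W); set r := rot i j c s.
  have -> : ev Q (x *m r) + ev W (x *m r) - (ev Q x + ev W x) -
      s * (ev (rotder i j Q) x + ev (rotder i j W) x) =
    (ev Q (x *m r) - ev Q x - s * ev (rotder i j Q) x) +
    (ev W (x *m r) - ev W x - s * ev (rotder i j W) x) by ring.
  by rewrite (le_trans (ler_normD _ _))// mulrDl lerD ?hM ?hN.
- have [A A0 hA] := ev_sphere_bound Q.
  have [B B0 hB] := ev_sphere_bound W.
  have [D D0 hD] := ev_sphere_bound (rotder i j Q).
  have [E E0 hE] := ev_sphere_bound (rotder i j W).
  exists (A * N + M * B + E * (D + M)) => [|x c s hx c0 s01 cs].
    by rewrite !addr_ge0 ?mulr_ge0// addr_ge0.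
  have -> : ev (rotder i j (Q * W)) x =
      ev (rotder i j Q) x * ev W x + ev Q x * ev (rotder i j W) x.
    by rewrite /rotder !mpoly.mderivM !(evB, evM, evD); ring.
  have hxr : sphere (x *m rot i j c s) by exact: sphere_rot.
  rewrite !evM; move: (hA _ hxr) (hM x c s hx c0 s01 cs) (hN x c s hx c0 s01 cs).
  set Q' := ev Q (x *m _); set W' := ev W (x *m _).
  set q := ev Q x; set w := ev W x.
  have := hB x hx; rewrite -/w; have := hD x hx; have := hE x hx.
  set q1 := ev (rotder _ _ Q) x; set w1 := ev (rotder _ _ W) x.
  move=> hw1 hq1 hw hQ' h1 h2; case/andP: s01 => s0 s1.
  (* Each of the three terms contains the remainder of one factor, or [s^2]. *)
  have -> : Q' * W' - q * w - s * (q1 * w + q * w1) =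
    Q' * (W' - w - s * w1) + (Q' - q - s * q1) * w +
    s * w1 * (s * q1 + (Q' - q - s * q1)) by ring.
  have g1 : `|Q' * (W' - w - s * w1)| <= A * N * s ^+ 2.
    by rewrite normrM -mulrA ler_pM.
  have g2 : `|(Q' - q - s * q1) * w| <= M * B * s ^+ 2.
    by rewrite normrM mulrAC ler_pM.
  rewrite (le_trans (ler_normD _ _))// [leRHS]mulrDl; apply: lerD => //.
    by rewrite (le_trans (ler_normD _ _))// [leRHS]mulrDl; apply: lerD.
  rewrite !normrM (ger0_norm s0).
  have -> : E * (D + M) * s ^+ 2 = (s * E) * (s * (D + M)) by ring.
  rewrite ler_pM ?mulr_ge0// ?ler_wpM2l//.
  rewrite (le_trans (ler_normD _ _))// mulrDr lerD//.
    by rewrite normrM (ger0_norm s0) ler_wpM2l.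
  rewrite (le_trans h1)// mulrC ler_wpM2r// expr2 ler_piMr//.
Qed.

Hypothesis p0 : (0 < p)%N.
Local Notation sp := (sproj p0).

Lemma bmf_ev Q : bmf (fun x => ev Q (sp x)).
Proof.
split; first exact: (measurableT_comp (measurable_ev Q) (measurable_sproj p0)).
have [M M0 hM] := ev_sphere_bound Q.
by exists M => x; apply: hM; exact: sphere_sproj.
Qed.

Variable nu : probability 'rV[R]_p R.
Hypothesis hnu : uniform_on_sphere nu.

Definition sint Q := \int[nu]_x ev Q (sp x).

Lemma sintD Q W : sint (Q + W) = sint Q + sint W.
Proof.
rewrite /sint -bintD; do ?[exact: bmf_ev].
by apply: eq_Rintegral => x _; rewrite evD.
Qed.

Lemma sintZ c Q : sint (c *: Q) = c * sint Q.
Proof.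
rewrite /sint -bintZ; do ?[exact: bmf_ev].
by apply: eq_Rintegral => x _; rewrite evZ.
Qed.

Lemma sintN Q : sint (- Q) = - sint Q.
Proof. by rewrite -scaleN1r sintZ mulN1r. Qed.

Lemma sintB Q W : sint (Q - W) = sint Q - sint W.
Proof. by rewrite sintD sintN. Qed.

Lemma sint0 : sint 0 = 0.
Proof. by rewrite -(scale0r 0) sintZ mul0r. Qed.

Lemma sint_sum I (s : seq I) (P : pred I) (G : I -> mpoly p R) :
  sint (\sum_(i <- s | P i) G i) = \sum_(i <- s | P i) sint (G i).
Proof. exact: (big_morph _ sintD sint0). Qed.

Lemma eq_sint Q W : (forall x, sphere x -> ev Q x = ev W x) -> sint Q = sint W.
Proof. by move=> h; apply: eq_Rintegral => x _; rewrite h//; exact: sphere_sproj. Qed.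

Lemma sint_rot i j c s F : i != j -> c ^+ 2 + s ^+ 2 = 1 ->
  \int[nu]_x ev F (sp x *m rot i j c s) = sint F.
Proof.
move=> ij cs; have [nu1 inv] := hnu; set r := rot i j c s.
have mr : measurable_fun setT (fun x : 'rV[R]_p => x *m r).
  by apply: measurable_map_rV; exact: mulmx_continuous.
have hs x : sphere (sp x *m r) by apply: sphere_rot => //; exact: sphere_sproj.
have hf : bmf (fun x => ev F (sp (x *m r))).
  exact: (bmf_comp (X := fun x => x *m r) mr (bmf_ev F)).
transitivity (\int[nu]_x ev F (sp (x *m r))); last first.
  apply: (@same_law_int _ _ _ _ _ nu (fun x => x *m r) id (fun x => ev F (sp x))) => //.
  - by move=> A mA; rewrite inv//; exact: rot_orthogonal.
  - exact: bmf_ev.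
rewrite -(sphere_RintegralT nu1 hf) (@sphere_Rintegral _ _ p0 nu nu1 (fun x => ev F (sp (x *m r)))).
  by apply: eq_Rintegral => x _; rewrite /= (sproj_id _ (hs x)).
exact: (bmf_comp (X := sp) (measurable_sproj p0) hf).
Qed.

(** By invariance, [F] has the same integral after a rotation, so [rot_expand] gives
    [s * sint (rotder i j F) = O(s^2)]; divide by [s] and let [s] tend to 0. *)
Lemma sint_rotder i j F : sint (rotder i j F) = 0.
Proof.
have [->|ij] := eqVneq i j; first by rewrite /rotder subrr sint0.
have [C C0 hC] := rot_expand F ij.
apply/eqP; rewrite -normr_le0; apply/ler_addgt0Pl => e e0; rewrite addr0.
pose s := Num.min 1 (e / (C + 1)).
have C1 : 0 < C + 1 by rewrite ltr_wpDl.
have s0 : 0 < s by rewrite lt_min ltr01 divr_gt0.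
have s1 : s <= 1 by rewrite ge_min lexx.
have se : C * s <= e.
  have h : s <= e / (C + 1) by rewrite ge_min lexx orbT.
  rewrite (le_trans (ler_wpM2l C0 h))// mulrCA -[leRHS]mulr1 ler_wpM2l ?(ltW e0)//.
  by rewrite ler_pdivrMr// mul1r lerDl ler01.
pose c := Num.sqrt (1 - s ^+ 2).
have cs : c ^+ 2 + s ^+ 2 = 1.
  by rewrite sqr_sqrtr ?subrK// subr_ge0 expr_le1// ltW.
have bF : bmf (fun x => ev F (sp x *m rot i j c s)).
  split; last first.
    have [M M0 hM] := ev_sphere_bound F.
    exists M => x; apply: hM; apply: sphere_rot => //; exact: sphere_sproj.
  have mr : measurable_fun setT (fun x : 'rV[R]_p => x *m rot i j c s).
    by apply: measurable_map_rV; exact: mulmx_continuous.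
  apply: (measurableT_comp (measurable_ev F)).
  exact: (measurableT_comp mr (measurable_sproj p0)).
have bL : bmf (fun x => s * ev (rotder i j F) (sp x)) by apply/bmfZ/bmf_ev.
have key : s * sint (rotder i j F) = - (\int[nu]_x (ev F (sp x *m rot i j c s)
    - ev F (sp x) - s * ev (rotder i j F) (sp x))).
  rewrite (bintB _ (bmfB bF (bmf_ev F)) bL) (bintB _ bF (bmf_ev F)) sint_rot//.
  by rewrite subrr sub0r opprK bintZ//; exact: bmf_ev.
have : `|s * sint (rotder i j F)| <= C * s ^+ 2.
  rewrite key normrN; apply: bint_norm_le.
    exact: bmfB (bmfB bF (bmf_ev F)) bL.
  move=> x; apply: hC => //; first exact: sphere_sproj.
    exact: sqrtr_ge0.
  by rewrite (ltW s0) s1.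
rewrite normrM (gtr0_norm s0) expr2 mulrCA ler_pM2l// => h.
exact: le_trans h se.
Qed.

(* Stein's identity on the sphere: apply the previous lemma to [x_j W] and sum
   over [j], using Euler's identity for [W] and [|x| = 1]. *)
Lemma sint_stein i k W : hom k W ->
  sint (mderiv i W) = (k%:R + p%:R - 1) * sint (Xi i * W).
Proof.
move=> hW.
have : sint (\sum_j rotder i j (Xi j * W)) = 0.
  by rewrite sint_sum big1// => j _; exact: sint_rotder.
suff -> : sint (\sum_j rotder i j (Xi j * W)) =
    sint ((k%:R + p%:R - 1) *: (Xi i * W) - mderiv i W).
  by rewrite sintB sintZ => /eqP; rewrite subr_eq0 => /eqP.
apply: eq_sint => x /sphereP hx; rewrite ev_sum evB evZ evM evX.
have e := congr1 (ev ^~ x) (euler hW); rewrite ev_sum evZ in e.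
rewrite (eq_bigr (fun j => x 0 i * ev W x + x 0 i * ev (Xi j * mderiv j W) x
   - (x 0 j * (i == j)%:R * ev W x + x 0 j * x 0 j * ev (mderiv i W) x))); last first.
  move=> j _; rewrite /rotder !mpoly.mderivM !mderivXU eqxx !(evB, evM, evD, evC, evX).
  rewrite (_ : true%:R = 1 :> R)//; ring.
rewrite sumrB !big_split/= -!mulr_sumr e sumr_const card_ord -!mulr_suml -/(dotp x x) hx.
rewrite (bigD1 i)//= eqxx big1 => [|j /negbTE]; last by rewrite eq_sym => ->; rewrite mulr0.
rewrite -[ev W x *+ p]mulr_natr (_ : true%:R = 1 :> R)//; ring.
Qed.

Lemma sint_lin_stein t k W : hom k W ->
  (k%:R + p%:R - 1) * sint (lin t * W) = sint (dird t W).
Proof.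
move=> hW; rewrite /dird /lin mulr_suml !sint_sum mulr_sumr.
by apply: eq_bigr => i _; rewrite -scalerAl !sintZ (sint_stein i hW); ring.
Qed.

End integration_of_polynomials.

(** * Orthogonality and moments of harmonic polynomials *)

Section harmonic_integrals.
Context {R : realType} {p : nat}.
Hypothesis p1 : (1 < p)%N.
Let p0 : (0 < p)%N := ltnW p1.
Variable nu : probability 'rV[R]_p R.
Hypothesis hnu : uniform_on_sphere nu.
Local Notation Xi i := (@mpoly.mpolyX p R (mpoly.mnm1 i)).
Local Notation sint := (sint p0 nu).
Implicit Types (Q W F : mpoly p R) (x t : 'rV[R]_p).

Lemma stein_coef_neq0 k : k%:R + p%:R - 1 != 0 :> R.
Proof. by rewrite -natrD -(natrB _ (n := 1)) ?pnatr_eq0 ?subn_eq0 -?ltnNge; lia. Qed.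

(** Euler's identity writes [Q] as a sum of [X_i] times its derivatives, and Stein's identity turns
    the integral of this sum into the integral of the Laplacian. *)
Lemma harmonic_sint0 k Q : hom k.+1 Q -> lap Q = 0 -> sint Q = 0.
Proof.
move=> hQ lQ; have e := euler hQ.
have k0 : k.+1%:R != 0 :> R by rewrite pnatr_eq0.
have h : (k%:R + p%:R - 1) * (k.+1%:R * sint Q) = 0.
  rewrite -(sintZ p0 nu) -e sint_sum mulr_sumr.
  under eq_bigr => i _ do rewrite -(sint_stein p0 hnu i (hom_deriv i hQ)).
  by rewrite -sint_sum -/(lap Q) lQ sint0.
by move/eqP: h; rewrite !mulf_eq0 (negbTE k0) (negbTE (stein_coef_neq0 k)) => /eqP.
Qed.

(** Euler's identity for [W] and Stein's identity reduce the integral to those of the products of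
    derivatives, where both degrees are lower by one, and of [Q * lap W = 0]. The descent ends with
    [W] constant. *)
Lemma harmonic_orthogonal k l Q W : (l < k)%N -> hom k Q -> lap Q = 0 ->
  hom l W -> lap W = 0 -> sint (Q * W) = 0.
Proof.
elim: l k Q W => [|l IH] k Q W lk hQ lQ hW lW.
  have [c ->] := hom0_const hW.
  rewrite mulrC mul_mpolyC sintZ; case: k lk hQ => // k _ hQ.
  by rewrite (harmonic_sint0 hQ lQ) mulr0.
case: k lk hQ => // k lk hQ; have e := euler hW.
have l0 : l.+1%:R != 0 :> R by rewrite pnatr_eq0.
have h : ((k.+1 + l)%:R + p%:R - 1) * (l.+1%:R * sint (Q * W)) = 0.
  rewrite -(sintZ p0 nu) scalerAr -e mulr_sumr sint_sum mulr_sumr.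
  under eq_bigr => i _.
    rewrite mulrCA -(sint_stein p0 hnu i (homM hQ (hom_deriv i hW))) mderivM.
    rewrite (sintD p0 nu) (IH k _ _ lk (hom_deriv i hQ) _ (hom_deriv i hW)); last 2 first.
      by rewrite lap_deriv lQ linear0.
      by rewrite lap_deriv lW linear0.
    rewrite add0r; over.
  by rewrite -sint_sum -mulr_sumr -/(lap W) lW mulr0 sint0.
by move/eqP: h; rewrite !mulf_eq0 (negbTE l0) (negbTE (stein_coef_neq0 _)) => /eqP.
Qed.

(** The value of [kap] at exponent [k + 2 l], which solves the recursion [kap_rec]; the product is
    [p (p + 2) ... (p + 2 (k + l) - 2)]. *)
Definition kp (k l : nat) : R :=
  (k + l.*2)`!%:R / (l`!%:R * 2 ^+ l * \prod_(i < k + l) (p%:R + 2 * i%:R)).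

(* The factor by which integration over [x] against [(t.x)^m] multiplies
   harmonic polynomials of degree [k], evaluated at [t]. *)
Definition kap (m k : nat) : R :=
  if (k <= m)%N && ~~ odd (m - k) then kp k (m - k)./2 else 0.

Lemma kap_kp k l : kap (k + l.*2) k = kp k l.
Proof. by rewrite /kap leq_addr addKn odd_double doubleK. Qed.

Lemma kap_cases m k : (exists l, m = k + l.*2)%N \/
  (kap m k = 0 /\ forall l, m <> (k + l.*2)%N).
Proof.
rewrite /kap; have [km|km] := leqP k m; last by right; split => // l; lia.
have [od|od] := boolP (odd (m - k)); last by left; exists (m - k)./2; lia.
by right; split => // l ml; move: od; rewrite ml addKn odd_double.
Qed.

Lemma kap0 m k : (forall l, m <> k + l.*2)%N -> kap m k = 0.
Proof. by have [[l ->] /(_ l)//|[]] := kap_cases m k. Qed.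

Lemma prod_kp_neq0 n : \prod_(i < n) (p%:R + 2 * i%:R) != 0 :> R.
Proof.
apply/prodf_neq0 => i _; rewrite -(natrM _ 2) -natrD pnatr_eq0; lia.
Qed.

Lemma fact_neq0 n : n`!%:R != 0 :> R.
Proof. by rewrite pnatr_eq0 -lt0n fact_gt0. Qed.

Lemma kp_recl k l : (k + l.*2.+2)%:R * (k + l.*2.+1)%:R * kp k l =
  2 * l.+1%:R * (2 * k%:R + 2 * l%:R + p%:R) * kp k l.+1.
Proof.
rewrite /kp doubleS !addnS !factS big_ord_recr/= !natrM exprS.
have h1 := prod_kp_neq0 (k + l); have h2 := fact_neq0 l.
have h3 : (p%:R + 2 * (k + l)%:R) != 0 :> R by rewrite -(natrM _ 2) -natrD pnatr_eq0; lia.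
have h4 : (2:R) ^+ l != 0 by rewrite expf_neq0.
have h5 : 1 + l%:R != 0 :> R by rewrite -(natrD _ 1 l) pnatr_eq0.
move: h3; rewrite natrD => h3.
by field; do ?[apply/andP; split].
Qed.

(** This lemma and the next two are [kap_rec] for [l = 0], for [k = 0] and for both positive: in the
    first two cases one term of the recursion drops out. *)
Lemma kp_recS0 k : (2 * k%:R + p%:R) * kp k.+1 0 = k.+1%:R * kp k 0.
Proof.
rewrite /kp !addn0 factS big_ord_recr/= natrM.
have h1 := prod_kp_neq0 k.
have h3 : (p%:R + 2 * k%:R) != 0 :> R by rewrite -(natrM _ 2) -natrD pnatr_eq0; lia.
by rewrite fact0 expr0; field; do ?[apply/andP; split].
Qed.

Lemma kp_rec0S l : (2 * l%:R + p%:R) * kp 0 l.+1 = l.*2.+1%:R * kp 0 l.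
Proof.
rewrite /kp doubleS !add0n !factS big_ord_recr/= !natrM exprS.
have h1 := prod_kp_neq0 l; have h2 := fact_neq0 l.
have h3 : (p%:R + 2 * l%:R) != 0 :> R by rewrite -(natrM _ 2) -natrD pnatr_eq0; lia.
have h4 : (2:R) ^+ l != 0 by rewrite expf_neq0.
have h5 : 1 + l%:R != 0 :> R by rewrite -(natrD _ 1 l) pnatr_eq0.
have e3 : (l.*2).+2%:R = 2 * l.+1%:R :> R.
  by rewrite -doubleS -muln2 natrM mulrC.
by rewrite e3; field; do ?[apply/andP; split].
Qed.

Lemma kp_recSS k l : (2 * k%:R + 2 + 2 * l%:R + p%:R) * kp k.+1 l.+1 =
  (k + l.*2.+2)%:R * kp k.+1 l + k.+1%:R * kp k l.+1.
Proof.
rewrite /kp doubleS !addnS !addSn !factS big_ord_recr/= !natrM exprS.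
have h1 := prod_kp_neq0 (k + l).+1; have h2 := fact_neq0 l.
have h3 : (p%:R + 2 * (k + l).+1%:R) != 0 :> R by rewrite -(natrM _ 2) -natrD pnatr_eq0; lia.
have h4 : (2:R) ^+ l != 0 by rewrite expf_neq0.
have h5 : 1 + l%:R != 0 :> R by rewrite -(natrD _ 1 l) pnatr_eq0.
have e1 : (k + l).+1%:R = k%:R + l%:R + 1 :> R by rewrite -natrD natr1.
have e2 : (k + l.*2).+3%:R = k%:R + 2 * l%:R + 3 :> R.
  by rewrite -addn3 !natrD -muln2 natrM mulrC.
have e3 : (k + l.*2).+2%:R = k%:R + 2 * l%:R + 2 :> R.
  by rewrite -addn2 !natrD -muln2 natrM mulrC.
have e4 : l.+1%:R = l%:R + 1 :> R by rewrite natr1.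
have e5 : k.+1%:R = k%:R + 1 :> R by rewrite natr1.
rewrite e1 in h3 *; rewrite e2 e3 e5.
by field; do ?[apply/andP; split].
Qed.

(** The recursion that Stein's identity in the direction [t] imposes on the moments: the two terms
    come from differentiating [(t.x)^m] and the harmonic polynomial. *)
Lemma kap_rec m k : (m%:R + k%:R + p%:R - 1) * kap m.+1 k =
  m%:R * kap m.-1 k + k%:R * kap m k.-1.
Proof.
have [[l]|[-> h]] := kap_cases m.+1 k; last first.
  have -> : m%:R * kap m.-1 k = 0.
    case: m h => [|m] h; rewrite ?mul0r// kap0 ?mulr0// => l e.
    by apply: (h l.+1) => /=; lia.
  rewrite mulr0 add0r; case: k h => [|k] h; rewrite ?mul0r//= kap0 ?mulr0// => l e.
  by apply: (h l); lia.
move=> mkl; rewrite mkl kap_kp.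
case: l mkl => [|l] mkl; case: k mkl => [|k] mkl; rewrite ?mul0r ?addr0.
- lia.
- have -> : m = k by lia.
  rewrite -[k.+1.-1]/k.
  have -> : kap k k = kp k 0 by rewrite -kap_kp addn0.
  rewrite (_ : k%:R * kap k.-1 k.+1 = 0); last first.
    by rewrite kap0 ?mulr0// => l; lia.
  rewrite add0r -kp_recS0 -[k.+1%:R]natr1; congr (_ * _); ring.
- have -> : m = l.*2.+1 by lia.
  have -> : kap l.*2.+1.-1 0 = kp 0 l by rewrite -kap_kp.
  rewrite -kp_rec0S -[l.*2.+1%:R]natr1 -muln2 natrM; congr (_ * _); ring.
have -> : m = (k + l.*2.+2)%N by lia.
have -> : kap (k + l.*2.+2).-1 k.+1 = kp k.+1 l by rewrite -kap_kp; congr kap; lia.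
have -> : kap (k + l.*2.+2) k.+1.-1 = kp k l.+1 by rewrite -kap_kp doubleS.
rewrite -kp_recSS -[k.+1%:R]natr1 natrD -doubleS -muln2 natrM -natr1; congr (_ * _).
ring.
Qed.

(** As [(m - k) (m + k + p - 2) = m (m + p - 2) - k (k + p - 2)], this says that the
    Laplace-Beltrami operator, applied to [(t.x)^m] and integrated against harmonics of degree [k],
    acts as [- k (k + p - 2)]. *)
Lemma kap_eigen m k : m%:R * (m%:R - 1) * kap m.-2 k =
  (m%:R - k%:R) * (m%:R + k%:R + p%:R - 2) * kap m k.
Proof.
have [[l ml]|[-> h]] := kap_cases m k; last first.
  rewrite mulr0; case: m h => [|[|m]] h; rewrite ?mul0r ?subrr ?mulr0 ?mul0r//.
  by rewrite kap0 ?mulr0// => l e; apply: (h l.+1) => /=; lia.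
case: l ml => [|l] ml.
  have -> : m = k by lia.
  rewrite subrr !mul0r; case: k {ml} => [|[|k]]; rewrite ?mul0r ?subrr ?mulr0 ?mul0r//.
  by rewrite kap0 ?mulr0// => l; lia.
have -> : kap m.-2 k = kp k l by rewrite -kap_kp; congr kap; lia.
have -> : kap m k = kp k l.+1 by rewrite -kap_kp ml.
have -> : m%:R - 1 = (k + l.*2.+1)%:R :> R.
  by rewrite ml doubleS addnS -natr1 addrK addnS.
have em : m%:R = (k + l.*2.+2)%:R :> R by rewrite ml doubleS.
rewrite em kp_recl; congr (_ * _); rewrite natrD -doubleS -muln2 natrM -natr1; ring.
Qed.

Lemma dird_lin_exp t m W : dotp t t = 1 ->
  dird t (lin t ^+ m * W) = m%:R *: (lin t ^+ m.-1 * W) + lin t ^+ m * dird t W.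
Proof.
move=> ht; rewrite /dird mulr_sumr.
rewrite (eq_bigr (fun i => (t 0 i * t 0 i) *: (m%:R *: (lin t ^+ m.-1 * W)) +
   lin t ^+ m * (t 0 i *: mderiv i W))).
  by rewrite big_split/= -scaler_suml -/(dotp t t) ht scale1r.
move=> i _; rewrite mderivM mderiv_exp mderiv_lin scalerDr -scalerAr; congr (_ + _).
rewrite -scalerAl -mulrA mul_mpolyC -scalerAr !scalerA; congr (_ *: _); ring.
Qed.

Lemma ev_dird t k W : hom k W -> ev (dird t W) t = k%:R * ev W t.
Proof.
move=> hW; have := congr1 (ev ^~ t) (euler hW).
rewrite ev_sum evZ => <-; rewrite /dird ev_sum.
by apply: eq_bigr => i _; rewrite evZ evM evX.
Qed.

(** Induction on [m] by Stein's identity. Only the value of [Q] at [t] survives, because the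
    derivative of [Q] along [t] is harmonic and equals [k Q(t)] at [t]. *)
Lemma harmonic_moment m k t Q : dotp t t = 1 -> hom k Q -> lap Q = 0 ->
  sint (lin t ^+ m * Q) = kap m k * ev Q t.
Proof.
move=> ht; elim/ltn_ind: m k Q => -[_|m IH] k Q hQ lQ.
  rewrite expr0 mul1r; case: k hQ => [|k] hQ.
    have [c ->] := hom0_const hQ; rewrite evC.
    rewrite (_ : kap 0 0 = 1); last first.
      by rewrite /kap/= /kp fact0 big_ord0 expr0 !mulr1 divr1.
    rewrite mul1r -[RHS](bint_cst nu); apply: eq_Rintegral => x _.
    by rewrite evC.
  rewrite (harmonic_sint0 hQ lQ) kap0 ?mul0r// => l; lia.
have hW : hom (1 * m + k) (lin t ^+ m * Q) by apply: homM => //; exact: hom_exp (hom_lin t).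
have := sint_lin_stein p0 hnu t hW.
rewrite mulrA -exprS (dird_lin_exp _ _ ht) (sintD p0 nu) (sintZ p0 nu) mul1n => e.
have D0 : (m%:R + k%:R + p%:R - 1) != 0 :> R by rewrite -natrD stein_coef_neq0.
apply: (mulfI D0); rewrite mulrA kap_rec -natrD e mulrDl; congr (_ + _).
  case: m {e D0 hW} IH => [|m] IH; first by rewrite !mul0r.
  by rewrite (IH m _ k Q hQ lQ)// mulrA.
case: k hQ {e D0 hW} => [|k] hQ.
  have -> : dird t Q = 0.
    by rewrite /dird big1// => i _; rewrite hom0_deriv// scaler0.
  by rewrite !mul0r mulr0 sint0.
rewrite (IH m (ltnSn m) _ _ (hom_dird t hQ) (lap_dird t lQ)) (ev_dird t hQ)/=.
by rewrite mulrA [_ * kap _ _]mulrC.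
Qed.

End harmonic_integrals.

(** * Parseval's formula for finite orthonormal families *)

Section orthonormal_families.
Context {d : measure_display} {T : measurableType d} {R : realType}.
Variable P : probability T R.

(** The difference is a variance. *)
Lemma sqr_bint_le (f : T -> R) : bmf f -> (\int[P]_x f x) ^+ 2 <= \int[P]_x (f x ^+ 2).
Proof.
move=> bf; set c := \int[P]_x f x; rewrite -subr_ge0.
have -> : \int[P]_x (f x ^+ 2) - c ^+ 2 = \int[P]_x ((f x - c) ^+ 2).
  have -> : (fun x => (f x - c) ^+ 2) = (fun x => f x ^+ 2 - 2 * c * f x + c ^+ 2).
    by apply/funext => x; ring.
  rewrite bintD; [|by apply: bmfB; [exact: bmfX|exact: bmfZ]|exact: bmf_cst].
  rewrite bintB; [|exact: bmfX|exact: bmfZ].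
  by rewrite bintZ// bint_cst -/c; ring.
by apply: bint_ge0 => x; exact: sqr_ge0.
Qed.

Context {I : finType}.
Variable e : I -> T -> R.
Hypotheses (be : forall i, bmf (e i))
  (oe : forall i j, \int[P]_x (e i x * e j x) = (i == j)%:R).

Definition coef (f : T -> R) i := \int[P]_x (f x * e i x).

(** Pythagoras: the distance is least for the coefficients [coef f]. *)
Lemma sqr_dist_span (f : T -> R) (c : I -> R) : bmf f ->
  \int[P]_x ((f x - \sum_i c i * e i x) ^+ 2) =
  \int[P]_x (f x ^+ 2) - \sum_i coef f i ^+ 2 + \sum_i (c i - coef f i) ^+ 2.
Proof.
move=> bf.
have bfe i : bmf (fun x => c i * (f x * e i x)) by apply: bmfZ; exact: bmfM.
have bee i j : bmf (fun x => c i * c j * (e i x * e j x)) by apply: bmfZ; exact: bmfM.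
have -> : (fun x => (f x - \sum_i c i * e i x) ^+ 2) = (fun x =>
   f x ^+ 2 - 2 * (\sum_i c i * (f x * e i x)) +
   \sum_i \sum_j c i * c j * (e i x * e j x)).
  apply/funext => x; rewrite sqrrB; congr (_ - _ + _).
    rewrite [in RHS]mulr_natl mulr_sumr; congr (_ *+ 2).
    by apply: eq_bigr => i _; rewrite mulrCA.
  rewrite expr2 mulr_suml; apply: eq_bigr => i _; rewrite mulr_sumr.
  by apply: eq_bigr => j _; ring.
have b1 : bmf (fun x => \sum_i c i * (f x * e i x)) by exact: bmf_sum.
have b2 i : bmf (fun x => \sum_j c i * c j * (e i x * e j x)) by exact: bmf_sum.
rewrite bintD; [|by apply: bmfB; [exact: bmfX|exact: bmfZ]|exact: bmf_sum].
rewrite bintB; [|exact: bmfX|exact: bmfZ].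
rewrite bintZ// !bint_sum//.
have -> : \sum_i \int[P]_x (c i * (f x * e i x)) = \sum_i c i * coef f i.
  by apply: eq_bigr => i _; rewrite bintZ//; exact: bmfM.
have -> : \sum_i \int[P]_x \sum_j c i * c j * (e i x * e j x) = \sum_i c i ^+ 2.
  apply: eq_bigr => i _; rewrite bint_sum// (bigD1 i)//= bintZ; last exact: bmfM.
  rewrite oe eqxx mulr1 big1 ?addr0// => j /negbTE ji.
  by rewrite bintZ ?oe 1?eq_sym ?ji ?mulr0//; exact: bmfM.
rewrite -!addrA; congr (_ + _); rewrite mulr_sumr -!sumrN -!big_split/=.
by apply: eq_bigr => i _; ring.
Qed.

(** The difference is the inner product of [h] with the residual of the projection of [f], whose
    norm is at most that of [f - \sum_i c i * e i]. One uniform approximation of [f], with any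
    coefficients, thus stands in for completeness. *)
Lemma parseval_bound (f h : T -> R) (c : I -> R) (eps M : R) :
  bmf f -> bmf h -> (forall x, `|h x| <= M) ->
  (forall x, `|f x - \sum_i c i * e i x| <= eps) ->
  `|\int[P]_x (f x * h x) - \sum_i coef f i * coef h i| <= M * eps.
Proof.
move=> bf bh hM hc.
have bS a : bmf (fun x => \sum_i a i * e i x) by apply: bmf_sum => i _; exact: bmfZ.
pose r x := f x - \sum_i coef f i * e i x.
have br : bmf r by exact: bmfB.
have M0 : 0 <= M by exact: le_trans (normr_ge0 _) (hM point).
have eps0 : 0 <= eps by exact: le_trans (normr_ge0 _) (hc point).
have -> : \int[P]_x (f x * h x) - \sum_i coef f i * coef h i = \int[P]_x (r x * h x).
  rewrite /r; under [RHS]eq_Rintegral do rewrite mulrBl.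
  rewrite bintB; [|exact: bmfM|exact: bmfM]; congr (_ - _).
  under [RHS]eq_Rintegral do rewrite mulr_suml.
  rewrite bint_sum => [|i _]; last by apply: bmfM => //; exact: bmfZ.
  apply: eq_bigr => i _; rewrite /coef -bintZ; last exact: bmfM.
  by apply: eq_Rintegral => x _; ring.
rewrite -(@ler_pXn2r _ 2) ?nnegrE ?mulr_ge0// real_normK ?num_real//.
apply: (le_trans (sqr_bint_le (bmfM br bh))).
apply: (@le_trans _ _ (\int[P]_x (M ^+ 2 * r x ^+ 2))).
  apply: bint_le => [||x]; [by apply: bmfX; exact: bmfM|by apply: bmfZ; exact: bmfX|].
  rewrite exprMn mulrC ler_wpM2r ?sqr_ge0//.
  by rewrite -[leLHS]real_normK ?num_real// lerXn2r ?nnegrE.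
rewrite bintZ; last exact: bmfX.
rewrite exprMn ler_wpM2l ?sqr_ge0//.
apply: (@le_trans _ _ (\int[P]_x ((f x - \sum_i c i * e i x) ^+ 2))).
  rewrite !sqr_dist_span// lerD2l.
  rewrite [leLHS]big1 => [|i _]; last by rewrite subrr expr0n.
  by apply: sumr_ge0 => i _; exact: sqr_ge0.
rewrite -(bint_cst P (eps ^+ 2)).
apply: bint_le => [||x]; [by apply: bmfX; exact: bmfB|exact: bmf_cst|].
by rewrite -[leLHS]real_normK ?num_real// lerXn2r ?nnegrE.
Qed.

End orthonormal_families.

(** * The Gamma function and the Funk-Hecke coefficients *)

Section half_line_FTC.
Context {R : realType}.
Local Notation mu := (@lebesgue_measure R).
(** With [n.+2] the endpoints are distinct even for [n = 0]. *)
Let D (n : nat) := `[(n.+2%:R : R)^-1, n.+2%:R]%classic.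
Let pos := `]0, +oo[%classic : set R.

Let inv_lt n : (n.+2%:R : R)^-1 < n.+2%:R.
Proof.
rewrite (lt_trans (y := 1)) ?ltr1n// invf_lt1 ?ltr1n// ltr0n//.
Qed.

Let D_pos n : D n `<=` pos.
Proof.
move=> x; rewrite /D /pos/= !in_itv/= andbT => /andP[h _].
by rewrite (lt_le_trans _ h)// invr_gt0 ltr0n.
Qed.

Let D_homo : {homo D : n m / (n <= m)%N >-> (n <= m)%O}.
Proof.
move=> n m nm; rewrite subsetEset; apply: subset_itv; rewrite bnd_simp ?ler_nat//.
by rewrite lef_pV2 ?posrE ?ltr0n// ler_nat.
Qed.

Let D_near x : pos x -> \forall n \near \oo, D n x.
Proof.
rewrite /pos/= in_itv/= andbT => x0.
have [N _ hN] : \forall n \near \oo, x <= n%:R := nbhs_infty_ger x.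
have [M _ hM] : \forall n \near \oo, x^-1 <= n%:R := nbhs_infty_ger x^-1.
exists (maxn N M) => // n /=; rewrite geq_max => /andP[Nn Mn].
rewrite /D/= in_itv/=; apply/andP; split.
  rewrite -[leRHS]invrK lef_pV2 ?posrE ?ltr0n ?invr_gt0//.
  by rewrite (le_trans (hM _ Mn))// ler_nat; do 2!apply: leqW.
by rewrite (le_trans (hN _ Nn))// ler_nat; do 2!apply: leqW.
Qed.

Let bigcup_D : \bigcup_n D n = pos.
Proof.
apply/seteqP; split => [x [n _]|x /D_near[n _ hn]]; first exact: D_pos.
by exists n => //; exact: hn n (leqnn n).
Qed.

Let mpos : measurable pos. Proof. exact: measurable_itv. Qed.
Let mD n : measurable (D n). Proof. exact: measurable_itv. Qed.

Lemma continuous_pos_measurable (f : R -> R) :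
  (forall x, 0 < x -> {for x, continuous f}) -> measurable_fun pos f.
Proof.
move=> cf; apply: subspace_continuous_measurable_fun => //.
apply: continuous_in_subspaceT => x; rewrite inE /pos/= in_itv/= andbT; exact: cf.
Qed.

Lemma FTC_D (f F : R -> R) n :
  (forall x, 0 < x -> {for x, continuous f}) ->
  (forall x : R, 0 < x -> is_derive x 1 F (f x)) ->
  (\int[mu]_(x in D n) (f x)%:E)%E = (F n.+2%:R - F n.+2%:R^-1)%:E.
Proof.
move=> cf dF; have n0 : 0 < n.+2%:R^-1 :> R by rewrite invr_gt0 ltr0n.
rewrite (continuous_FTC2 (@inv_lt n) (F := F)) ?EFinB//.
- apply: continuous_in_subspaceT => x /set_mem /(@D_pos n).
  by rewrite /pos/= in_itv/= andbT; exact: cf.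
- split.
  + move=> x; rewrite in_itv/= => /andP[h _].
    by have [] := dF x (lt_trans n0 h).
  + apply/cvg_at_right_filter/differentiable_continuous/derivable1_diffP.
    by have [] := dF n.+2%:R^-1 n0.
  + apply/cvg_at_left_filter/differentiable_continuous/derivable1_diffP.
    by have [] := dF n.+2%:R (ltr0Sn _ _).
- move=> x; rewrite in_itv/= => /andP[h _].
  by rewrite derive1E; have [_ ->] := dF x (lt_trans n0 h).
Qed.

Lemma integrable_pos_bounded (f : R -> R) (M : R) :
  measurable_fun pos f -> (forall x, 0 < x -> 0 <= f x) ->
  (forall n, (\int[mu]_(x in D n) (f x)%:E <= M%:E)%E) ->
  mu.-integrable pos (EFin \o f).
Proof.
move=> mf f0 hM; have mfE : measurable_fun pos (EFin \o f) by exact/measurable_EFinP.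
apply/integrableP; split; first exact: mfE.
have -> : (\int[mu]_(x in pos) `|(EFin \o f) x|)%E = (\int[mu]_(x in pos) (f x)%:E)%E.
  apply: eq_integral => x /set_mem; rewrite /pos/= in_itv/= andbT => x0.
  by rewrite ger0_norm// f0.
apply: (@le_lt_trans _ _ M%:E); last by rewrite ltry.
have h : (\int[mu]_(x in D n) (f x)%:E)%E @[n --> \oo] -->
    (\int[mu]_(x in \bigcup_n D n) (f x)%:E)%E.
  have mfD n : measurable_fun (D n) (EFin \o f).
    exact: (measurable_funS mpos (@D_pos n)).
  have f0D n x : D n x -> (0 <= (EFin \o f) x)%E.
    by move/(@D_pos n); rewrite /pos/= in_itv/= andbT lee_fin; exact: f0.
  have hh := (@ge0_nondecreasing_set_cvg_integral _ _ R _ _ mu D_homo mD mfD f0D). exact: hh.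
rewrite bigcup_D in h; apply: (cvge_le _ h); exact: nearW.
Qed.

(** Dominated convergence by [|f|] along the segments [D n]. The end at 0 has to be improper too,
    since the integrand of [Gamma a] is unbounded there for [a < 1]. *)
Lemma continuous_FTC2_half_line (f F : R -> R) (l0 l1 : R) :
  (forall x, 0 < x -> {for x, continuous f}) ->
  (forall x : R, 0 < x -> is_derive x 1 F (f x)) ->
  mu.-integrable pos (EFin \o f) ->
  F n.+2%:R @[n --> \oo] --> l1 -> F n.+2%:R^-1 @[n --> \oo] --> l0 ->
  \int[mu]_(x in pos) f x = l1 - l0.
Proof.
move=> cf dF fi F1 F0.
have mfE : measurable_fun pos (EFin \o f).
  by apply/measurable_EFinP; exact: continuous_pos_measurable.
have h1 : (\int[mu]_(x in D n) (f x)%:E)%E @[n --> \oo] -->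
    (\int[mu]_(x in pos) (f x)%:E)%E.
  have -> : (fun n => (\int[mu]_(x in D n) (f x)%:E)%E) =
     (fun n => (\int[mu]_(x in pos) ((EFin \o f) \_ (D n)) x)%E).
    apply/funext => n; rewrite [LHS]integral_mkcond [RHS]integral_mkcond.
    apply: eq_integral => x _; rewrite !patchE; case: ifPn => [xD|_].
      by rewrite mem_set//; exact: (D_pos (set_mem xD)).
    by case: ifP.
  apply: (@dominated_cvg _ _ _ mu pos mpos
    (fun n => (EFin \o f) \_ (D n)) (EFin \o f) (fun x => `|(f x)%:E|%E)).
  - move=> n; apply: (measurable_funTS).
    apply: ((measurable_restrictT _ (mD n)).1 (measurable_funS mpos (@D_pos n) mfE)).
  - move=> x px; apply: cvg_near_cst; apply: filterS (D_near px) => n Dn.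
    by rewrite patchE mem_set.
  - by [].
  - exact: integrable_abse.
  - by move=> n x _; rewrite patchE; case: ifPn => // _; rewrite abse0.
have h3 : (F n.+2%:R - F n.+2%:R^-1)%:E @[n --> \oo] --> (l1 - l0)%:E.
  by apply: cvg_EFin; [exact: nearW|exact: cvgB].
have e : (fun n => (\int[mu]_(x in D n) (f x)%:E)%E) =
         (fun n => (F n.+2%:R - F n.+2%:R^-1)%:E).
  by apply/funext => n; exact: FTC_D.
rewrite e in h1; rewrite /Rintegral.
suff -> : (\int[mu]_(x in pos) (f x)%:E)%E = (l1 - l0)%:E by [].
exact: cvg_unique h1 h3.
Qed.

Lemma integrable_expRN (c : R) : 0 < c ->
  mu.-integrable pos (EFin \o (fun t => expR (- (t / c)))).
Proof.
move=> c0; have d1 (x : R) : is_derive x 1 (fun t => expR (- (t / c))) (- c^-1 * expR (- (x / c))).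
  have d0 : is_derive x 1 (fun t => - (t / c)) (- c^-1).
    by apply: is_derive_eq; rewrite /GRing.scale/=; ring.
  have d2 := @is_derive1_comp R expR (fun t => - (t / c)) x _ _ (is_derive_expR _) d0.
  by apply: (is_derive_eq d2); rewrite mulrC.
have cf (x : R) : 0 < x -> {for x, continuous (fun t : R => expR (- (t / c)))}.
  by move=> _; have [dx _] := d1 x; exact/differentiable_continuous/derivable1_diffP.
apply: (@integrable_pos_bounded _ c) => [||n].
- exact: continuous_pos_measurable.
- by move=> x _; exact: expR_ge0.
have dF (x : R) : 0 < x ->
    is_derive x 1 (fun t => - c * expR (- (t / c))) (expR (- (x / c))).
  move=> _; have d2 := d1 x; apply: is_derive_eq; rewrite /GRing.scale/=; field.
  by rewrite gt_eqF.
rewrite (FTC_D n cf dF).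
rewrite lee_fin !mulNr opprK addrC lerBlDr.
have h : expR (- (n.+2%:R^-1 / c)) <= 1.
  by rewrite expR_le1 oppr_le0 divr_ge0// ltW.
by rewrite (le_trans (ler_wpM2l (ltW c0) h))// mulr1 lerDl mulr_ge0 ?expR_ge0// ltW.
Qed.

End half_line_FTC.

(** * The functional equation of the Gamma function *)

Section gamma_function.
Context {R : realType}.
Local Notation mu := (@lebesgue_measure R).
Local Notation pos := (`]0, +oo[%classic : set R).
Implicit Types a x t : R.

Let g a t := t `^ (a - 1) * expR (- t).

Let pos_gt0 x : pos x -> 0 < x. Proof. by rewrite /= in_itv/= andbT. Qed.

(** This primitive yields both the integrability of [g a] near 0 and the functional equation. *)
Let is_derive_F a x : 0 < x ->
  is_derive x 1 (fun t => t `^ a * expR (- t)) (a * g a x - g (a + 1) x).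
Proof.
move=> x0; have d1 := is_derive1_powR a x0.
have d0 : is_derive x 1 (fun t => - t) (-1 : R) by apply: is_derive_eq.
have d2 := @is_derive1_comp R expR (fun t => - t) x _ _ (is_derive_expR _) d0.
by apply: is_derive_eq; rewrite /g /GRing.scale/= addrK; ring.
Qed.

Let cont_g a x : 0 < x -> {for x, continuous (g a)}.
Proof.
move=> x0; have [dx _] := is_derive_F (a - 1) x0.
exact/differentiable_continuous/derivable1_diffP.
Qed.

Let powR_exp_bound b : 0 <= b -> exists2 C, 0 <= C &
  forall t, 0 < t -> t `^ b * expR (- t) <= C * expR (- (t / 2)).
Proof.
(* The bound comes from [ln (t / c) < t / c], and [c >= 2 b] gives [b t / c <= t / 2]. *)
move=> b0; pose c := 2 * (b + 1); have c0 : 0 < c by rewrite /c; lra.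
exists (expR (b * ln c)); first exact: expR_ge0.
move=> t t0; rewrite /powR gt_eqF// -!expRD ler_expR.
have h : ln t <= t / c + ln c.
  rewrite -lerBlDr -ln_div ?posrE//; apply/ltW/ln_sublinear; exact: divr_gt0.
have h2 := ler_wpM2l b0 h.
suff : b * (t / c) <= t / 2 by move: h2; rewrite mulrDr; lra.
rewrite mulrCA ler_wpM2l ?(ltW t0)// ler_pdivrMr// /c; lra.
Qed.

Let integrable_powR_exp b : 0 <= b ->
  mu.-integrable pos (EFin \o (fun t => t `^ b * expR (- t))).
Proof.
move=> b0; have [C C0 hC] := powR_exp_bound b0.
apply: (@le_integrable _ _ _ mu pos _ _ (fun t => (C%:E * (expR (- (t / 2)))%:E)%E)).
- exact: measurable_itv.
- apply/measurable_EFinP; apply: continuous_pos_measurable => x x0.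
  by have := @cont_g (b + 1) x x0; rewrite /g addrK.
- move=> x /pos_gt0 x0 /=; rewrite lee_fin ger0_norm ?mulr_ge0 ?powR_ge0 ?expR_ge0//.
  by rewrite ger0_norm ?mulr_ge0 ?expR_ge0// hC.
- by apply: integrableZl; [exact: measurable_itv|exact: integrable_expRN].
Qed.

(** The behavior at 0 is controlled through the primitive [t^a exp (- t)], which lies between 0 and
    [C]: the integrals of [a * g a] over the segments exceed those of [g (a + 1)] by at most [C]. *)
Lemma integrable_gamma a : 0 < a -> mu.-integrable pos (EFin \o g a).
Proof.
move=> a0.
have [C C0 hC] := powR_exp_bound (ltW a0).
have i1 : mu.-integrable pos (EFin \o g (a + 1)).
  have -> : g (a + 1) = fun t => t `^ a * expR (- t).
    by apply/funext => t; rewrite /g addrK.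
  exact: integrable_powR_exp (ltW a0).
have F0 t : 0 <= t `^ a * expR (- t) by rewrite mulr_ge0 ?powR_ge0 ?expR_ge0.
have FC t : 0 < t -> t `^ a * expR (- t) <= C.
  move=> t0; rewrite (le_trans (hC t t0))// ler_piMr// expR_le1 oppr_le0.
  by rewrite divr_ge0// ltW.
have g0 b t : 0 <= g b t by rewrite mulr_ge0 ?powR_ge0 ?expR_ge0.
pose I1 := \int[mu]_(t in pos) g (a + 1) t.
have iag : mu.-integrable pos (EFin \o (fun t => a * g a t)).
  have cag x : 0 < x -> {for x, continuous (fun t : R => a * g a t)}.
    by move=> x0; apply: cvgM; [exact: cvg_cst|exact: cont_g].
  apply: (@integrable_pos_bounded _ _ (C + I1)) => [|x x0|n].
  - exact: continuous_pos_measurable.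
  - by rewrite mulr_ge0// ltW.
  set D := `[_, _]%classic.
  have mD : measurable D by exact: measurable_itv.
  have Dpos : D `<=` pos.
    move=> x; rewrite /D/= !in_itv/= andbT => /andP[h _].
    by rewrite (lt_le_trans _ h)// invr_gt0 ltr0n.
  have cD f : (forall x, 0 < x -> {for x, continuous f}) -> mu.-integrable D (EFin \o f).
    move=> cf; apply: continuous_compact_integrable; first exact: segment_compact.
    by apply: continuous_in_subspaceT => x /set_mem/Dpos/pos_gt0; exact: cf.
  have cF x : 0 < x -> {for x, continuous (fun t : R => a * g a t - g (a + 1) t)}.
    by move=> x0; apply: cvgB; [exact: cag|exact: cont_g].
  have := FTC_D n cF (@is_derive_F a); rewrite -/D => e.
  have -> : (\int[mu]_(x in D) (a * g a x)%:E)%E =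
     (\int[mu]_(x in D) ((a * g a x - g (a + 1) x)%:E + (g (a + 1) x)%:E))%E.
    by apply: eq_integral => x _; rewrite -EFinD subrK.
  rewrite integralD//; [|exact: cD cF|exact: cD (@cont_g _)].
  rewrite e [X in (_ <= X)%E]EFinD; apply: leeD.
    by rewrite lee_fin lerBlDr (le_trans (FC _ (ltr0Sn _ _)))// lerDl.
  rewrite /I1 /Rintegral fineK; last exact: integrable_fin_num i1.
  apply: ge0_subset_integral => //.
  - exact: measurable_int i1.
  - by move=> x _; rewrite lee_fin.
have -> : EFin \o g a = (fun t => (a^-1%:E * (EFin \o (fun t => (a * g a t)%R)) t)%E).
  by apply/funext => t; rewrite /= -EFinM mulKf// gt_eqF.
by apply: integrableZl => //; exact: measurable_itv.
Qed.

Let cvg_expRN2 : expR (- (n.+2%:R / 2)) @[n --> \oo] --> (0 : R).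
Proof.
have h : 2 * n.+1%:R^-1 @[n --> \oo] --> (0 : R).
  by rewrite -[X in _ --> X](mulr0 2); apply: cvgM; [exact: cvg_cst|exact: cvg_harmonic].
apply: (squeeze_cvgr _ (cvg_cst 0) h); apply: nearW => n.
rewrite expR_ge0/= expRN ler_pdivlMr ?ltr0n// mulrC ler_pdivrMr ?expR_gt0//.
rewrite (le_trans _ (ler_wpM2l (ler0n _ 2) (expR_ge1Dx _)))//.
rewrite mulrDr mulr1 (mulrC 2 (_ / 2)) divfK// -[n.+2%:R]natr1; lra.
Qed.

Lemma Gamma_rec a : 0 < a -> Gamma (a + 1) = a * Gamma a.
Proof.
move=> a0; have a10 : 0 < a + 1 by rewrite addr_gt0.
have i0 := integrable_gamma a0; have i1 := integrable_gamma a10.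
have ia : mu.-integrable pos (EFin \o (fun t => a * g a t)).
  have -> : EFin \o (fun t => a * g a t) = (fun t => (a%:E * (EFin \o g a) t)%E).
    by apply/funext => t.
  by apply: integrableZl => //; exact: measurable_itv.
have [C C0 hC] := powR_exp_bound (ltW a0).
have : \int[mu]_(t in pos) (a * g a t - g (a + 1) t) = 0 - 0.
  apply: (@continuous_FTC2_half_line _ _ (fun t => t `^ a * expR (- t))).
  - move=> x x0; apply: cvgB; last exact: cont_g.
    by apply: cvgM; [exact: cvg_cst|exact: cont_g].
  - exact: is_derive_F.
  - have -> : EFin \o (fun t => a * g a t - g (a + 1) t) =
       ((EFin \o (fun t => (a * g a t)%R)) \- (EFin \o g (a + 1)%R))%E by apply/funext.
    by apply: integrableB => //; exact: measurable_itv.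
  - have h : C * expR (- (n.+2%:R / 2)) @[n --> \oo] --> 0.
      by rewrite -[X in _ --> X](mulr0 C); apply: cvgM; [exact: cvg_cst|exact: cvg_expRN2].
    apply: (squeeze_cvgr _ (cvg_cst 0) h); apply: nearW => n.
    by rewrite mulr_ge0 ?powR_ge0 ?expR_ge0//= hC.
  - have h : n.+2%:R^-1 `^ a @[n --> \oo] --> 0.
      have := powR_cvg0 a0; move/cvg_at_rightP => /(_ (fun n => n.+2%:R^-1)); apply.
      split; first by move=> n; rewrite invr_gt0 ltr0n.
      by have := @cvg_harmonic R; rewrite -cvg_shiftS.
    apply: (squeeze_cvgr _ (cvg_cst 0) h); apply: nearW => n.
    rewrite mulr_ge0 ?powR_ge0 ?expR_ge0//= ler_piMr ?powR_ge0// expR_le1 oppr_le0.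
rewrite RintegralB// ?RintegralZl// ?subr0; do ?[exact: measurable_itv].
by move=> /eqP; rewrite subr_eq0 => /eqP.
Qed.

Lemma Gamma1 : Gamma (1 : R) = 1.
Proof.
rewrite /Gamma; transitivity (\int[mu]_(t in pos) expR (- t)).
  by apply: eq_Rintegral => t _; rewrite subrr powRr0 mul1r.
have d1 (x : R) : is_derive x 1 (fun t => - expR (- t)) (expR (- x)).
  have d0 : is_derive x 1 (fun t => - t) (-1 : R) by apply: is_derive_eq.
  have d2 := @is_derive1_comp R expR (fun t => - t) x _ _ (is_derive_expR _) d0.
  by apply: is_derive_eq; ring.
have l1 : - expR (- n.+2%:R) @[n --> \oo] --> (0 : R).
  rewrite -oppr0; apply: cvgN.
  apply: (squeeze_cvgr _ (cvg_cst 0) cvg_expRN2); apply: nearW => n.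
  by rewrite expR_ge0/= ler_expR lerN2 ler_pdivrMr// ler_peMr// ler1n.
have l0 : - expR (- (n.+2%:R^-1)) @[n --> \oo] --> (- 1 : R).
  have h : n.+2%:R^-1 @[n --> \oo] --> (0 : R).
    by have := @cvg_harmonic R; rewrite -cvg_shiftS.
  have h0 : - (n.+2%:R^-1) @[n --> \oo] --> (0 : R).
    by rewrite -[X in _ --> X]oppr0; exact: cvgN.
  have h1 := continuous_cvg _ (@continuous_expR R 0) h0.
  rewrite expR0 in h1; have h2 := cvgN (h1 _); exact: h2.
have cf (x : R) : 0 < x -> {for x, continuous (fun t : R => expR (- t))}.
  move=> _; apply: continuous_comp; first exact: opp_continuous.
  exact: continuous_expR.
have ie : mu.-integrable pos (EFin \o (fun t => expR (- t))).
  have := @integrable_expRN R 1 ltr01.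
  by rewrite (_ : (fun t => expR (- (t / 1))) = (fun t => expR (- t)))//; apply/funext => t; rewrite divr1.
have := continuous_FTC2_half_line cf (fun x _ => d1 x) ie l1 l0.
by rewrite sub0r opprK.
Qed.

(** It is enough to bound [Gamma (a + 1)] below: its integrand is at least [exp (-2)] on
    [[1, 2]]. *)
Lemma Gamma_gt0 a : 0 < a -> 0 < Gamma a.
Proof.
move=> a0; have a10 : 0 < a + 1 by rewrite addr_gt0.
rewrite -(pmulr_rgt0 _ a0) -Gamma_rec//.
have i1 := integrable_gamma a10.
pose D := `[(1:R), 2]%classic.
have mD : measurable D by exact: measurable_itv.
have Dpos : D `<=` pos.
  by move=> x; rewrite /D/= !in_itv/= andbT => /andP[h _]; rewrite (lt_le_trans _ h).
have e2 : 0 < expR (-2) :> R by exact: expR_gt0.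
apply: (lt_le_trans e2); rewrite /Gamma -lee_fin /Rintegral fineK; last first.
  exact: integrable_fin_num i1.
apply: (@le_trans _ _ (\int[mu]_(t in D) (g (a + 1) t)%:E)%E); last first.
  apply: ge0_subset_integral => //.
  - exact: measurable_int i1.
  - by move=> x _; rewrite lee_fin mulr_ge0 ?powR_ge0 ?expR_ge0.
apply: (@le_trans _ _ (\int[mu]_(t in D) (expR (-2))%:E)%E).
  rewrite integral_cst//= lebesgue_measure_itv/= lte_fin ltr1n/= -EFinB -EFinM lee_fin.
  by rewrite ler_pMr//; lra.
apply: ge0_le_integral => //.
- exact: (measurable_funS _ Dpos (measurable_int _ i1)).
- move=> x; rewrite /D/= in_itv/= => /andP[x1 x2]; rewrite lee_fin /g addrK.
  rewrite -[leLHS]mul1r ler_pM ?expR_ge0 ?ler_expR ?lerN2//.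
  by rewrite -(powRr0 x) ler_powR// ltW.
Qed.

End gamma_function.

(** * Bessel functions as Funk-Hecke coefficients *)

Section bessel.
Context {R : realType}.
Implicit Types a x : R.

(** For [m = k + 2 l], this is [x^m / m! * kap m k]; the sum over [l] is the Funk-Hecke coefficient
    of [exp (x u)] in degree [k]. *)
Definition funk_hecke_term (p k : nat) x (l : nat) : R :=
  x ^+ (k + l.*2) / (l`!%:R * 2 ^+ l * \prod_(i < k + l) (p%:R + 2 * i%:R)).

Definition funk_hecke (p k : nat) x : R := limn (series (funk_hecke_term p k x)).

Lemma Gamma_addn a n : 0 < a -> Gamma (a + n%:R) = Gamma a * \prod_(i < n) (a + i%:R).
Proof.
move=> a0; elim: n => [|n IH]; first by rewrite addr0 big_ord0 mulr1.
rewrite -natr1 addrA Gamma_rec ?ltr_wpDr// IH big_ord_recr/=; ring.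
Qed.

Lemma prod_ge1 p n : (0 < p)%N -> 1 <= \prod_(i < n) (p%:R + 2 * i%:R) :> R.
Proof.
move=> p0; elim: n => [|n IH]; first by rewrite big_ord0.
rewrite big_ord_recr/= -[leLHS]mulr1 ler_pM//.
have : 1 <= p%:R :> R by rewrite ler1n.
by have := ler0n R n; lra.
Qed.

Lemma is_cvg_funk_hecke p k x : (0 < p)%N -> 0 <= x ->
  cvgn (series (funk_hecke_term p k x)).
Proof.
move=> p0 x0; apply: (@series_le_cvg _ _ (fun l => x ^+ k * exp_coeff (x ^+ 2) l)).
- move=> l; rewrite divr_ge0 ?exprn_ge0// !mulr_ge0 ?exprn_ge0//.
  exact: le_trans ler01 (prod_ge1 _ p0).
- by move=> l; rewrite mulr_ge0 ?exprn_ge0// divr_ge0// exprn_ge0// exprn_ge0.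
- move=> l; rewrite /funk_hecke_term /exp_coeff/= exprD -muln2 mulnC exprM mulrA.
  rewrite ler_wpM2l ?mulr_ge0 ?exprn_ge0//.
  have f0 : 0 < l`!%:R :> R by rewrite ltr0n fact_gt0.
  rewrite lef_pV2 ?posrE ?mulr_gt0 ?exprn_gt0 ?(lt_le_trans _ (prod_ge1 _ p0))//.
  rewrite -mulrA ler_peMr ?(ltW f0)// mulr_ege1 ?prod_ge1//.
  by rewrite exprn_ege1// ler1n.
- exact: is_cvg_seriesZ (is_cvg_series_exp_coeff _).
Qed.

(** Termwise: the functional equation turns [Gamma (alpha + 1 + k + m)] into [Gamma (alpha + 1)]
    times a product whose factors are [(p + 2 i) / 2]. *)
Lemma besselI_funk_hecke (p k : nat) (alpha x : R) : (0 < p)%N -> 0 < x -> 0 <= alpha ->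
  p%:R = 2 * alpha + 2 ->
  besselI (alpha + k%:R) x = (x / 2) `^ alpha / Gamma (alpha + 1) * funk_hecke p k x.
Proof.
move=> p0 x0 al0 pE; have x20 : 0 < x / 2 by rewrite divr_gt0.
have a10 : 0 < alpha + 1 by rewrite ltr_wpDl.
have G0 : Gamma (alpha + 1) != 0 by rewrite gt_eqF// Gamma_gt0.
rewrite /besselI.
have -> : (fun m : nat => (x / 2) `^ (m%:R *+ 2 + (alpha + k%:R)) /
    (m`!%:R * Gamma (m%:R + (alpha + k%:R) + 1))) =
    (x / 2) `^ alpha / Gamma (alpha + 1) *: funk_hecke_term p k x.
  apply/funext => m; rewrite fctE/= /GRing.scale/= /funk_hecke_term.
  have -> : m%:R *+ 2 + (alpha + k%:R) = alpha + (k + m.*2)%:R :> R.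
    by rewrite natrD -muln2 natrM mulr2n; ring.
  rewrite powRD; last by rewrite (gt_eqF x20) implybT.
  rewrite powR_mulrn ?(ltW x20)//.
  have -> : m%:R + (alpha + k%:R) + 1 = alpha + 1 + (k + m)%:R :> R.
    by rewrite natrD; ring.
  rewrite Gamma_addn//.
  have -> : \prod_(i < k + m) (p%:R + 2 * i%:R) =
      2 ^+ (k + m) * \prod_(i < k + m) (alpha + 1 + i%:R) :> R.
    rewrite -[in 2 ^+ _](card_ord (k + m)) -prodr_const -big_split/=.
    by apply: eq_bigr => i _; rewrite pE; ring.
  set Pr := \prod_(i < _) (alpha + 1 + _).
  have Pr0 : Pr != 0 by apply/prodf_neq0 => i _; rewrite gt_eqF// ltr_wpDr.
  have f0 : m`!%:R != 0 :> R by rewrite pnatr_eq0 -lt0n fact_gt0.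
  rewrite exprMn exprVn.
  have -> : (2 : R) ^+ (k + m.*2) = 2 ^+ m * 2 ^+ (k + m).
    by rewrite -exprD addnCA -addnn.
  have e1 : (2 : R) ^+ m != 0 by rewrite expf_neq0.
  have e2 : (2 : R) ^+ (k + m) != 0 by rewrite expf_neq0.
  by move: (x ^+ _) (Gamma _) G0 (_ `^ _) => ? ? ? ?; field; do ?[apply/andP; split].
rewrite lim_seriesZ//; apply: is_cvg_funk_hecke => //; exact: ltW.
Qed.

(** Here [alpha = (p - 2) / 2]. For [p > 2], [Gamma (alpha + 1) = alpha * Gamma alpha] cancels the
    Gamma factor of [c_coef], and the square of [(x / 2)^alpha] is an integer power that cancels the
    powers of [x] and 2. *)
Lemma gamma_c_coef (p k : nat) (x : R) : (1 < p)%N -> 0 < x ->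
  gamma_coef p k * c_coef p k x =
    (k%:R * (k%:R + p%:R - 2) * funk_hecke p k x) ^+ 2.
Proof.
move=> p1 x0; rewrite /gamma_coef /c_coef; case: eqVneq => [->|p2].
  have := @besselI_funk_hecke 2 k 0 x isT x0 (lexx 0).
  rewrite mulr0 add0r => /(_ erefl); rewrite add0r powRr0 add0r Gamma1 divr1 mul1r => ->.
  (* [gamma_coef] is different at [k = 0], but both sides vanish there. *)
  case: k => [|k].
    by rewrite expr0n/= !(mulr0, mul0r) expr0n.
  by rewrite /= addr0 addrK mul1r; field.
have p3 : (2 < p)%N by rewrite ltn_neqAle eq_sym p2.
set al := (p%:R - 2) / 2; have al0 : 0 < al.
  by rewrite divr_gt0// subr_gt0 (ltr_nat R 2 p).
have pE : p%:R = 2 * al + 2 :> R by rewrite /al; field.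
rewrite (besselI_funk_hecke k (ltnW p1) x0 (ltW al0) pE) Gamma_rec//.
set M := funk_hecke p k x.
have G0 : Gamma al != 0 by rewrite gt_eqF// Gamma_gt0.
have x2 : 0 < x / 2 by rewrite divr_gt0.
have pw : ((x / 2) `^ al) ^+ 2 = x ^+ (p - 2) / 2 ^+ (p - 2).
  rewrite -powR_mulrn ?powR_ge0// -powRrM (_ : al * 2%:R = (p - 2)%:R); last first.
    by rewrite natrB ?(ltnW p3)// /al divfK.
  by rewrite powR_mulrn ?(ltW x2)// exprMn exprVn.
have -> : (2 : R) ^+ (p - 3) = 2 ^+ (p - 2) / 2.
  have -> : (p - 2 = (p - 3).+1)%N by rewrite -subSn.
  by rewrite exprS mulrC mulKf.
have kp0 : 2 * k%:R + 2 * al != 0 :> R.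
  by rewrite gt_eqF// ltr_wpDl ?mulr_ge0// mulr_gt0.
have xn0 : x ^+ (p - 2) != 0 by rewrite expf_neq0// gt_eqF.
have e2 : (2 : R) ^+ (p - 2) != 0 by rewrite expf_neq0.
have -> : Gamma al * (k%:R * (k%:R + p%:R - 2)) *
    ((x / 2) `^ al / (al * Gamma al) * M) =
    (x / 2) `^ al * (k%:R * (k%:R + p%:R - 2) * M / al).
  by field; rewrite gt_eqF// G0.
rewrite exprMn pw !pE.
have al0' : al != 0 by rewrite gt_eqF.
move: kp0 xn0 e2; set u := x ^+ (p - 2); set v := 2 ^+ (p - 2) => kp0 xn0 e2.
rewrite -[k%:R *+ 2]mulr_natr.
field; do ?[apply/andP; split] => //.
by rewrite (_ : _ - 2 = 2 * k%:R + 2 * al)//; ring.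
Qed.

End bessel.

(** * The Laplace-Beltrami operator on exponentials *)

(* The value at [x], for [x] and [t] on the sphere and [u = t.x], of the
   Laplace-Beltrami operator applied to [exp (lambda t.x)]. *)
Definition lb_exp_kernel {R : realType} (p : nat) (lambda u : R) : R :=
  (lambda ^+ 2 * (1 - u ^+ 2) - lambda * (p%:R - 1) * u) * expR (lambda * u).

(** [g] describes [f] along a line on which [a] has parameter [c]; this shift makes it possible to
    differentiate at every point of the line near [s], and then a second time. *)
Lemma derive_along_line {R : realType} {p : nat} (f : 'rV[R]_p -> R)
    (a v : 'rV[R]_p) (g : R -> R) (c l : R) :
  (\forall h \near (0 : R), f (h *: v + a) = g (h + c)) ->
  h^-1 *: (g (h + c) - g c) @[h --> 0^'] --> l ->
  'D_v f a = l.
Proof.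
move=> fg gl; have f0 : f a = g c.
  by have := nbhs_singleton fg; rewrite scale0r !add0r.
apply: cvg_lim => //; apply: cvg_trans gl; apply: near_eq_cvg.
by apply: cvg_within; near=> h; rewrite /= f0 (near fg h).
Unshelve. all: by end_near. Qed.

Section radial_extension.
Context {R : realType}.
Variables (s a b lambda : R).
Hypotheses (s1 : `|s| <= 1) (a1 : `|a| <= 1) (b1 : `|b| <= 1).

(* [g h] is the inverse of the norm of [x + h e_i], where [x_i = s]; and
   [psi h] is the scalar product of the normalization of [x + h e_i] with [y],
   where [a = x.y] and [b = y_i]. *)
Definition rad_inv (h : R) := (Num.sqrt (1 + 2 * h * s + h ^+ 2))^-1.
Definition rad_psi (h : R) := (a + h * b) * rad_inv h.
Definition rad_psi1 (h : R) :=
  b * rad_inv h - (a + h * b) * (s + h) * rad_inv h ^+ 3.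
Definition rad_psi2 (h : R) :=
  3 * (a + h * b) * (s + h) ^+ 2 * rad_inv h ^+ 5
  - (2 * b * (s + h) + (a + h * b)) * rad_inv h ^+ 3.
Definition rad_phi (h : R) := expR (lambda * rad_psi h).
Definition rad_phi1 (h : R) := rad_phi h * (lambda * rad_psi1 h).
Definition rad_phi2 (h : R) :=
  rad_phi h * (lambda ^+ 2 * rad_psi1 h ^+ 2 + lambda * rad_psi2 h).

(** For these [h] the squared norm is at least [(1 - |h|)^2 >= 1/4], so that the inverse norm is
    smooth and bounded by 2. *)
Let I : set R := `](- (1/2)), (1/2)[.

Lemma rad_pos h : I h -> 1/4 <= 1 + 2 * h * s + h ^+ 2.
Proof.
rewrite /I/= in_itv/= => h12.
have k2 : `|h| < 1/2 by rewrite ltr_norml.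
have hs : - `|h| <= h * s.
  by rewrite lerNl (le_trans (ler_norm _))// normrN normrM ler_piMr.
have -> : h ^+ 2 = `|h| ^+ 2 by rewrite real_normK ?num_real.
by move: (normr_ge0 h) k2 hs; set k := `|h|; nra.
Qed.

Lemma rad_inv_bound h : I h -> `|rad_inv h| <= 2.
Proof.
move=> /rad_pos hp; rewrite /rad_inv ger0_norm ?invr_ge0 ?sqrtr_ge0//.
have h2 : 2^-1 <= Num.sqrt (1 + 2 * h * s + h ^+ 2).
  rewrite -[2^-1]ger0_norm// -sqrtr_sqr ler_sqrt; last by lra.
  by rewrite (le_trans _ hp)// expr2; lra.
by rewrite -[leRHS]invrK lef_pV2 ?posrE ?(lt_le_trans _ h2)// invr_gt0.
Qed.

Lemma is_derive_rad_inv h : I h ->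
  is_derive h 1 rad_inv (- (s + h) * rad_inv h ^+ 3).
Proof.
move=> /rad_pos hp; have q0 : 0 < 1 + 2 * h * s + h ^+ 2 by lra.
have dq : is_derive h 1 (fun h => 1 + 2 * h * s + h ^+ 2) (2 * s + 2 * h).
  apply: is_derive_eq; rewrite /GRing.scale/=; ring.
have ds := is_derive1_sqrt q0.
have dc := @is_derive1_comp R Num.sqrt (fun h => 1 + 2 * h * s + h ^+ 2) h _ _ ds dq.
have r0 : Num.sqrt (1 + 2 * h * s + h ^+ 2) != 0 by rewrite gt_eqF// sqrtr_gt0.
apply: (is_derive_eq (is_deriveV (f := fun h => Num.sqrt (1 + 2 * h * s + h ^+ 2)) r0 dc)).
rewrite /rad_inv /GRing.scale/=; field; rewrite r0 //.
Qed.

Lemma is_derive_rad_psi h : I h -> is_derive h 1 rad_psi (rad_psi1 h).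
Proof.
move=> Ih; have dg := is_derive_rad_inv Ih; rewrite /rad_psi.
by apply: is_derive_eq; rewrite /rad_psi1 /GRing.scale/=; ring.
Qed.

Lemma is_derive_rad_psi1 h : I h -> is_derive h 1 rad_psi1 (rad_psi2 h).
Proof.
move=> Ih; have dg := is_derive_rad_inv Ih; rewrite /rad_psi1.
by apply: is_derive_eq; rewrite /rad_psi2 /GRing.scale/=; ring.
Qed.

Lemma is_derive_rad_phi h : I h -> is_derive h 1 rad_phi (rad_phi1 h).
Proof.
move=> Ih; have dp := is_derive_rad_psi Ih.
have dl : is_derive h 1 (fun h => lambda * rad_psi h) (lambda * rad_psi1 h).
  by apply: is_derive_eq; rewrite /GRing.scale/=; ring.
exact: (is_derive1_comp (is_derive_expR _) dl).
Qed.

Lemma is_derive_rad_phi1 h : I h -> is_derive h 1 rad_phi1 (rad_phi2 h).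
Proof.
move=> Ih; have dp := is_derive_rad_phi Ih; have dq := is_derive_rad_psi1 Ih.
rewrite /rad_phi1; apply: is_derive_eq.
by rewrite /rad_phi2 /rad_phi1 /GRing.scale/=; ring.
Qed.

(** The constants 3, 20 and 400 come from [|a + h b| <= 3/2], [|s + h| <= 3/2] and [rad_inv <= 2].
    They only have to be independent of [s], [a], [b] and [h], to dominate the derivatives under the
    integral. *)
Definition rad_bound1 : R := expR (3 * `|lambda|) * (`|lambda| * 20).
Definition rad_bound2 : R :=
  expR (3 * `|lambda|) * (`|lambda| ^+ 2 * 400 + `|lambda| * 400).

Lemma itv_bound h : I h -> `|h| <= 1/2.
Proof. by rewrite /I/= in_itv/= => h12; rewrite ltW// ltr_norml. Qed.

Lemma norm_lin_bound h : I h -> `|a + h * b| <= 3/2.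
Proof.
move=> /itv_bound h2; rewrite (le_trans (ler_normD _ _))// normrM.
have -> : 3/2 = 1 + 1/2 * 1 :> R by lra.
by rewrite lerD// ler_pM.
Qed.

Lemma norm_sh_bound h : I h -> `|s + h| <= 3/2.
Proof.
move=> /itv_bound h2; rewrite (le_trans (ler_normD _ _))//.
have -> : 3/2 = 1 + 1/2 :> R by lra.
by rewrite lerD.
Qed.

Lemma rad_inv_exp_bound h n : I h -> `|rad_inv h ^+ n| <= 2 ^+ n.
Proof. by move=> Ih; rewrite normrX lerXn2r ?nnegrE// rad_inv_bound. Qed.

Lemma rad_phi_bound h : I h -> `|rad_phi h| <= expR (3 * `|lambda|).
Proof.
move=> Ih; rewrite ger0_norm ?expR_ge0// ler_expR (le_trans (ler_norm _))//.
rewrite normrM mulrC ler_wpM2r// normrM.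
have := ler_pM (normr_ge0 _) (normr_ge0 _) (norm_lin_bound Ih) (rad_inv_bound Ih).
by move=> /le_trans; apply; lra.
Qed.

Lemma rad_psi1_bound h : I h -> `|rad_psi1 h| <= 20.
Proof.
move=> Ih; rewrite (le_trans (ler_normB _ _))// normrM (normrM (_ * (s + h))).
rewrite (normrM (a + h * b)).
have h1 := ler_pM (normr_ge0 _) (normr_ge0 _) b1 (rad_inv_bound Ih).
have h2 := ler_pM (normr_ge0 _) (normr_ge0 _) (norm_lin_bound Ih) (norm_sh_bound Ih).
have h3 := ler_pM (mulr_ge0 (normr_ge0 _) (normr_ge0 _)) (normr_ge0 _) h2
  (rad_inv_exp_bound 3 Ih).
by rewrite (le_trans (lerD h1 h3))//; lra.
Qed.

Lemma rad_psi2_bound h : I h -> `|rad_psi2 h| <= 400.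
Proof.
move=> Ih; rewrite (le_trans (ler_normB _ _))// normrM.
rewrite (normrM _ (rad_inv h ^+ 3)) -(mulrA 3) (normrM 3) (normrM (a + h * b)).
have hs := norm_sh_bound Ih; have hl := norm_lin_bound Ih.
have hs2 : `|(s + h) ^+ 2| <= (3/2) ^+ 2 by rewrite normrX lerXn2r ?nnegrE.
have h1 := ler_pM (normr_ge0 _) (normr_ge0 _) hl hs2.
have h2 := ler_pM (mulr_ge0 (normr_ge0 _) (normr_ge0 _)) (normr_ge0 _) h1
  (rad_inv_exp_bound 5 Ih).
have h3 : `|2 * b * (s + h) + (a + h * b)| <= 5.
  rewrite (le_trans (ler_normD _ _))// !normrM (ger0_norm (ler0n _ 2)).
  have := ler_wpM2l (ler0n _ 2) (ler_pM (normr_ge0 _) (normr_ge0 _) b1 hs).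
  by rewrite mulrA => /lerD/(_ hl)/le_trans; apply; lra.
have h4 := ler_pM (normr_ge0 _) (normr_ge0 _) h3 (rad_inv_exp_bound 3 Ih).
have h5 : `|3 : R| = 3 by rewrite ger0_norm.
move: h2 h4; rewrite h5 -!mulrA => h2 h4.
rewrite (le_trans (lerD (ler_wpM2l (ler0n _ 3) h2) h4))//; lra.
Qed.

Lemma rad_phi1_bound h : I h -> `|rad_phi1 h| <= rad_bound1.
Proof.
move=> Ih; rewrite normrM ler_pM ?rad_phi_bound// normrM.
by rewrite ler_wpM2l// rad_psi1_bound.
Qed.

Lemma rad_phi2_bound h : I h -> `|rad_phi2 h| <= rad_bound2.
Proof.
move=> Ih; rewrite normrM ler_pM ?rad_phi_bound//.
have h1 := rad_psi1_bound Ih; have h2 := rad_psi2_bound Ih.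
rewrite (le_trans (ler_normD _ _))// lerD//; last by rewrite normrM ler_wpM2l.
rewrite normrM !normrX ler_wpM2l ?exprn_ge0//.
by rewrite (_ : 400 = 20 ^+ 2 :> R) ?lerXn2r ?nnegrE// expr2; lra.
Qed.

Lemma rad_phi2_0 : rad_phi2 0 = expR (lambda * a) *
  (lambda ^+ 2 * (b - a * s) ^+ 2 + lambda * (3 * a * s ^+ 2 - 2 * b * s - a)).
Proof.
have g0 : rad_inv 0 = 1 by rewrite /rad_inv mulr0 mul0r expr0n/= !addr0 sqrtr1 invr1.
rewrite /rad_phi2 /rad_phi /rad_psi /rad_psi1 /rad_psi2 g0 !mul0r !addr0 !expr1n.
by rewrite !mulr1; congr (_ * _); ring.
Qed.

End radial_extension.

Section integral_derivative.
Context {R : realType} {d : measure_display} {T : measurableType d}.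
Variable P : probability T R.

Lemma cvg_derivative_integral (f f' : R -> T -> R) (u v c C : R) :
  c \in `]u, v[ ->
  (forall h, h \in `]u, v[ -> bmf (f h)) ->
  (forall h y, h \in `]u, v[ -> is_derive h 1 (f ^~ y) (f' h y)) ->
  (forall h y, h \in `]u, v[ -> `|f' h y| <= C) ->
  h^-1 *: (\int[P]_y f (h + c) y - \int[P]_y f c y) @[h --> 0^'] -->
    \int[P]_y f' c y.
Proof.
move=> Ic bf df bC.
have C0 : 0 <= C by exact: le_trans (normr_ge0 _) (bC c point Ic).
have d1 h y : h \in `]u, v[ -> partial1of2 f h y = f' h y.
  by move=> Ih; rewrite partial1of2E; have [_ ->] := df h y Ih.
have -> : \int[P]_y f' c y = \int[P]_y partial1of2 f c y.
  by apply: eq_Rintegral => y _; rewrite d1.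
apply: (@cvg_differentiation_under_integral _ _ _ P f setT measurableT c u v Ic
  _ _ (fun=> C)) => //.
- by move=> h Ih; apply: bmf_integrable; exact: bf.
- by move=> h y Ih _; have [] := df h y Ih.
- exact: (bmf_integrable P (bmf_cst C)).
- by move=> h y Ih _; rewrite d1// bC.
Qed.

End integral_derivative.

Section laplace_beltrami_integral.
Context {R : realType} {p : nat} {d : measure_display} {T : measurableType d}.
Variables (P : probability T R) (V : T -> 'rV[R]_p) (w : T -> R) (lambda : R).
Hypotheses (mV : measurable_fun setT V) (hV : forall y, sphere (V y)) (hw : bmf w).

Lemma bmf_dotp (x : 'rV[R]_p) : sphere x -> bmf (fun y => dotp x (V y)).
Proof.
move=> hx; split; last by exists 1 => y; exact: dotp_norm_le.
exact: measurable_dotp.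
Qed.

Lemma bmf_coord i : bmf (fun y => V y 0 i).
Proof.
split; last by exists 1 => y; exact: coord_norm_le.
exact: (measurableT_comp (measurable_coord i) mV).
Qed.

Let I : set R := `](- (1/2)), (1/2)[.

Variables (s : 'rV[R]_p) (f : 'rV[R]_p -> R).
Hypotheses (hs : sphere s)
  (hf : forall u, sphere u -> f u = \int[P]_y (w y * expR (lambda * dotp u (V y)))).

Let F (u : 'rV[R]_p) : R := f ((enorm u)^-1 *: u).

Section line.
Variable i : 'I_p.
Let e : 'rV[R]_p := delta_mx 0 i.
Let si := s 0 i.
Let a y := dotp s (V y).
Let b y := V y 0 i.

Let si1 : `|si| <= 1. Proof. exact: coord_norm_le. Qed.
Let a1 y : `|a y| <= 1. Proof. exact: dotp_norm_le. Qed.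
Let b1 y : `|b y| <= 1. Proof. exact: coord_norm_le. Qed.

Lemma dotp_line h (x : 'rV[R]_p) : dotp (h *: e + s) x = dotp s x + h * x 0 i.
Proof.
rewrite /dotp (eq_bigr (fun j => s 0 j * x 0 j + h * ((j == i)%:R * x 0 j))).
  rewrite big_split/= -mulr_sumr; congr (_ + _ * _).
  rewrite (bigD1 i)//= eqxx mul1r big1 ?addr0// => j.
  by move=> /negbTE ->; rewrite mul0r.
by move=> j _; rewrite !mxE eqxx/=; ring.
Qed.

Lemma enorm_line h : enorm (h *: e + s) = Num.sqrt (1 + 2 * h * si + h ^+ 2).
Proof.
rewrite /enorm dotp_line [dotp s _]dotpC dotp_line !mxE !eqxx/=.
by move/sphereP : hs => ->; congr Num.sqrt; rewrite /si; ring.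
Qed.

Lemma F_line h : I h ->
  F (h *: e + s) = \int[P]_y (w y * rad_phi si (a y) (b y) lambda h).
Proof.
move=> Ih; have q0 := rad_pos si1 Ih; rewrite /F hf.
  apply: eq_Rintegral => y _; congr (_ * expR (_ * _)).
  rewrite /rad_psi /rad_inv -enorm_line mulrC -dotp_line /dotp mulr_sumr.
  by apply: eq_bigr => j _; rewrite mxE mulrA.
apply/sphereP; rewrite /dotp.
rewrite (eq_bigr (fun j => (enorm (h *: e + s)) ^- 2 *
   ((h *: e + s) 0 j * (h *: e + s) 0 j))); last first.
  by move=> j _; rewrite mxE -exprVn; ring.
rewrite -mulr_sumr -/(dotp _ _) -[dotp _ _]sqr_sqrtr ?dotp_ge0// -/(enorm _).
rewrite mulVf// expf_neq0// enorm_line gt_eqF// sqrtr_gt0; lra.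
Qed.

Lemma bmf_rad_phi h : bmf (fun y => rad_phi si (a y) (b y) lambda h).
Proof.
apply: (bmf_continuous (g := expR)); first exact: continuous_expR.
apply: bmfZ; apply: bmfM; last exact: bmf_cst.
by apply: bmfD; [exact: bmf_dotp|apply: bmfZ; exact: bmf_coord].
Qed.

Lemma bmf_rad_phi1 h : bmf (fun y => rad_phi1 si (a y) (b y) lambda h).
Proof.
apply: bmfM; first exact: bmf_rad_phi.
apply: bmfZ; apply: bmfB.
  by apply: bmfM; [exact: bmf_coord|exact: bmf_cst].
do 2![apply: bmfM; last exact: bmf_cst].
by apply: bmfD; [exact: bmf_dotp|apply: bmfZ; exact: bmf_coord].
Qed.

Lemma derive2_line : 'D_e (fun y => 'D_e F y) s =
  \int[P]_y (w y * rad_phi2 si (a y) (b y) lambda 0).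
Proof.
have [mw [M hM]] := hw.
have M0 : 0 <= M by exact: le_trans (normr_ge0 _) (hM point).
have I0 : I 0 by rewrite /I/= in_itv/=; lra.
(* The first derivative is needed near [s] and not only at [s], in order to be differentiated
   again. *)
have D1 h : I h -> 'D_e F (h *: e + s) =
    \int[P]_y (w y * rad_phi1 si (a y) (b y) lambda h).
  move=> Ih; apply: (@derive_along_line _ _ _ _ _
    (fun h => \int[P]_y (w y * rad_phi si (a y) (b y) lambda h)) h).
    have Ihn : \forall k \near (0:R), I (k + h).
      have : \forall k \near h, I k by apply: open_nbhs_nbhs; split => //; exact: itv_open.
      by rewrite (near_shift 0); apply: filterS => z /=; rewrite subr0.
    near=> k; rewrite addrA -scalerDl F_line//; exact: (near Ihn k).
  apply: (@cvg_derivative_integral _ _ _ P (fun h y => w y * rad_phi si (a y) (b y) lambda h)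
     (fun h y => w y * rad_phi1 si (a y) (b y) lambda h) _ _ _
     (M * rad_bound1 lambda) Ih) => [k Ik|k y Ik|k y Ik].
  - by apply: bmfM => //; exact: bmf_rad_phi.
  - have dk := @is_derive_rad_phi R si (a y) (b y) lambda si1 k Ik.
    by apply: is_derive_eq; rewrite /GRing.scale/=; ring.
  - by rewrite normrM ler_pM// rad_phi1_bound.
apply: (@derive_along_line _ _ _ _ _
    (fun h => \int[P]_y (w y * rad_phi1 si (a y) (b y) lambda h)) 0).
  have In : \forall k \near (0:R), I k.
    by apply: open_nbhs_nbhs; split => //; exact: itv_open.
  by near=> k; rewrite addr0 D1//; exact: (near In k).
apply: (@cvg_derivative_integral _ _ _ P (fun h y => w y * rad_phi1 si (a y) (b y) lambda h)
   (fun h y => w y * rad_phi2 si (a y) (b y) lambda h) _ _ _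
   (M * rad_bound2 lambda) I0) => [k Ik|k y Ik|k y Ik].
- by apply: bmfM => //; exact: bmf_rad_phi1.
- have dk := @is_derive_rad_phi1 R si (a y) (b y) lambda si1 k Ik.
  by apply: is_derive_eq; rewrite /GRing.scale/=; ring.
- by rewrite normrM ler_pM// rad_phi2_bound.
Unshelve. all: by end_near. Qed.

Lemma bmf_rad_phi2_0 : bmf (fun y => rad_phi2 si (a y) (b y) lambda 0).
Proof.
under eq_fun do rewrite rad_phi2_0.
have ba := bmf_dotp hs; have bb := bmf_coord i.
apply: bmfM.
  apply: (bmf_continuous (g := expR)); first exact: continuous_expR.
  exact: bmfZ.
apply: bmfD; apply: bmfZ.
  apply: bmfX; apply: bmfB => //; apply: bmfM => //; exact: bmf_cst.
apply: bmfB => //; apply: bmfB.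
  by apply: bmfM; [exact: bmfZ|exact: bmf_cst].
by apply: bmfM; [exact: bmfZ|exact: bmf_cst].
Qed.

End line.

(** Sum the second derivatives over the coordinates and use [|s| = |V y| = 1]: the squares give
    [1 - a^2] and the rest [- (p - 1) a]. The weight [w] allows the operator to be applied twice, as
    in [K'], and a constant [V] gives the summands of the statistic. *)
Lemma laplace_beltrami_int :
  laplace_beltrami f s = \int[P]_y (w y * lb_exp_kernel p lambda (dotp s (V y))).
Proof.
rewrite /laplace_beltrami; under eq_bigr do rewrite derive2_line.
rewrite -bint_sum; last by move=> i _; apply: bmfM => //; exact: bmf_rad_phi2_0.
apply: eq_Rintegral => y _; rewrite -mulr_sumr; congr (_ * _).
set a := dotp s (V y); under eq_bigr do rewrite rad_phi2_0.
rewrite -mulr_sumr mulrC; congr (_ * _).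
have ss : dotp s s = 1 by apply/sphereP.
have vv : dotp (V y) (V y) = 1 by apply/sphereP; exact: hV.
rewrite (eq_bigr (fun i =>
  lambda ^+ 2 * (V y 0 i * V y 0 i) + (lambda ^+ 2 * a ^+ 2 + 3 * lambda * a) * (s 0 i * s 0 i)
  + (- 2 * lambda ^+ 2 * a - 2 * lambda) * (s 0 i * V y 0 i) + (- lambda * a))); last first.
  by move=> i _; ring.
rewrite !big_split/= -!mulr_sumr -!/(dotp _ _) ss vv -/a sumr_const card_ord.
by rewrite -[_ *+ p]mulr_natr; ring.
Qed.

End laplace_beltrami_integral.

(** * The Funk-Hecke formula *)

Section kernel_expansion.
Context {R : realType}.
Variables (p : nat) (lambda : R).
Hypothesis lambda_ge0 : 0 <= lambda.
Implicit Types u : R.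

Definition expR_trunc (N : nat) (x : R) := \sum_(m < N) x ^+ m / m`!%:R.

Lemma expR_truncS N x : expR_trunc N.+1 x = expR_trunc N x + x ^+ N / N`!%:R.
Proof. by rewrite /expR_trunc big_ord_recr. Qed.

Lemma expR_trunc_cvg x : expR_trunc N x @[N --> \oo] --> expR x.
Proof.
have -> : expR_trunc ^~ x = series (exp_coeff x).
  by apply/funext => N; rewrite seriesEord.
exact: is_cvg_series_exp_coeff.
Qed.

(** Termwise [|lambda u|^m <= lambda^m]; compare the sums up to [M] and let [M] tend to infinity. *)
Lemma expR_tail N u : `|u| <= 1 ->
  `|expR (lambda * u) - expR_trunc N (lambda * u)| <= expR lambda - expR_trunc N lambda.
Proof.
move=> u1; apply: (ler_cvg_to (a := \oo) (f :=
  (fun M => `|expR_trunc M (lambda * u) - expR_trunc N (lambda * u)|))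
  (g := (fun M => expR_trunc M lambda - expR_trunc N lambda))).
- by apply: cvg_norm; apply: cvgB; [exact: expR_trunc_cvg|exact: cvg_cst].
- by apply: cvgB; [exact: expR_trunc_cvg|exact: cvg_cst].
near=> M; have NM : (N <= M)%N by near: M; exact: nbhs_infty_ge.
have -> : M = (N + (M - N))%N by rewrite subnKC.
elim: (M - N)%N => [|n IH]; first by rewrite addn0 !subrr normr0.
rewrite addnS !expR_truncS ![_ + _ / _ - _]addrAC.
rewrite (le_trans (ler_normD _ _))// lerD// normrM normfV normr_nat.
rewrite ler_wpM2r ?invr_ge0// normrX normrM exprMn (ger0_norm lambda_ge0).
by rewrite ler_piMr ?exprn_ge0// exprn_ile1.
Unshelve. all: by end_near. Qed.

(* [lambda^m / m!] times the Laplace-Beltrami operator applied to [(t.x)^m],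
   where [u = t.x]. *)
Definition kernel_term (m : nat) u :=
  lambda ^+ m / m`!%:R *
  (m%:R * (m%:R - 1) * u ^+ m.-2 - m%:R * (m%:R + p%:R - 2) * u ^+ m).

Definition kernel_trunc (N : nat) u := \sum_(m < N) kernel_term m u.

(** Two derivatives shorten the truncated exponential by two terms and one derivative by one, hence
    the lengths [N] and [N.+1]. *)
Lemma kernel_truncE N u : kernel_trunc N.+2 u =
  lambda ^+ 2 * (1 - u ^+ 2) * expR_trunc N (lambda * u) -
  lambda * (p%:R - 1) * u * expR_trunc N.+1 (lambda * u).
Proof.
elim: N => [|N IH].
  rewrite /kernel_trunc /expR_trunc !big_ord_recr !big_ord0/= /kernel_term/=.
  by rewrite !factS fact0/=; field.
rewrite /kernel_trunc big_ord_recr/= -/(kernel_trunc _ _) IH.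
rewrite (expR_truncS N.+1) (expR_truncS N).
rewrite /kernel_term/= !exprMn !exprS !factS !natrM.
have h1 := @fact_neq0 R N.
have h2 : N.+1%:R != 0 :> R by rewrite pnatr_eq0.
have h3 : N.+2%:R != 0 :> R by rewrite pnatr_eq0.
rewrite -!natr1 in h2 h3 *.
by field; rewrite h1 h2 h3.
Qed.

Lemma kernel_trunc_unif e : 0 < e -> exists N0, forall N u, (N0 <= N)%N -> `|u| <= 1 ->
  `|lb_exp_kernel p lambda u - kernel_trunc N u| <= e.
Proof.
move=> e0; pose C := lambda ^+ 2 + lambda * `|p%:R - 1|.
have C0 : 0 <= C by rewrite addr_ge0 ?sqr_ge0// mulr_ge0.
have e1 : 0 < e / (C + 1) by rewrite divr_gt0// ltr_wpDl.
have /cvgrPdist_le/(_ _ e1)[N0 _ hN0] := @expR_trunc_cvg lambda.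
exists N0.+2 => -[|[|N]]// u; rewrite !ltnS => N0N u1.
have tl n : (N0 <= n)%N -> `|expR (lambda * u) - expR_trunc n (lambda * u)| <= e / (C + 1).
  by move=> h; rewrite (le_trans (expR_tail n u1))// (le_trans (ler_norm _))//; exact: hN0.
have t1 := tl N N0N; have t2 := tl N.+1 (leqW N0N).
rewrite kernel_truncE /lb_exp_kernel.
rewrite (_ : _ - _ =
  lambda ^+ 2 * (1 - u ^+ 2) * (expR (lambda * u) - expR_trunc N (lambda * u)) -
  lambda * (p%:R - 1) * u * (expR (lambda * u) - expR_trunc N.+1 (lambda * u))); last by ring.
have u2 : `|1 - u ^+ 2| <= 1.
  have u20 := sqr_ge0 u.
  have : u ^+ 2 <= 1 by rewrite -real_normK ?num_real// exprn_ile1.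
  by move: u20; move: (u ^+ 2) => v v0 v1; rewrite ger0_norm; lra.
apply: (@le_trans _ _ (C * (e / (C + 1)))); last first.
  rewrite mulrCA ler_piMr ?(ltW e0)// ler_pdivrMr ?ltr_wpDl// mul1r lerDl//.
rewrite /C mulrDl (le_trans (ler_normB _ _))// lerD// !normrM.
  by rewrite ger0_norm ?sqr_ge0// ler_pM// ?mulr_ge0 ?sqr_ge0// ler_piMr// sqr_ge0.
rewrite (ger0_norm lambda_ge0) ler_pM// ?mulr_ge0// ler_piMr// mulr_ge0//.
Qed.

Hypothesis p1 : (1 < p)%N.

(** Below [k] all terms vanish, and from [k] on every second one does, by parity. *)
Lemma kap_series k L : \sum_(m < k + L.*2) lambda ^+ m / m`!%:R * @kap R p m k =
  series (funk_hecke_term p k lambda) L.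
Proof.
elim: L => [|L IH].
  rewrite addn0 [RHS]/series/= big_geq// big1// => m _.
  by rewrite kap0 ?mulr0// => l ml; have := ltn_ord m; lia.
rewrite doubleS !addnS !big_ord_recr/= IH.
have -> : series (funk_hecke_term p k lambda) L.+1 =
    series (funk_hecke_term p k lambda) L + funk_hecke_term p k lambda L.
  by rewrite /series/= big_nat_recr.
rewrite -addrA; congr (_ + _).
rewrite [X in _ + X](_ : _ = 0) ?addr0; last by rewrite kap0 ?mulr0// => l; lia.
rewrite kap_kp /kp /funk_hecke_term.
by rewrite mulrA divfK ?fact_neq0.
Qed.

Variable nu : probability 'rV[R]_p R.
Hypothesis hnu : uniform_on_sphere nu.
Let p0 := ltnW p1.

Lemma bmf_dotp_sproj (t : 'rV[R]_p) : sphere t -> bmf (fun x => dotp t (sproj p0 x)).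
Proof.
by apply: bmf_dotp; [exact: measurable_sproj|move=> x; exact: sphere_sproj].
Qed.

Lemma bmf_kernel {d} {T : measurableType d} (f : T -> R) :
  bmf f -> bmf (fun x => lb_exp_kernel p lambda (f x)).
Proof.
move=> bf; apply: bmfM.
  apply: bmfB; last exact: bmfZ.
  by apply: bmfZ; apply: bmfB; [exact: bmf_cst|exact: bmfX].
by apply: (bmf_continuous (g := expR)); [exact: continuous_expR|exact: bmfZ].
Qed.

Lemma bmf_kernel_term {d} {T : measurableType d} (f : T -> R) m :
  bmf f -> bmf (fun x => kernel_term m (f x)).
Proof. by move=> bf; apply: bmfZ; apply: bmfB; apply: bmfZ; exact: bmfX. Qed.

Lemma bmf_kernel_trunc {d} {T : measurableType d} (f : T -> R) N :
  bmf f -> bmf (fun x => kernel_trunc N (f x)).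
Proof. by move=> bf; apply: bmf_sum => m _; exact: bmf_kernel_term. Qed.

(** By [kap_eigen], each term is [- k (k + p - 2)] times the moment of [(t.x)^m]: this is the
    eigenvalue of the Laplace-Beltrami operator in degree [k]. *)
Lemma kernel_trunc_moment N k t (Q : mpoly p R) : sphere t -> hom k Q -> lap Q = 0 ->
  \int[nu]_x (kernel_trunc N (dotp t (sproj p0 x)) * ev Q (sproj p0 x)) =
  - (k%:R * (k%:R + p%:R - 2)) * (\sum_(m < N) lambda ^+ m / m`!%:R * @kap R p m k) * ev Q t.
Proof.
move=> st hQ lQ; have bt := bmf_dotp_sproj st.
have bQ := bmf_ev p0 Q.
under eq_Rintegral do rewrite mulr_suml.
rewrite bint_sum => [|m _]; last by apply: bmfM => //; exact: bmf_kernel_term.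
rewrite [_ * (\sum_(m < N) _)]mulr_sumr [RHS]mulr_suml; apply: eq_bigr => m _.
have mom n : \int[nu]_x (dotp t (sproj p0 x) ^+ n * ev Q (sproj p0 x)) = @kap R p n k * ev Q t.
  rewrite -(harmonic_moment p1 hnu n _ hQ lQ) ?(sphereP _).1//.
  by apply: eq_Rintegral => x _; rewrite evM ev_exp ev_lin.
have bn n : bmf (fun x => dotp t (sproj p0 x) ^+ n * ev Q (sproj p0 x)).
  by apply: bmfM => //; exact: bmfX.
have -> : (fun x => kernel_term m (dotp t (sproj p0 x)) * ev Q (sproj p0 x)) = (fun x =>
   lambda ^+ m / m`!%:R * (m%:R * (m%:R - 1)) * (dotp t (sproj p0 x) ^+ m.-2 * ev Q (sproj p0 x)) -
   lambda ^+ m / m`!%:R * (m%:R * (m%:R + p%:R - 2)) * (dotp t (sproj p0 x) ^+ m * ev Q (sproj p0 x))).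
  by apply/funext => x; rewrite /kernel_term; ring.
rewrite bintB ?bintZ//; [|exact: bmfZ..].
rewrite !mom; have := kap_eigen p1 m k (R := R).
set a := @kap R p m.-2 k; set b := @kap R p m k => e.
transitivity (lambda ^+ m / m`!%:R * (m%:R * (m%:R - 1) * a - m%:R * (m%:R + p%:R - 2) * b) * ev Q t).
  by ring.
by rewrite e; ring.
Qed.

(** Both sides are limits of the truncated integrals, taken along the lengths [k + 2 L] for which
    [kap_series] applies. *)
Lemma funk_hecke_kernel k t (Q : mpoly p R) : sphere t -> hom k Q -> lap Q = 0 ->
  \int[nu]_x (lb_exp_kernel p lambda (dotp t (sproj p0 x)) * ev Q (sproj p0 x)) =
  - (k%:R * (k%:R + p%:R - 2)) * funk_hecke p k lambda * ev Q t.
Proof.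
move=> st hQ lQ; have bt := bmf_dotp_sproj st; have bQ := bmf_ev p0 Q.
have [mQ [M hM]] := bQ; have M0 : 0 <= M by exact: le_trans (normr_ge0 _) (hM point).
pose s L := \int[nu]_x (kernel_trunc (k + L.*2) (dotp t (sproj p0 x)) * ev Q (sproj p0 x)).
have s1 : s L @[L --> \oo] --> - (k%:R * (k%:R + p%:R - 2)) * funk_hecke p k lambda * ev Q t.
  have -> : s = (fun L => - (k%:R * (k%:R + p%:R - 2)) * series (funk_hecke_term p k lambda) L * ev Q t).
    by apply/funext => L; rewrite /s (kernel_trunc_moment _ st hQ lQ) kap_series.
  apply: cvgM; last exact: cvg_cst.
  by apply: cvgM; [exact: cvg_cst|exact: is_cvg_funk_hecke].
have s2 : s L @[L --> \oo] -->
    \int[nu]_x (lb_exp_kernel p lambda (dotp t (sproj p0 x)) * ev Q (sproj p0 x)).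
  apply/cvgrPdist_le => e e0.
  have e1 : 0 < e / (M + 1) by rewrite divr_gt0// ltr_wpDl.
  have [N0 hN0] := kernel_trunc_unif e1.
  near=> L; have NL : (N0 <= k + L.*2)%N.
    have : (N0 <= L)%N by near: L; exact: nbhs_infty_ge.
    lia.
  have b1 := bmf_kernel bt; have b2 := bmf_kernel_trunc (k + L.*2) bt.
  rewrite -bintB; [|exact: bmfM|exact: bmfM].
  apply: bint_norm_le => [|x]; first by apply: bmfB; exact: bmfM.
  rewrite -mulrBl normrM (@le_trans _ _ (e / (M + 1) * M))//.
    by rewrite ler_pM// hN0// dotp_norm_le//; exact: sphere_sproj.
  rewrite mulrAC ler_pdivrMr ?ltr_wpDl// ler_wpM2l ?(ltW e0)// lerDl//.
exact: (cvg_unique _ s2 s1).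
Unshelve. all: by end_near. Qed.

Lemma harmonic_span_kernel_trunc N (t : 'rV[R]_p) : sphere t ->
  harmonic_span N (fun x => kernel_trunc N (dotp t x)).
Proof.
move=> /sphereP st; apply: (@harmonic_span_sum _ _ _ _ _ _ (fun (m : 'I_N) x => kernel_term m (dotp t x))) => m _.
have hz n : (n <= m)%N -> harmonic_span N (fun x => dotp t x ^+ n).
  move=> nm; apply: (@harmonic_spanW _ _ n.+1); first exact: leq_ltn_trans nm (ltn_ord m).
  exact: harmonic_span_dotp.
apply: harmonic_spanZ; under eq_fun do rewrite -[X in _ + X]mulN1r.
apply: harmonic_spanD; first by apply: harmonic_spanZ; apply: hz; lia.
by apply: harmonic_spanZ; apply: harmonic_spanZ; exact: hz.
Qed.

End kernel_expansion.

(** * The expansions of zeta and tau in spherical harmonics *)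

Section harmonic_series.
Context {R : realType} {p : nat}.
Variable lambda : R.
Hypotheses (lambda_ge0 : 0 <= lambda) (p1 : (1 < p)%N).
Let p0 := ltnW p1.
Variable nu : probability 'rV[R]_p R.
Hypothesis hnu : uniform_on_sphere nu.
Variable Y : forall k : nat, 'I_(sph_dim p k) -> 'rV[R]_p -> R.
Hypothesis hY : forall k, is_orthonormal_sph_basis nu k (@Y k).
Context {d : measure_display} {T : measurableType d}.
Variable P : probability T R.
Variable X : T -> 'rV[R]_p.
Hypotheses (mX : measurable_fun setT X) (hX : forall w, sphere (X w)).

Let G (u : R) := lb_exp_kernel p lambda u.
Let pr := sproj (R := R) p0.

Lemma bmf_harmonic k r : bmf (fun x => @Y k r (pr x)).
Proof.
have [/(_ r)/spherical_harmonicP[Q [_ _ hQ]] _ _] := hY k.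
have -> : (fun x => @Y k r (pr x)) = (fun x => ev Q (pr x)).
  by apply/funext => x; rewrite hQ//; exact: sphere_sproj.
exact: bmf_ev.
Qed.

(** One finite type for all the harmonics of degree below [n], as required by [parseval_bound]. *)
Let idx n := {k : 'I_n & 'I_(sph_dim p k)}.
Let e n (i : idx n) x := Y (tagged i) (pr x).

Lemma bmf_basis n (i : idx n) : bmf (e i).
Proof. exact: bmf_harmonic. Qed.

Lemma orthogonal_degrees k l r s : (l < k)%N ->
  \int[nu]_x (@Y k r (pr x) * @Y l s (pr x)) = 0.
Proof.
move=> lk.
have [/(_ r)/spherical_harmonicP[Q [hQ lQ yQ]] _ _] := hY k.
have [/(_ s)/spherical_harmonicP[W [hW lW yW]] _ _] := hY l.
rewrite -(harmonic_orthogonal p1 hnu lk hQ lQ hW lW).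
apply: eq_Rintegral => x _; rewrite yQ ?yW ?evM//; exact: sphere_sproj.
Qed.

Lemma orthonormal_basis n (i j : idx n) : \int[nu]_x (e i x * e j x) = (i == j)%:R.
Proof.
case: i j => [k r] [l s]; rewrite /e/=.
have [kl|kl|kl] := ltngtP k l.
- rewrite (_ : (_ == _) = false); last first.
    by apply/eqP => -[kl' _]; move: kl; rewrite kl' ltnn.
  under eq_Rintegral do rewrite mulrC.
  exact: orthogonal_degrees.
- rewrite (_ : (_ == _) = false); last first.
    by apply/eqP => -[kl' _]; move: kl; rewrite kl' ltnn.
  exact: orthogonal_degrees.
- have {}kl := val_inj kl; subst l.
  have [_ /(_ r s) o _] := hY k.
  rewrite eq_Tagged/= -o sphere_Rintegral//; first by case: hnu.
  by apply: bmfM; exact: bmf_harmonic.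
Qed.

Lemma sum_basis n (F : forall k, 'I_(sph_dim p k) -> R) :
  \sum_(k < n) \sum_(r < sph_dim p k) F k r = \sum_(i : idx n) F (tag i) (tagged i).
Proof.
by rewrite (@sig_big_dep _ _ _ 'I_n (fun k => 'I_(sph_dim p k)) xpredT
  (fun _ => xpredT) (fun k r => F k r)).
Qed.

Lemma harmonic_span_basis n f : harmonic_span n f ->
  exists c : idx n -> R, forall x, f (pr x) = \sum_i c i * e i x.
Proof.
move=> [g [hg fg]].
have hc k : exists a : 'I_(sph_dim p k) -> R,
    forall x, sphere x -> g k x = \sum_r a r * Y r x.
  by have [_ _] := hY k; apply; exact: hg.
pose a k := sval (cid (hc k)).
exists (fun i : idx n => a (tag i) (tagged i)) => x.
have sx := @sphere_sproj R p p0 x.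
rewrite fg// -(sum_basis n (fun k r => a k r * Y r (pr x))).
by apply: eq_bigr => k _; rewrite (svalP (cid (hc k)) _ sx).
Qed.

(** The eigenvalue of the Laplace-Beltrami operator times the Funk-Hecke coefficient of the
    exponential. *)
Definition multiplier k : R := - (k%:R * (k%:R + p%:R - 2)) * funk_hecke p k lambda.

Lemma kernel_harmonic k r t : sphere t ->
  \int[nu]_x (G (dotp t (pr x)) * @Y k r (pr x)) = multiplier k * Y r t.
Proof.
move=> st; have [/(_ r)/spherical_harmonicP[Q [hQ lQ yQ]] _ _] := hY k.
rewrite yQ// -(funk_hecke_kernel lambda_ge0 p1 hnu st hQ lQ).
by apply: eq_Rintegral => x _; rewrite yQ//; exact: sphere_sproj.
Qed.

Lemma bmf_kernel_joint :
  bmf (fun xw : 'rV[R]_p * T => G (dotp (pr xw.1) (X xw.2))).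
Proof.
apply: bmf_kernel; split.
  apply: measurable_dotp; apply: measurableT_comp => //; exact: measurable_sproj.
by exists 1 => xw; apply: dotp_norm_le => //; exact: sphere_sproj.
Qed.

Lemma bmf_kernel_RV s : sphere s -> bmf (fun w => G (dotp s (X w))).
Proof. by move=> ss; apply: bmf_kernel; exact: bmf_dotp. Qed.

(* On the sphere, this is [z]. *)
Definition kernel_mean s := \int[P]_w G (dotp s (X w)).

(** On the sphere, this is [zeta]. *)
Definition kernel_mean2 t := \int[nu]_x (G (dotp t (pr x)) * kernel_mean (pr x)).

Lemma bmf_kernel_mean : bmf (fun x => kernel_mean (pr x)).
Proof. exact: (bmf_int2 nu P bmf_kernel_joint). Qed.

Lemma bmf_kernel_mean2 : bmf (fun w => kernel_mean2 (X w)).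
Proof.
have h : bmf (fun wx : T * 'rV[R]_p => G (dotp (X wx.1) (pr wx.2)) * kernel_mean (pr wx.2)).
  apply: bmfM.
    apply: bmf_kernel; split.
      apply: measurable_dotp; apply: measurableT_comp => //; exact: measurable_sproj.
    by exists 1 => xw; apply: dotp_norm_le => //; exact: sphere_sproj.
  by apply: (bmf_comp _ bmf_kernel_mean).
exact: (bmf_int2 P nu h).
Qed.

Lemma kernel_mean_harmonic k r : \int[nu]_x (kernel_mean (pr x) * @Y k r (pr x)) =
  multiplier k * \int[P]_w Y r (X w).
Proof.
have bY := bmf_harmonic r.
have bj : bmf (fun xw : 'rV[R]_p * T => G (dotp (pr xw.1) (X xw.2)) * Y r (pr xw.1)).
  by apply: bmfM; [exact: bmf_kernel_joint|exact: (bmf_comp _ bY)].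
transitivity (\int[nu]_x \int[P]_w (G (dotp (pr x) (X w)) * Y r (pr x))).
  by apply: eq_Rintegral => x _; rewrite bintZr//; exact/bmf_kernel_RV/sphere_sproj.
rewrite (bfubini nu P bj).
transitivity (\int[P]_w (multiplier k * Y r (X w))).
  apply: eq_Rintegral => w _; rewrite -(@kernel_harmonic k r (X w) (hX w)).
  by apply: eq_Rintegral => x _; rewrite dotpC.
rewrite bintZ//.
have -> : (fun w => Y r (X w)) = (fun w => Y r (pr (X w))).
  by apply/funext => w; rewrite /pr sproj_id.
exact: (bmf_comp mX bY).
Qed.

(** Parseval for [G (t.x)] and the mean [z], in the span of the degrees below [n]. [N] does not
    depend on [t], because it only serves to approximate [G] uniformly on [[-1, 1]]. *)
Lemma kernel_mean2_series eps : 0 < eps -> exists N, forall n t, (N <= n)%N -> sphere t ->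
  `|kernel_mean2 t - \sum_(k < n) \sum_(r < sph_dim p k)
     multiplier k ^+ 2 * \int[P]_w Y r (X w) * Y r t| <= eps.
Proof.
move=> eps0; have [_ [M hM]] := bmf_kernel_mean.
have M0 : 0 <= M by exact: le_trans (normr_ge0 _) (hM point).
have e1 : 0 < eps / (M + 1) by rewrite divr_gt0// ltr_wpDl.
have [N hN] := kernel_trunc_unif p lambda_ge0 e1.
exists N => n t Nn st.
have [c hc] := harmonic_span_basis (harmonic_spanW Nn (harmonic_span_kernel_trunc lambda_ge0 p1 N st)).
have bG := bmf_kernel p lambda (bmf_dotp_sproj p1 st).
rewrite (sum_basis n (fun k r => multiplier k ^+ 2 * \int[P]_w Y r (X w) * Y r t)).
have := @parseval_bound _ _ _ nu _ _ (@bmf_basis n) (@orthonormal_basis n) _ _ c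
  (eps / (M + 1)) M bG bmf_kernel_mean hM.
set A := `| _ - _|; set B := `|_ - _| => h.
have -> : B = A.
  rewrite /A /B; congr (`|_ - _|); apply: eq_bigr => -[k r] _ /=.
  rewrite /coef /e/= kernel_harmonic// kernel_mean_harmonic; ring.
apply: (le_trans (h _)).
  move=> x; rewrite -hc; apply: hN => //; apply: dotp_norm_le => //; exact: sphere_sproj.
by rewrite mulrCA ler_piMr ?(ltW eps0)// ler_pdivrMr ?ltr_wpDl// mul1r lerDl.
Qed.

Lemma int_kernel_mean2 : \int[P]_w kernel_mean2 (X w) = \int[nu]_x (kernel_mean (pr x) ^+ 2).
Proof.
have bj : bmf (fun xw : 'rV[R]_p * T => G (dotp (pr xw.1) (X xw.2)) * kernel_mean (pr xw.1)).
  by apply: bmfM; [exact: bmf_kernel_joint|exact: (bmf_comp _ bmf_kernel_mean)].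
transitivity (\int[P]_w \int[nu]_x (G (dotp (pr x) (X w)) * kernel_mean (pr x))).
  by apply: eq_Rintegral => w _; apply: eq_Rintegral => x _; rewrite dotpC.
rewrite -(bfubini nu P bj); apply: eq_Rintegral => x _.
by rewrite bintZr; [rewrite expr2|exact/bmf_kernel_RV/sphere_sproj].
Qed.

Lemma harmonic_series_cvg t : sphere t ->
  \sum_(k < n) \sum_(r < sph_dim p k)
     multiplier k ^+ 2 * \int[P]_w Y r (X w) * Y r t @[n --> \oo] --> kernel_mean2 t.
Proof.
move=> st; apply/cvgrPdist_le => eps eps0; have [N hN] := kernel_mean2_series eps0.
by near=> n; apply: hN => //; near: n; exact: nbhs_infty_ge.
Unshelve. all: by end_near. Qed.

(** Integrate the expansion of [zeta] at [t = X w]: its convergence is uniform, and the mean of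
    [zeta X] is the squared norm of [z]. *)
Lemma sum_coef_sqr_cvg : \sum_(k < n) \sum_(r < sph_dim p k)
     multiplier k ^+ 2 * (\int[P]_w Y r (X w)) ^+ 2 @[n --> \oo] -->
  \int[nu]_x (kernel_mean (pr x) ^+ 2).
Proof.
rewrite -int_kernel_mean2.
pose partial n t := \sum_(k < n) \sum_(r < sph_dim p k)
  multiplier k ^+ 2 * \int[P]_w Y r (X w) * Y r t.
have bYX k (r : 'I_(sph_dim p k)) : bmf (fun w => Y r (X w)).
  have -> : (fun w => Y r (X w)) = (fun w => Y r (pr (X w))).
    by apply/funext => w; rewrite /pr sproj_id.
  exact: (bmf_comp mX (bmf_harmonic r)).
have bpart n : bmf (fun w => partial n (X w)).
  by apply: bmf_sum => k _; apply: bmf_sum => r _; exact: bmfZ.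
have -> : (fun n => \sum_(k < n) \sum_(r < sph_dim p k)
     multiplier k ^+ 2 * (\int[P]_w Y r (X w)) ^+ 2) = (fun n => \int[P]_w partial n (X w)).
  apply/funext => n; rewrite /partial bint_sum => [|k _]; last by apply: bmf_sum => r _; exact: bmfZ.
  apply: eq_bigr => k _; rewrite bint_sum => [|r _]; last exact: bmfZ.
  by apply: eq_bigr => r _; rewrite bintZ// expr2 mulrA.
apply/cvgrPdist_le => eps eps0; have [N hN] := kernel_mean2_series eps0.
near=> n; rewrite -bintB//; last exact: bmf_kernel_mean2.
apply: bint_norm_le => [|w]; first by apply: bmfB => //; exact: bmf_kernel_mean2.
by apply: hN => //; near: n; exact: nbhs_infty_ge.
Unshelve. all: by end_near. Qed.

End harmonic_series.

(** * Trigonometric approximation and convergence in distribution *)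

Section trigonometric_bounds.
Context {R : realType}.
Implicit Types x y : R.

Lemma mvt_norm_le (f df : R -> R) (a b C : R) :
  (forall x : R, is_derive x 1 f (df x)) ->
  (forall x, Num.min a b <= x <= Num.max a b -> `|df x| <= C) ->
  `|f b - f a| <= C * `|b - a|.
Proof.
move=> dfx hC; wlog ab : a b hC / a <= b => [h|].
  have [/h->//|/ltW ba] := leP a b.
  by rewrite distrC (distrC b) h// => x; rewrite minC maxC; exact: hC.
have cf : {within `[a, b], continuous f}.
  apply: continuous_subspaceT => x; have [dx _] := dfx x.
  exact/differentiable_continuous/derivable1_diffP.
have [c] := MVT_segment ab (fun x _ => dfx x) cf.
rewrite in_itv/= => cab ->; rewrite normrM ler_wpM2r// hC//.
by rewrite (min_idPl ab) (max_idPr ab).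
Qed.

Lemma mvt_norm_le0 (f df : R -> R) (x C : R) : f 0 = 0 ->
  (forall x : R, is_derive x 1 f (df x)) ->
  (forall y, `|y| <= `|x| -> `|df y| <= C) -> `|f x| <= C * `|x|.
Proof.
move=> f0 dfx hC; have := @mvt_norm_le f df 0 x C dfx; rewrite f0 !subr0; apply.
move=> y; case: (leP 0 x) => x0; rewrite ?(ltW x0) => /andP[y1 y2]; apply: hC.
  by rewrite !ger0_norm.
by rewrite !ler0_norm ?lerN2// ltW.
Qed.

Lemma sin_norm_le x : `|sin x| <= `|x|.
Proof.
rewrite -[leRHS]mul1r; apply: (@mvt_norm_le0 sin cos); first exact: sin0.
  by move=> y _; rewrite ler_norml cos_geN1 cos_le1.
Qed.

(** This bound and the next two each follow from the previous one by the mean value inequality. The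
    constants are not sharp; only the exponents matter. *)
Lemma cos_1_norm_le x : `|cos x - 1| <= x ^+ 2.
Proof.
have d (y : R) : is_derive y 1 (fun x => cos x - 1) (- sin y).
  by apply: is_derive_eq; rewrite subr0.
rewrite -[leRHS]ger0_norm ?sqr_ge0// expr2 normrM.
apply: (mvt_norm_le0 (f := fun x => cos x - 1) _ d); first by rewrite cos0 subrr.
by move=> y yx; rewrite normrN (le_trans (sin_norm_le y)).
Qed.

Lemma sin_id_norm_le x : `|sin x - x| <= `|x| ^+ 3.
Proof.
have d (y : R) : is_derive y 1 (fun x => sin x - x) (cos y - 1).
  exact: is_derive_eq.
rewrite exprSr; apply: (@mvt_norm_le0 (fun x => sin x - x) _ x (`|x| ^+ 2) _ d).
  by rewrite sin0 subrr.
move=> y yx; rewrite (le_trans (cos_1_norm_le y))//.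
by rewrite -real_normK ?num_real// lerXn2r ?nnegrE.
Qed.

Lemma cos_quad_norm_le x : `|cos x - 1 + x ^+ 2 / 2| <= `|x| ^+ 4.
Proof.
have d (y : R) : is_derive y 1 (fun x => cos x - 1 + x ^+ 2 / 2) (- (sin y - y)).
  by apply: is_derive_eq; rewrite /GRing.scale/=; field.
rewrite [leRHS]exprSr.
apply: (@mvt_norm_le0 (fun x => cos x - 1 + x ^+ 2 / 2) _ x (`|x| ^+ 3) _ d).
  by rewrite cos0 subrr expr0n/= mul0r addr0.
move=> y yx; rewrite normrN (le_trans (sin_id_norm_le y))//.
by rewrite lerXn2r ?nnegrE.
Qed.

Lemma cos_ge_half x : `|x| <= 1/2 -> 1/2 <= cos x.
Proof.
move=> x2; have := cos_1_norm_le x; rewrite ler_norml => /andP[h _].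
have : x ^+ 2 <= (1/2) ^+ 2 by rewrite -real_normK ?num_real// lerXn2r ?nnegrE.
by move: h; rewrite !expr2; lra.
Qed.

Lemma cos_lipschitz x y : `|cos x - cos y| <= `|x - y|.
Proof.
rewrite -[leRHS]mul1r; apply: (@mvt_norm_le cos (fun x => - sin x)).
by move=> z _; rewrite normrN ler_norml sin_geN1 sin_le1.
Qed.

(** Mean value theorem, with [cos >= 1/2] on [[-1/2, 1/2]]: the inverse of sine is 2-Lipschitz
    there. *)
Lemma sin_expands x y : `|x| <= 1/2 -> `|y| <= 1/2 -> `|x - y| <= 2 * `|sin x - sin y|.
Proof.
move=> hx hy; wlog xy : x y hx hy / y <= x => [h|].
  have [/h->//|/ltW yx] := leP y x.
  by rewrite distrC (distrC (sin x)) h.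
have cs : {within `[y, x], continuous sin}.
  by apply: continuous_subspaceT => z; exact: continuous_sin.
have [c cyx e] := MVT_segment xy (fun x _ => is_derive_sin x) cs.
have c2 : `|c| <= 1/2.
  move: cyx hx hy; rewrite in_itv/= !ler_norml => /andP[c1 c2] /andP[_ x2] /andP[y1 _].
  by rewrite (le_trans y1 c1) (le_trans c2 x2).
have := cos_ge_half c2; rewrite e normrM => h.
rewrite (ger0_norm (x := cos c)); last by lra.
by rewrite mulrA ler_peMl//; lra.
Qed.

End trigonometric_bounds.

(** * Bernstein operators *)

Section bernstein.
Context {R : realType}.

(* The expectation of [h (S_n)], for [S_n] binomial with parameters [n], [y]. *)
Fixpoint bern (n : nat) (h : nat -> R) (y : R) : R :=
  if n is m.+1 then y * bern m (fun k => h k.+1) y + (1 - y) * bern m h y else h 0%N.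

Lemma bern_cst n c y : bern n (fun=> c) y = c.
Proof. by elim: n => //= n ->; ring. Qed.

Lemma bernD n h1 h2 y : bern n (fun k => h1 k + h2 k) y = bern n h1 y + bern n h2 y.
Proof. by elim: n h1 h2 => //= n IH h1 h2; rewrite !IH; ring. Qed.

Lemma bernZ n c h y : bern n (fun k => c * h k) y = c * bern n h y.
Proof. by elim: n h => //= n IH h; rewrite !IH; ring. Qed.

Lemma bern_le n h1 h2 y : 0 <= y <= 1 -> (forall k, (k <= n)%N -> h1 k <= h2 k) ->
  bern n h1 y <= bern n h2 y.
Proof.
move=> /andP[y0 y1]; elim: n h1 h2 => /= [|n IH] h1 h2 h12; first exact: h12.
apply: lerD; apply: ler_wpM2l; rewrite ?subr_ge0//; apply: IH => k kn; apply: h12 => //.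
exact: leqW.
Qed.

Lemma bern_norm n h y : 0 <= y <= 1 -> `|bern n h y| <= bern n (fun k => `|h k|) y.
Proof.
move=> y01; rewrite ler_norml; apply/andP; split.
  have <- : bern n (fun k => -1 * `|h k|) y = - bern n (fun k => `|h k|) y.
    by rewrite bernZ mulN1r.
  by apply: bern_le => // k _; rewrite mulN1r lerNl ler_normr lexx orbT.
by apply: bern_le => // k _; exact: ler_norm.
Qed.

(** Variance plus squared bias. The center [c] is arbitrary because the induction moves it to
    [c - 1]. *)
Lemma bern_var n c y : bern n (fun k => (k%:R - c) ^+ 2) y =
  n%:R * (y * (1 - y)) + (n%:R * y - c) ^+ 2.
Proof.
elim: n c => [|n IH] c /=; first by rewrite !mul0r !add0r.
have -> : (fun k : nat => (k.+1%:R - c) ^+ 2) = (fun k => (k%:R - (c - 1)) ^+ 2).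
  by apply/funext => k; rewrite -natr1; congr (_ ^+ 2); ring.
by rewrite !IH -natr1; ring.
Qed.

End bernstein.

Section trigonometric_approximation.
Context {R : realType}.

(** The phase [b] provides sines and constants; the frequencies are arbitrary reals. *)
Inductive trig_poly : (R -> R) -> Prop :=
| trig_cos a b : trig_poly (fun x => cos (a * x + b))
| trig_add f g : trig_poly f -> trig_poly g -> trig_poly (fun x => f x + g x)
| trig_scale c f : trig_poly f -> trig_poly (fun x => c * f x).

Lemma trig_mul f g : trig_poly f -> trig_poly g -> trig_poly (fun x => f x * g x).
Proof.
move=> tf; elim: tf g => [a b|f1 f2 _ IH1 _ IH2|c f1 _ IH] g tg.
- elim: tg => [a' b'|g1 g2 _ IH1 _ IH2|c g1 _ IH].
  + have -> : (fun x => cos (a * x + b) * cos (a' * x + b')) =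
       (fun x => 1/2 * (cos ((a + a') * x + (b + b')) + cos ((a - a') * x + (b - b')))).
      apply/funext => x.
      have -> : (a + a') * x + (b + b') = (a * x + b) + (a' * x + b') by ring.
      have -> : (a - a') * x + (b - b') = (a * x + b) - (a' * x + b') by ring.
      by move: (a * x + b) (a' * x + b') => u v; rewrite cosD cosB; field.
    by apply: trig_scale; apply: trig_add; exact: trig_cos.
  + under eq_fun do rewrite mulrDr; exact: trig_add.
  + under eq_fun do rewrite mulrCA; exact: trig_scale.
- by under eq_fun do rewrite mulrDl; apply: trig_add; [exact: IH1|exact: IH2].
- by under eq_fun do rewrite -mulrA; apply: trig_scale; exact: IH.
Qed.

Lemma trig_cst c : trig_poly (fun=> c).
Proof.
have -> : (fun=> c) = (fun x : R => c * cos (0 * x + 0)).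
  by apply/funext => x; rewrite mul0r addr0 cos0 mulr1.
exact/trig_scale/trig_cos.
Qed.

Lemma trig_bern n h (y : R -> R) : trig_poly y -> trig_poly (fun x => bern n h (y x)).
Proof.
move=> ty; elim: n h => [|n IH] h /=; first exact: trig_cst.
apply: trig_add; apply: trig_mul => //.
apply: trig_add; first exact: trig_cst.
by under eq_fun do rewrite -mulN1r; exact: trig_scale.
Qed.

Lemma trig_bmf f : trig_poly f -> bmf (f : measurableTypeR R -> R).
Proof.
elim => [a b|f1 f2 _ h1 _ h2|c f1 _ h1]; [|exact: bmfD|exact: bmfZ].
split; last by exists 1 => x; rewrite ler_norml cos_geN1 cos_le1.
apply: (measurableT_comp (f := cos)).
  by apply: continuous_measurable_fun; exact: continuous_cos.
by apply: measurable_funD => //; exact: measurable_funM.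
Qed.

(** Heine-Cantor, with only [x] confined to the segment. *)
Lemma uniform_continuity (f : R -> R) (K e : R) : continuous f -> 0 < e ->
  exists2 de, 0 < de & forall x y, `|x| <= K -> `|x - y| < de -> `|f x - f y| <= e.
Proof.
move=> cf e0; have cK : compact `[-K, K]%classic by exact: segment_compact.
have nc := (compact_near_coveringP _).1 cK.
have := nc R (0^'+) (fun de x => forall y, `|x - y| < de -> `|f x - f y| <= e) _.
case.
  move=> x _.
  have /cvgrPdist_lt/(_ (e / 2)) := cf x.
  rewrite divr_gt0// => /(_ isT)/nbhs_ballP[d /= d0 hd].
  have d20 : 0 < d / 2 by rewrite divr_gt0.
  near=> z t => y zy /=.
  have zx : `|x - z| < d / 2 by near: z; exact: (nbhsx_ballx x (d / 2) d20).
  have td : t < d / 2 by near: t; exact: nbhs_right_lt.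
  have h1 : `|f x - f z| < e / 2.
    by apply: hd; rewrite /ball/= (lt_trans zx)// ltr_pdivrMr// ltr_pMr// ltr1n.
  have h2 : `|f x - f y| < e / 2.
    apply: hd; rewrite /ball/= (_ : x - y = (x - z) + (z - y)); last by ring.
    by rewrite (le_lt_trans (ler_normD _ _))// (splitr d) ltrD// (lt_trans zy).
  rewrite (_ : f z - f y = (f x - f y) - (f x - f z)); last by ring.
  by rewrite (le_trans (ler_normB _ _))// ltW// (splitr e) ltrD.
move=> de /= de0 hde; exists (de / 2); first exact: divr_gt0.
move=> x y xK; apply: hde; last by rewrite /= in_itv/= -ler_norml.
  by rewrite /ball/= sub0r normrN gtr0_norm ?divr_gt0// ltr_pdivrMr// ltr_pMr// ltr1n.
by rewrite /= divr_gt0.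
Unshelve. all: by end_near. Qed.

(** Near the diagonal by uniform continuity, and away from it because [|f x - f y| <= 2 M]. A
    quadratic bound is what [bern_var] can average. *)
Lemma uniform_quadratic (f : R -> R) (K M e : R) : continuous f ->
  (forall x, `|f x| <= M) -> 0 < e ->
  exists2 C, 0 <= C & forall x y, `|x| <= K -> `|f x - f y| <= e + C * (x - y) ^+ 2.
Proof.
move=> cf fM e0; have [de de0 hde] := uniform_continuity K cf e0.
have M0 : 0 <= M by exact: le_trans (normr_ge0 _) (fM 0).
have C0 : 0 <= 2 * M / de ^+ 2 by rewrite divr_ge0 ?sqr_ge0//; exact: mulr_ge0.
exists (2 * M / de ^+ 2) => //.
move=> x y xK; have [h|h] := ltP `|x - y| de.
  by rewrite (le_trans (hde _ _ xK h))// lerDl mulr_ge0// sqr_ge0.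
apply: (@le_trans _ _ (2 * M)).
  by rewrite (le_trans (ler_normB _ _))// mulr_natl mulr2n lerD.
apply: (@le_trans _ _ (2 * M / de ^+ 2 * (x - y) ^+ 2)); last by rewrite lerDr ltW.
rewrite mulrAC ler_pdivlMr ?exprn_gt0// ler_wpM2l ?mulr_ge0//.
by rewrite -[leRHS]real_normK ?num_real// lerXn2r ?nnegrE ?(ltW de0).
Qed.

(* Bernstein approximation in the variable [(1 + sin (x / 2 K)) / 2]. *)
Lemma trig_approximation (f : R -> R) (K M e : R) : continuous f -> 0 < K ->
  (forall x, `|f x| <= M) -> 0 < e ->
  exists g, [/\ trig_poly g, forall x, `|g x| <= M &
    forall x, `|x| <= K -> `|f x - g x| <= e].
Proof.
move=> cf K0 fM e0; have e20 : 0 < e / 2 by rewrite divr_gt0.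
have M0 : 0 <= M by exact: le_trans (normr_ge0 _) (fM 0).
have [C C0 hC] := uniform_quadratic K cf fM e20.
pose h : R := 1/2; have h12 : `|h| <= 1/2 by rewrite ger0_norm /h; lra.
have hh : - h <= h by rewrite /h; lra.
(* An inverse of sine on [[-1/2, 1/2]], extended to all reals by minimizing the distance, since the
   nodes [2 k / n.+1 - 1] may lie outside the range of sine on this segment. *)
have inv_sin (s : R) : exists t : R, `|t| <= 1/2 /\
    forall u, `|u| <= 1/2 -> `|sin t - s| <= `|sin u - s|.
  have cs : {within `[- h, h], continuous (fun t : R => `|sin t - s|)}.
    apply: continuous_subspaceT => z; apply: cvg_norm.
    by apply: cvgB; [exact: continuous_sin|exact: cvg_cst].
  have [t th ht] := EVT_min hh cs; exists t; split.
    by move: th; rewrite in_itv/= -ler_norml.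
  by move=> u uh; apply: ht; rewrite in_itv/= -ler_norml.
pose ts s := sval (cid (inv_sin s)).
have ts1 s : `|ts s| <= 1/2 by have [] := svalP (cid (inv_sin s)).
have ts2 s u : `|u| <= 1/2 -> `|sin (ts s) - s| <= `|sin u - s|.
  by have [_] := svalP (cid (inv_sin s)); apply.
have tsE s u : `|u| <= 1/2 -> `|ts s - u| <= 4 * `|s - sin u|.
  move=> u2; apply: (le_trans (sin_expands (ts1 s) u2)).
  rewrite (_ : 4 = 2 * 2 :> R) -?mulrA ?ler_wpM2l//; last by ring.
  rewrite (_ : sin (ts s) - sin u = (sin (ts s) - s) + (s - sin u)); last by ring.
  by rewrite (le_trans (ler_normD _ _))// mulr_natl mulr2n lerD2r (le_trans (ts2 s u u2))// distrC.
(* 256 is the product of [4^2] from [tsE], [2^2] from the scale [2 K] and [2^2] from the factor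
   [2 / n.+1] between nodes and counts. *)
have [c c0 ec] : exists2 c : R, 0 <= c & c = 256 by exists 256; first exact: ler0n.
have cCK : 0 <= c * C * K ^+ 2 by exact: (mulr_ge0 (mulr_ge0 c0 C0) (sqr_ge0 K)).
(* Once [n.+1] exceeds [D], the variance term is at most [e / 2]. *)
pose D := 2 * (c * C * K ^+ 2) / e.
have D0 : 0 <= D.
  by apply: divr_ge0; [exact: (mulr_ge0 (ler0n _ 2))|exact: ltW].
have [n nD] : exists n : nat, D < n.+1%:R.
  by exists (Num.trunc D); rewrite truncnS_gt.
have n0 : (0 : R) < n.+1%:R by rewrite ltr0n.
have n1 : n.+1%:R != 0 :> R by rewrite gt_eqF.
pose y (x : R) := (1 + cos ((2 * K)^-1 * x + (- (pi / 2)))) / 2.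
have y_sin x : y x = (1 + sin (x / (2 * K))) / 2.
  by rewrite /y -cosBpihalf [x / _]mulrC.
have y01 x : 0 <= y x <= 1.
  by rewrite /y; have := cos_geN1 ((2 * K)^-1 * x + (- (pi / 2))); have := cos_le1 ((2 * K)^-1 * x + (- (pi / 2))); lra.
have ty : trig_poly y.
  rewrite /y; under eq_fun do rewrite mulrC; apply: trig_scale; apply: trig_add; first exact: trig_cst.
  exact: trig_cos.
pose h_ k := f (2 * K * ts (2 * k%:R / n.+1%:R - 1)).
exists (fun x => bern n.+1 h_ (y x)); split; first exact: trig_bern.
  move=> x; apply: (le_trans (bern_norm _ _ (y01 x))).
  by rewrite -[leRHS](bern_cst n.+1 M (y x)); apply: bern_le => // k _; exact: fM.
move=> x xK; have K20 : 0 < 2 * K by rewrite mulr_gt0.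
have x2 : `|x / (2 * K)| <= 1/2.
  by rewrite normrM normfV (gtr0_norm K20) ler_pdivrMr//; rewrite (le_trans xK)//; lra.
have -> : f x - bern n.+1 h_ (y x) = bern n.+1 (fun k => f x + (-1) * h_ k) (y x).
  by rewrite bernD bern_cst bernZ mulN1r.
apply: (le_trans (bern_norm _ _ (y01 x))).
pose C' := c * C * K ^+ 2 / n.+1%:R ^+ 2.
apply: (@le_trans _ _ (bern n.+1 (fun k => e / 2 + C' * (k%:R - n.+1%:R * y x) ^+ 2) (y x))).
  apply: bern_le => // k _; rewrite mulN1r.
  apply: (le_trans (hC x _ xK)); rewrite lerD2l /C'.
  have := tsE (2 * k%:R / n.+1%:R - 1) _ x2.
  set t := ts _ => ht.
  have -> : x - 2 * K * t = - (2 * K * (t - x / (2 * K))).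
    by field; rewrite gt_eqF.
  rewrite sqrrN exprMn.
  have h2 : (t - x / (2 * K)) ^+ 2 <= (4 * `|2 * k%:R / n.+1%:R - 1 - sin (x / (2 * K))|) ^+ 2.
    by rewrite -[leLHS]real_normK ?num_real// lerXn2r ?nnegrE ?mulr_ge0.
  rewrite exprMn real_normK ?num_real// in h2.
  have e2 : 2 * k%:R / n.+1%:R - 1 - sin (x / (2 * K)) = 2 / n.+1%:R * (k%:R - n.+1%:R * y x).
    by rewrite y_sin; move: (n.+1%:R : R) n1 => N N0; field.
  rewrite e2 exprMn in h2.
  apply: (@le_trans _ _ (C * ((2 * K) ^+ 2 * (4 ^+ 2 * ((2 / n.+1%:R) ^+ 2 * (k%:R - n.+1%:R * y x) ^+ 2))))).
    by rewrite !ler_wpM2l ?sqr_ge0.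
  by rewrite le_eqVlt; apply/orP; left; apply/eqP; rewrite ec; move: (n.+1%:R : R) n1 (k%:R : R) => N N0 k'; field.
rewrite bernD bern_cst bernZ bern_var subrr expr0n/= addr0.
rewrite [leRHS]splitr lerD2l /C'.
have -> : c * C * K ^+ 2 / n.+1%:R ^+ 2 * (n.+1%:R * (y x * (1 - y x))) =
   c * C * K ^+ 2 * (y x * (1 - y x)) / n.+1%:R.
  by move: (n.+1%:R : R) n1 => N N0; field.
rewrite ler_pdivrMr//; apply: (@le_trans _ _ (c * C * K ^+ 2)).
  rewrite ler_piMr//; have /andP[y0 y1] := y01 x.
  by rewrite mulr_ile1 ?subr_ge0// lerBlDr lerDl.
rewrite (_ : c * C * K ^+ 2 = e / 2 * D); last by rewrite /D; field; rewrite gt_eqF.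
by rewrite ler_wpM2l ?(ltW e20)// ltW.
Qed.

End trigonometric_approximation.

(** * From cosines to convergence in distribution *)

Section levy_continuity.
Context {d : measure_display} {Omega : measurableType d} {R : realType}.
Variable P : probability Omega R.

Lemma measurable_tails (K : R) : measurable [set x : measurableTypeR R | K < `|x|].
Proof.
rewrite [X in measurable X](_ : _ = (fun x : R => `|x|) @^-1` `]K, +oo[%classic).
  rewrite -[X in measurable X]setTI; apply: normr_measurable => //.
by apply/seteqP; split => x /=; rewrite in_itv/= andbT.
Qed.

Lemma tails_cvg0 (mu : probability (measurableTypeR R) R) (e : R) : 0 < e ->
  exists n : nat, (mu [set x : measurableTypeR R | (n%:R < `|x|)%R] < e%:E)%E.
Proof.
move=> e0; pose F (n : nat) := [set x : measurableTypeR R | (n%:R : R) < `|x|].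
have F0 : \bigcap_n F n = set0.
  apply/seteqP; split => // x /(_ (Num.truncn `|x|).+1 I); rewrite /F/=.
  by move=> /(lt_trans (truncnS_gt _)); rewrite ltxx.
have mF n : measurable (F n) by exact: measurable_tails.
have h : (mu \o F) n @[n --> \oo] --> mu (\bigcap_n F n).
  apply: nonincreasing_cvg_mu => //.
  - by rewrite (le_lt_trans (probability_le1 mu _)) ?ltry.
  - by rewrite F0; exact: measurable0.
  - move=> m n mn; apply/subsetPset => x; rewrite /F/=; apply: le_lt_trans.
    by rewrite ler_nat.
rewrite F0 measure0 in h.
have [|n _ /(_ n (leqnn n)) hn] := h [set x | (x < e%:E)%E]; last by exists n.
by apply: open_nbhs_nbhs; split; [exact: open_ereal_lt_ereal|rewrite /= lte_fin].
Qed.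

Lemma trig_cvg (Z : nat -> Omega -> R) (mu : probability (measurableTypeR R) R) g :
  (forall n, bmf (Z n)) ->
  (forall a b : R, \int[P]_w cos (a * Z n w + b) @[n --> \oo] -->
     \int[mu]_x cos (a * x + b)) ->
  trig_poly g -> \int[P]_w g (Z n w) @[n --> \oo] --> \int[mu]_x g x.
Proof.
move=> hZ hcos; have bZ f n : trig_poly f -> bmf (fun w => f (Z n w)).
  move=> /trig_bmf[mg [M hM]]; split; last by exists M => w; exact: hM.
  by apply: (measurableT_comp mg); case: (hZ n).
elim => [a b|f1 f2 t1 h1 t2 h2|c f1 t1 h1]; first exact: hcos.
- rewrite bintD; [|exact: trig_bmf..].
  by under eq_fun => n do rewrite (bintD P (bZ _ n t1) (bZ _ n t2)); exact: cvgD.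
- rewrite bintZ; [|exact: trig_bmf].
  by under eq_fun => n do rewrite (bintZ P _ (bZ _ n t1)); apply: cvgM => //; exact: cvg_cst.
Qed.

(* The bound on the first moments gives the tightness needed to replace a bounded
   continuous function by a trigonometric polynomial close to it on an interval. *)
Lemma cvg_in_distribution_cos (Z : nat -> Omega -> R)
    (mu : probability (measurableTypeR R) R) (C : R) :
  (forall n, bmf (Z n)) -> (forall n, \int[P]_w `|Z n w| <= C) ->
  (forall a b : R, \int[P]_w cos (a * Z n w + b) @[n --> \oo] -->
     \int[mu]_x cos (a * x + b)) ->
  cvg_in_distribution P Z mu.
Proof.
move=> hZ hC hcos; split=> [n|f cf [M fM]]; first by case: (hZ n).
have bf : bmf (f : measurableTypeR R -> R).
  by split; [exact: continuous_measurable_fun|exists M].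
have bZ h n : bmf (h : measurableTypeR R -> R) -> bmf (fun w => h (Z n w)).
  move=> [mg [N hN]]; split; last by exists N => w; exact: hN.
  by apply: (measurableT_comp mg); case: (hZ n).
have M0 : 0 <= M by exact: le_trans (normr_ge0 _) (fM 0).
have C0 : 0 <= C by apply: le_trans (hC 0%N); exact: bint_ge0.
rewrite bintE//; under eq_fun => n do rewrite unlock (bintE P (bZ _ n bf)).
apply: cvg_EFin; first by near=> n.
rewrite /comp/=; apply/cvgrPdist_le => eps eps0.
(* The final error is [(e + 2 M e) + e + (e + 2 M e)]. *)
pose e := eps / (3 + 4 * M).
have M4 : 0 < 3 + 4 * M by rewrite ltr_wpDr ?mulr_ge0.
have e0 : 0 < e by rewrite divr_gt0.
have [m hm] := tails_cvg0 mu e0.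
(* [m] controls the tails of [mu], and [C / e] those of all the [Z n], by Markov's inequality. *)
have [K [K0 mK CK]] : exists K : R, [/\ 0 < K, m%:R <= K & C <= e * K].
  exists (m%:R + 1 + C / e); split.
  - by rewrite -addrA ltr_wpDl// ltr_wpDr// divr_ge0// ltW.
  - by rewrite -addrA lerDl addr_ge0// divr_ge0// ltW.
  - rewrite mulrDr [X in _ + X]mulrC divfK ?gt_eqF// lerDr mulr_ge0 ?(ltW e0)//.
have [g [tg gM fg]] := trig_approximation cf K0 fM e0.
have bg := trig_bmf tg.
have bfg : bmf (fun x : measurableTypeR R => f x - g x) by exact: bmfB.
have fgM x : `|f x - g x| <= 2 * M.
  by rewrite (le_trans (ler_normB _ _))// mulr_natl mulr2n lerD.
have M20 : 0 <= 2 * M by exact: mulr_ge0.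
have fmu : `|\int[mu]_x f x - \int[mu]_x g x| <= e + 2 * M * e.
  rewrite -bintB//; apply: (le_trans (bint_norm mu bfg)).
  have bt := bmf_indic (measurable_tails m%:R).
  apply: (@le_trans _ _ (\int[mu]_x (e + 2 * M * \1_[set x : R | m%:R < `|x|] x))).
    apply: bint_le; [exact: bmf_norm|by apply: bmfD; [exact: bmf_cst|exact: bmfZ]|].
    move=> x; rewrite indicE; have [h|h] := ltP m%:R `|x|.
      rewrite mem_set// mulr1 (le_trans (fgM x))// lerDr; exact: ltW.
    rewrite memNset ?mulr0 ?addr0 ?fg// ?(le_trans h)//= => h'.
    by move: (lt_le_trans h' h); rewrite ltxx.
  rewrite bintD ?bint_cst; [|exact: bmf_cst|exact: bmfZ].
  rewrite lerD2l bintZ// ler_wpM2l//.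
  rewrite -lee_fin -bintE// integral_indic//; last exact: measurable_tails.
  by rewrite setIT ltW.
have fP n : `|\int[P]_w f (Z n w) - \int[P]_w g (Z n w)| <= e + 2 * M * e.
  rewrite -bintB; [|exact: bZ..].
  have bfZ := bZ _ n bfg; apply: (le_trans (bint_norm P bfZ)).
  have bn := bmf_norm (hZ n).
  apply: (@le_trans _ _ (\int[P]_w (e + 2 * M / K * `|Z n w|))).
    apply: bint_le; [exact: bmf_norm|by apply: bmfD; [exact: bmf_cst|exact: bmfZ]|].
    move=> w; have [h|h] := leP `|Z n w| K.
      by rewrite (le_trans (fg _ h))// lerDl mulr_ge0// divr_ge0// ltW.
    rewrite (le_trans (fgM _))// -[leLHS]add0r lerD ?(ltW e0)//.
    by rewrite -mulrA ler_peMr// mulrC ler_pdivlMr// mul1r ltW.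
  rewrite bintD ?bint_cst; [|exact: bmf_cst|exact: bmfZ].
  rewrite lerD2l bintZ// -mulrA ler_wpM2l// mulrC ler_pdivrMr//.
  exact: le_trans (hC n) CK.
have /cvgrPdist_le/(_ e e0) := trig_cvg hZ hcos tg.
apply: filterS => n hn.
have -> : eps = (e + 2 * M * e) + e + (e + 2 * M * e).
  by rewrite /e; field; rewrite gt_eqF.
rewrite (_ : \int[mu]_x f x - \int[P]_w f (Z n w) =
   (\int[mu]_x f x - \int[mu]_x g x) + (\int[mu]_x g x - \int[P]_w g (Z n w))
   - (\int[P]_w f (Z n w) - \int[P]_w g (Z n w))); last by ring.
rewrite (le_trans (ler_normB _ _))// lerD// (le_trans (ler_normD _ _))// lerD//.
Unshelve. all: by end_near. Qed.

End levy_continuity.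

(** * The characteristic function of the normal law *)

Section improper_FTC.
Context {R : realType}.
Local Notation mu := (@lebesgue_measure R).

Lemma continuous_FTC2_line (f F : R -> R) (l0 l1 : R) :
  continuous f -> (forall x : R, is_derive x 1 F (f x)) ->
  mu.-integrable setT (EFin \o f) ->
  F n%:R @[n --> \oo] --> l1 -> F (- n%:R) @[n --> \oo] --> l0 ->
  \int[mu]_x f x = l1 - l0.
Proof.
move=> cf dF fi F1 F0.
pose D (n : nat) := `[- (n.+1%:R : R), n.+1%:R]%classic.
have mf : measurable_fun setT f by exact: continuous_measurable_fun.
have mfE : measurable_fun setT (EFin \o f) by exact/measurable_EFinP.
have h1 : (\int[mu]_(x in D n) (f x)%:E)%E @[n --> \oo] --> (\int[mu]_x (f x)%:E)%E.
  under eq_fun do rewrite integral_mkcond.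
  apply: (@dominated_cvg _ _ _ mu setT measurableT
    (fun n => (EFin \o f) \_ (D n)) (EFin \o f) (fun x => `|(f x)%:E|%E)).
  - move=> n; have mD : measurable (D n) by exact: measurable_itv.
    exact: ((measurable_restrictT _ mD).1 (measurable_funTS mfE)).
  - move=> x _; apply: cvg_near_cst.
    have [N _ hN] : \forall n \near \oo, `|x| <= n%:R := nbhs_infty_ger `|x|.
    exists N => // n /= Nn; rewrite patchE mem_set// /D/= in_itv/= -ler_norml.
    by rewrite (le_trans (hN _ Nn))// ler_nat.
  - by [].
  - exact: integrable_abse.
  - by move=> n x _; rewrite patchE; case: ifPn => // _; rewrite abse0.
have h2 n : (\int[mu]_(x in D n) (f x)%:E)%E = (F n.+1%:R - F (- n.+1%:R))%:E.
  have n0 : - n.+1%:R < n.+1%:R :> R.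
    by rewrite (lt_trans (y := 0))// ?oppr_lt0 ltr0n.
  rewrite (continuous_FTC2 n0 (F := F)) ?EFinB//.
  - exact: continuous_subspaceT.
  - split.
    + by move=> x _; have [] := dF x.
    + apply/cvg_at_right_filter/differentiable_continuous/derivable1_diffP.
      by have [] := dF (- n.+1%:R).
    + apply/cvg_at_left_filter/differentiable_continuous/derivable1_diffP.
      by have [] := dF (n.+1%:R).
  - by move=> x _; rewrite derive1E; have [_ ->] := dF x.
have h3 : (F n.+1%:R - F (- n.+1%:R))%:E @[n --> \oo] --> (l1 - l0)%:E.
  apply: cvg_EFin; first exact: nearW.
  rewrite (cvg_shiftS (fun n : nat => F n%:R - F (- n%:R))).
  exact: cvgB.
rewrite /Rintegral.
suff -> : (\int[mu]_x (f x)%:E)%E = (l1 - l0)%:E by [].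
have e : (fun n => (\int[mu]_(x in D n) (f x)%:E)%E) =
         (fun n => (F n.+1%:R - F (- n.+1%:R))%:E) by apply/funext => n; exact: h2.
rewrite e in h1.
exact: cvg_unique h1 h3.
Qed.

Lemma is_derive_cvg (f : R -> R) (a l : R) :
  h^-1 *: (f (h + a) - f a) @[h --> 0^'] --> l -> is_derive a 1 f l.
Proof.
move=> fl; have fl' : h^-1 *: ((f \o shift a) (h *: 1) - f a) @[h --> 0^'] --> l.
  by under eq_fun do rewrite /= [_ *: 1]mulr1.
apply: DeriveDef; first by apply/cvg_ex; exists l.
exact: cvg_lim fl'.
Qed.

End improper_FTC.

Section gaussian.
Context {R : realType}.
Local Notation mu := (@lebesgue_measure R).
Variable s : R.
Hypothesis s0 : 0 < s.
Local Notation pdf := (normal_pdf 0 s).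

Let sn0 : s != 0. Proof. by rewrite gt_eqF. Qed.

Lemma normal_pdf_expE x : pdf x = normal_peak s * expR (- (x ^+ 2 / (2 * s ^+ 2))).
Proof.
by rewrite normal_pdfE// /normal_fun subr0 mulNr -mulr_natl.
Qed.

Lemma is_derive_normal_pdf (x : R) : is_derive x 1 pdf (- (x / s ^+ 2) * pdf x).
Proof.
rewrite (_ : pdf = fun x => normal_peak s * expR (- (x ^+ 2 / (2 * s ^+ 2)))); last first.
  by apply/funext => y; exact: normal_pdf_expE.
have d1 : is_derive x 1 (fun x => - (x ^+ 2 / (2 * s ^+ 2))) (- (x / s ^+ 2)).
  by apply: is_derive_eq; rewrite /GRing.scale/=; field.
have d2 := is_derive1_comp (is_derive_expR _) d1.
by apply: is_derive_eq; rewrite /GRing.scale/=; ring.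
Qed.

Lemma normal_pdf_pos x : 0 <= pdf x.
Proof. exact: normal_pdf_ge0. Qed.

Let ipdf : mu.-integrable setT (EFin \o pdf) := integrable_normal_pdf 0 s.

Lemma integrableM_bmf (f g : R -> R) : bmf f -> mu.-integrable setT (EFin \o g) ->
  mu.-integrable setT (EFin \o (fun x => f x * g x)).
Proof.
move=> [mf [M hM]] ig.
rewrite (_ : EFin \o _ = ((EFin \o g) \* (EFin \o f))%E); last first.
  by apply/funext => x /=; rewrite EFinM muleC.
apply: integrableMl => //.
exists M; split; first exact: num_real.
by move=> N MN x _ /=; rewrite (le_trans (hM x))// ltW.
Qed.

(** Dominated by a multiple of the normal density with standard deviation [sqrt 2 * s]: half of the
    exponent absorbs the factor [x], through [|x| <= s (1 + x^2 / (4 s^2))]. *)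
Lemma integrable_x_pdf : mu.-integrable setT (EFin \o (fun x => x * pdf x)).
Proof.
pose s2 := Num.sqrt 2 * s.
have s22 : s2 ^+ 2 = 2 * s ^+ 2 by rewrite exprMn sqr_sqrtr.
have s2n0 : s2 != 0 by rewrite mulf_neq0// gt_eqF// sqrtr_gt0.
pose C := s * normal_peak s / normal_peak s2.
apply: (@le_integrable _ _ _ mu setT measurableT _ (fun x => (C%:E * (normal_pdf 0 s2 x)%:E)%E)).
- apply/measurable_EFinP; apply: measurable_funM => //.
  exact: measurable_normal_pdf.
- move=> x _ /=; rewrite lee_fin normrM (ger0_norm (normal_pdf_pos x)).
  rewrite (le_trans _ (ler_norm _))// /C.
  have -> : normal_pdf 0 s2 x = normal_peak s2 * expR (- (x ^+ 2 / (2 * (2 * s ^+ 2)))).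
    by rewrite normal_pdfE// /normal_fun subr0 mulNr -mulr_natl s22.
  have pk : normal_peak s2 != 0 by rewrite gt_eqF// normal_peak_gt0.
  rewrite normal_pdf_expE.
  set y := x ^+ 2 / (2 * (2 * s ^+ 2)).
  have -> : x ^+ 2 / (2 * s ^+ 2) = y + y by rewrite /y; field.
  have -> : s * normal_peak s / normal_peak s2 * (normal_peak s2 * expR (- y)) =
      normal_peak s * (s * expR (- y)) by field.
  rewrite mulrCA ler_wpM2l ?normal_peak_ge0// opprD expRD mulrA ler_wpM2r ?expR_ge0//.
  rewrite expRN ler_pdivrMr ?expR_gt0//.
  have h : s * (1 + y) <= s * expR y by rewrite ler_wpM2l ?(ltW s0)// expR_ge1Dx.
  rewrite (le_trans _ h)// mulrDr mulr1.
  have -> : s * y = `|x| ^+ 2 / (4 * s) by rewrite real_normK ?num_real// /y; field.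
  rewrite -subr_ge0; have -> : s + `|x| ^+ 2 / (4 * s) - `|x| = (2 * s - `|x|) ^+ 2 / (4 * s).
    by field.
  by rewrite divr_ge0 ?sqr_ge0// mulr_ge0// ltW.
- have -> : (fun x => (C%:E * (normal_pdf 0 s2 x)%:E)%E) = (fun x => (C%:E * (EFin \o normal_pdf 0 s2) x)%E) by [].
  by apply: integrableZl => //; exact: integrable_normal_pdf.
Qed.

Lemma normal_pdf_cvg0 : pdf n%:R @[n --> \oo] --> 0.
Proof.
pose C := normal_peak s * (2 + 2 * s ^+ 2).
have hC : C * n.+1%:R^-1 @[n --> \oo] --> 0.
  by rewrite -[X in _ --> X](mulr0 C); apply: cvgM; [exact: cvg_cst|exact: cvg_harmonic].
apply: (squeeze_cvgr _ (cvg_cst 0) hC); apply: nearW => n.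
rewrite normal_pdf_pos/= normal_pdf_expE /C -mulrA ler_wpM2l ?normal_peak_ge0//.
rewrite expRN; set t := n%:R ^+ 2 / (2 * s ^+ 2).
have k0 : 0 < 2 * s ^+ 2 by rewrite mulr_gt0// exprn_gt0.
have t0 : 0 <= t by rewrite divr_ge0 ?sqr_ge0 ?ltW.
have h : n.+1%:R <= (2 + 2 * s ^+ 2) * (1 + t).
  have kt : 2 * s ^+ 2 * t = n%:R ^+ 2 by rewrite /t mulrC divfK// gt_eqF.
  have -> : (2 + 2 * s ^+ 2) * (1 + t) = 2 + 2 * t + 2 * s ^+ 2 + 2 * s ^+ 2 * t.
    by ring.
  rewrite kt -natr1; have := sqr_ge0 (n%:R - 1 : R); have := ler0n R n.
  by move: t0 k0; set k := 2 * s ^+ 2; nra.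
rewrite ler_pdivlMr ?ltr0n// mulrC ler_pdivrMr ?expR_gt0//.
rewrite (le_trans h)// ler_wpM2l ?addr_ge0// ?(ltW k0)//; exact: expR_ge1Dx.
Qed.

Lemma normal_pdf_cvg0N : pdf (- n%:R) @[n --> \oo] --> 0.
Proof.
by have := normal_pdf_cvg0; under eq_fun do rewrite normal_pdf_expE -sqrrN -normal_pdf_expE.
Qed.

(** The characteristic function at [a]; the phase [b] selects its real or imaginary part. *)
Definition gcf (b a : R) := \int[mu]_x (cos (a * x + b) * pdf x).

Lemma bmf_cos (a b : R) : bmf (fun x : R => cos (a * x + b)).
Proof. exact: trig_bmf (trig_cos a b). Qed.

Lemma bmf_sin (a b : R) : bmf (fun x : R => sin (a * x + b)).
Proof. by under eq_fun do rewrite -cosBpihalf -addrA; exact: bmf_cos. Qed.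

Lemma is_derive_cos_lin (a b x : R) :
  is_derive x 1 (fun x : R => cos (a * x + b)) (- (a * sin (a * x + b))).
Proof.
have d1 : is_derive x 1 (fun x : R => a * x + b) a.
  by apply: is_derive_eq; rewrite /GRing.scale/=; ring.
have d2 := @is_derive1_comp R cos (fun x => a * x + b) x _ _ (is_derive_cos _) d1.
by apply: (is_derive_eq d2); ring.
Qed.

Lemma is_derive_sin_lin (a b x : R) :
  is_derive x 1 (fun x : R => sin (a * x + b)) (a * cos (a * x + b)).
Proof.
have d1 : is_derive x 1 (fun x : R => a * x + b) a.
  by apply: is_derive_eq; rewrite /GRing.scale/=; ring.
have d2 := @is_derive1_comp R sin (fun x => a * x + b) x _ _ (is_derive_sin _) d1.
by apply: (is_derive_eq d2); ring.
Qed.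

Lemma derive_continuous (f : R -> R) (x l : R) :
  is_derive x 1 f l -> {for x, continuous f}.
Proof. by move=> [fx _]; apply/differentiable_continuous/derivable1_diffP. Qed.

(** [x * pdf x] is [- s^2] times the derivative of [pdf], and the boundary terms vanish. *)
Lemma gaussian_by_parts a b :
  \int[mu]_x (sin (a * x + b) * (x * pdf x)) = s ^+ 2 * a * gcf b a.
Proof.
pose F x := sin (a * x + b) * pdf x.
pose f x := a * (cos (a * x + b) * pdf x) - s ^- 2 * (sin (a * x + b) * (x * pdf x)).
have ic := integrableM_bmf (bmf_cos a b) ipdf.
have is_ := integrableM_bmf (bmf_sin a b) integrable_x_pdf.
have dF (x : R) : is_derive x 1 F (f x).
  have d1 := is_derive_normal_pdf x; have d2 := is_derive_sin_lin a b x.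
  by apply: is_derive_eq; rewrite /f /GRing.scale/=; ring.
have cf : continuous f.
  move=> x; have d1 := is_derive_normal_pdf x; have d2 := is_derive_sin_lin a b x.
  have d3 := is_derive_cos_lin a b x.
  have [l dl] : exists l, is_derive x 1 f l by rewrite /f; eexists; typeclasses eauto.
  exact: derive_continuous dl.
have i1 : mu.-integrable setT (fun x => (a * (cos (a * x + b) * pdf x))%:E).
  by under eq_fun do rewrite EFinM; exact: integrableZl.
have i2 : mu.-integrable setT (fun x => (s ^- 2 * (sin (a * x + b) * (x * pdf x)))%:E).
  by under eq_fun do rewrite EFinM; exact: integrableZl.
have fi : mu.-integrable setT (EFin \o f).
  rewrite (_ : EFin \o f = fun x => ((a * (cos (a * x + b) * pdf x))%:E -
    (s ^- 2 * (sin (a * x + b) * (x * pdf x)))%:E)%E); last by apply/funext.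
  exact: integrableB.
have lim0 (u : nat -> R) : pdf (u n) @[n --> \oo] --> 0 -> F (u n) @[n --> \oo] --> 0.
  move=> pu; apply: norm_cvg0; apply: (squeeze_cvgr _ (cvg_cst 0) pu).
  apply: nearW => n; rewrite normr_ge0/= normrM (ger0_norm (normal_pdf_pos _)).
  by rewrite ler_piMl ?normal_pdf_pos// ler_norml sin_geN1 sin_le1.
have := continuous_FTC2_line cf dF fi (lim0 _ normal_pdf_cvg0) (lim0 _ normal_pdf_cvg0N).
rewrite subrr /f RintegralB// !RintegralZl// -/(gcf b a) => /eqP.
rewrite subr_eq0 => /eqP e.
by rewrite -mulrA e mulrA divff ?mul1r// expf_neq0.
Qed.

Lemma is_derive_gcf (b a : R) : is_derive a 1 (gcf b) (- (s ^+ 2) * a * gcf b a).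
Proof.
pose f x y := cos (x * y + b) * pdf y.
have d1 (x y : R) : is_derive x 1 (f ^~ y) (- (sin (x * y + b) * (y * pdf y))).
  have dc := is_derive_cos_lin y b x.
  have -> : f ^~ y = (fun x => cos (y * x + b) * pdf y).
    by apply/funext => z; rewrite /f mulrC [z * y]mulrC mulrC.
  by apply: is_derive_eq; rewrite /GRing.scale/= [x * y]mulrC; ring.
apply: is_derive_cvg.
have -> : - (s ^+ 2) * a * gcf b a = \int[mu]_y partial1of2 f a y.
  rewrite -mulrA mulNr mulrA -gaussian_by_parts -mulN1r -RintegralZl//; last first.
    exact: integrableM_bmf (bmf_sin a b) integrable_x_pdf.
  by apply: eq_Rintegral => y _; rewrite partial1of2E; have [_ ->] := d1 a y; rewrite mulN1r.
have Ia : `]a - 1, a + 1[%classic a by rewrite /= in_itv/=; lra.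
apply: (@cvg_differentiation_under_integral _ _ _ mu f setT measurableT a _ _ Ia _ _
  (fun y => `|y * pdf y|)) => //.
- by move=> x _; exact: integrableM_bmf (bmf_cos x b) ipdf.
- exact: (integrable_norm integrable_x_pdf).
- move=> x y _ _; rewrite partial1of2E; have [_ ->] := d1 x y.
  by rewrite normrN normrM ler_piMl// ler_norml sin_geN1 sin_le1.
Qed.

(** [gcf b] solves a linear differential equation in [a] with value [cos b] at 0: its product with
    the inverse Gaussian factor has derivative 0. *)
Lemma gcfE b a : gcf b a = expR (- (s ^+ 2 * a ^+ 2 / 2)) * cos b.
Proof.
pose K a := gcf b a * expR (s ^+ 2 * a ^+ 2 / 2).
have K0 : K 0 = cos b.
  rewrite /K expr0n/= mulr0 mul0r expR0 mulr1 /gcf.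
  under eq_Rintegral do rewrite mul0r add0r.
  rewrite RintegralZl// /Rintegral (_ : (\int[mu]_x (pdf x)%:E)%E = 1%E) ?mulr1//.
  exact: integral_normal_pdf.
have dK (x : R) : is_derive x 1 K 0.
  have d1 := is_derive_gcf b x.
  have d0 : is_derive x 1 (fun x => s ^+ 2 * x ^+ 2 / 2) (s ^+ 2 * x).
    by apply: is_derive_eq; rewrite /GRing.scale/=; field.
  have d2 := is_derive1_comp (is_derive_expR _) d0.
  by apply: is_derive_eq; rewrite /GRing.scale/=; ring.
have := is_derive_0_is_cst a 0 dK; rewrite K0 /K => <-.
by rewrite mulrCA -expRD addNr expR0 mulr1.
Qed.

Lemma int_cos_normal b a :
  \int[normal_prob 0 s]_x cos (a * x + b) = expR (- (s ^+ 2 * a ^+ 2 / 2)) * cos b.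
Proof.
rewrite -gcfE /gcf.
under [RHS]eq_Rintegral do rewrite mulrC.
apply/esym; apply: (@density_int _ _ _ _ R (normal_prob 0 s) mu setT id pdf
  (fun x => cos (a * x + b)) measurableT) => //.
- by move=> x _; exact: normal_pdf_pos.
- by move=> A mA; rewrite setIT.
- exact: bmf_cos.
Qed.

End gaussian.

Lemma int_cos_centered_normal {R : realType} (v a b : R) : 0 <= v ->
  \int[centered_normal v]_x cos (a * x + b) = expR (- (v * a ^+ 2 / 2)) * cos b.
Proof.
move=> v0; rewrite /centered_normal; case: eqVneq => [->|vn0].
  rewrite /Rintegral integral_dirac//; last first.
    by apply/measurable_EFinP; case: (bmf_cos a b).
  by rewrite diracT mul1e /= mulr0 add0r !mul0r oppr0 expR0 mul1r.
have s0 : 0 < Num.sqrt v by rewrite sqrtr_gt0 lt_neqAle eq_sym vn0.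
by rewrite (int_cos_normal s0) sqr_sqrtr.
Qed.

(** * Independence and the central limit theorem *)

Section independence.
Context {d : measure_display} {Omega : measurableType d} {R : realType}.
Variable P : probability Omega R.
Context {d' : measure_display} {E : measurableType d'}.
Variable X : nat -> {RV P >-> E}.
Hypothesis hind : independent_seq X.

Let law j (A : set E) : R := fine (P (X j @^-1` A)).

Lemma bmf_RV j (g : E -> R) : bmf g -> bmf (fun w => g (X j w)).
Proof.
move=> [mg [M hM]]; split; last by exists M => w; exact: hM.
exact: (measurableT_comp mg).
Qed.

Lemma bint_indic_RV j (A : set E) : measurable A ->
  \int[P]_w \1_A (X j w) = law j A.
Proof. by move=> mA; rewrite int_indic_preimage. Qed.

(* [H] is independent of the family of the [X j] with [k <= j]. *)
Definition indep_tail (k : nat) (H : Omega -> R) := bmf H /\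
  forall (J : seq nat) (A : nat -> set E), uniq J -> all (leq k) J ->
    (forall j, measurable (A j)) ->
    \int[P]_w (H w * \prod_(j <- J) \1_(A j) (X j w)) =
    \int[P]_w H w * \prod_(j <- J) law j (A j).

Lemma bmf_prod_indic (J : seq nat) (A : nat -> set E) :
  (forall j, measurable (A j)) ->
  bmf (fun w => \prod_(j <- J) (\1_(A j) (X j w) : R)).
Proof. by move=> mA; apply: bmf_prod => j _; apply: bmf_RV; exact: bmf_indic. Qed.

(** The product of the indicators is the indicator of the intersection in [independent_seq]. *)
Lemma indep_tail_cst c : indep_tail 0 (fun=> c).
Proof.
split=> [|J A uJ _ mA]; first exact: bmf_cst.
have bp := bmf_prod_indic J mA.
rewrite bintZ// bint_cst; congr (_ * _).
have -> : (fun w => \prod_(j <- J) (\1_(A j) (X j w) : R)) =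
    \1_(\bigcap_(j in [set` J]) (X j @^-1` A j)).
  apply/funext => w; rewrite indicE; have [h|h] := pselect ((\bigcap_(j in [set` J]) (X j @^-1` A j)) w).
    rewrite mem_set//; rewrite big_seq big1// => j jJ.
    by rewrite indicE mem_set//; exact: h.
  rewrite memNset//; have [j jJ hj] : exists2 j, j \in J & ~ A j (X j w).
    apply: contrapT => h'; apply: h => j /= jJ; apply: contrapT => hj; apply: h'.
    by exists j.
  by rewrite (big_rem j)//= indicE memNset// mul0r.
apply: EFin_inj; rewrite -bintE; last first.
  apply: bmf_indic; apply: bigcap_measurableType => j _.
  by rewrite -[X in measurable X]setTI; exact: measurable_funPT.
rewrite integral_indic//; last first.
  apply: bigcap_measurableType => j _.
  by rewrite -[X in measurable X]setTI; exact: measurable_funPT.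
rewrite setIT; apply: (etrans (hind uJ mA)); rewrite -prodEFin; apply: eq_bigr => j _.
rewrite /law fineK// fin_num_measure//.
by rewrite -[X in measurable X]setTI; exact: measurable_funPT.
Qed.

Lemma indep_tailD k H1 H2 : indep_tail k H1 -> indep_tail k H2 ->
  indep_tail k (fun w => H1 w + H2 w).
Proof.
move=> [b1 h1] [b2 h2]; split=> [|J A uJ kJ mA]; first exact: bmfD.
have bp := bmf_prod_indic J mA.
under eq_Rintegral do rewrite mulrDl.
by rewrite !bintD ?mulrDl ?h1 ?h2//; exact: bmfM.
Qed.

Lemma indep_tailZ k c H : indep_tail k H -> indep_tail k (fun w => c * H w).
Proof.
move=> [b h]; split=> [|J A uJ kJ mA]; first exact: bmfZ.
have bp := bmf_prod_indic J mA.
under eq_Rintegral do rewrite -mulrA.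
by rewrite !bintZ// ?h ?mulrA//; exact: bmfM.
Qed.

Lemma indep_tailS k H : indep_tail k H -> indep_tail k.+1 H.
Proof.
move=> [b h]; split=> // J A uJ kJ mA; apply: h => //.
by apply: sub_all kJ => j; exact: ltnW.
Qed.

Lemma functional_bound (H : Omega -> R) k (g : E -> R) e M : bmf H -> bmf g ->
  (forall w, `|H w| <= M) -> (forall x, `|g x| <= e) ->
  `|\int[P]_w (H w * g (X k w))| <= M * e.
Proof.
move=> bH bg hM he; apply: bint_norm_le; first by apply: bmfM => //; exact: bmf_RV.
by move=> w; rewrite normrM ler_pM.
Qed.

Lemma indep_tail_int k H (g : E -> R) : indep_tail k H -> bmf g ->
  \int[P]_w (H w * g (X k w)) = \int[P]_w H w * \int[P]_w g (X k w).
Proof.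
move=> [bH hH] bg; apply/eqP; rewrite -subr_eq0; apply/eqP.
pose L (f : E -> R) := \int[P]_w (H w * f (X k w)) - \int[P]_w H w * \int[P]_w f (X k w).
have [M hM] := bH.2.
apply: (@bmf_functional_eq0 _ _ _ L (2 * M)) => //.
- move=> f h bf bh; rewrite /L; under eq_Rintegral do rewrite mulrDr.
  have bfX := bmf_RV k bf; have bhX := bmf_RV k bh.
  rewrite !bintD//; [ring|exact: bmfM|exact: bmfM].
- move=> c f bf; rewrite /L; under eq_Rintegral do rewrite mulrCA.
  have bfX := bmf_RV k bf.
  by rewrite !bintZ//; [ring|exact: bmfM].
- move=> f e bf he; rewrite /L (le_trans (ler_normB _ _))// mulr_natl mulr2n mulrDl lerD//.
    exact: functional_bound.
  rewrite normrM ler_pM//; first exact: bint_norm_le.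
  by apply: bint_norm_le; [exact: bmf_RV|move=> w; exact: he].
- move=> A mA; rewrite /L; have := hH [:: k] (fun=> A) isT; rewrite /= leqnn => /(_ isT (fun=> mA)).
  under eq_Rintegral do rewrite big_seq1.
  by rewrite big_seq1 => ->; rewrite bint_indic_RV// subrr.
Qed.

(** When [g] is an indicator, this is the hypothesis on [H] for the list [k :: J]; bounded [g]
    follow by [bmf_functional_eq0]. *)
Lemma indep_tailM k H (g : E -> R) : indep_tail k H -> bmf g ->
  indep_tail k.+1 (fun w => H w * g (X k w)).
Proof.
move=> hH bg; have [bH hI] := hH; have bgX := bmf_RV k bg.
split=> [|J A uJ kJ mA]; first exact: bmfM.
have bp := bmf_prod_indic J mA.
pose q := \prod_(j <- J) law j (A j).
pose L (f : E -> R) := \int[P]_w (H w * \prod_(j <- J) \1_(A j) (X j w) * f (X k w)) -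
  \int[P]_w (H w * f (X k w)) * q.
have bHp : bmf (fun w => H w * \prod_(j <- J) (\1_(A j) (X j w) : R)) by exact: bmfM.
have [M hM] := bH.2; have [N hN] := bHp.2.
apply/eqP; rewrite -subr_eq0; apply/eqP.
under eq_Rintegral do rewrite mulrAC.
apply: (@bmf_functional_eq0 _ _ _ L (N + M * `|q|)) => //.
- move=> f h bf bh; rewrite /L; under eq_Rintegral do rewrite mulrDr.
  under [X in _ - X * _]eq_Rintegral do rewrite mulrDr.
  have bfX := bmf_RV k bf; have bhX := bmf_RV k bh.
  by rewrite !bintD//; [ring|exact: bmfM..].
- move=> c f bf; rewrite /L; under eq_Rintegral do rewrite mulrCA.
  under [X in _ - X * _]eq_Rintegral do rewrite mulrCA.
  have bfX := bmf_RV k bf.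
  by rewrite !bintZ//; [ring|exact: bmfM..].
- move=> f e bf he; rewrite /L (le_trans (ler_normB _ _))// mulrDl lerD//.
    exact: functional_bound.
  rewrite normrM mulrAC ler_wpM2r//; exact: functional_bound.
- move=> B mB; rewrite /L.
  pose A' j := if j == k then B else A j.
  have mA' j : measurable (A' j) by rewrite /A'; case: ifP.
  have kJ' : k \notin J by apply/negP => /(allP kJ); rewrite ltnn.
  have := hI (k :: J) A'; rewrite /= kJ' uJ leqnn/= => /(_ isT).
  have -> : all (leq k) J by apply: sub_all kJ => j; exact: ltnW.
  move=> /(_ isT mA').
  have e1 w : \prod_(j <- k :: J) (\1_(A' j) (X j w) : R) =
      \prod_(j <- J) \1_(A j) (X j w) * \1_B (X k w).
    rewrite big_cons /A' eqxx mulrC; congr (_ * _).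
    rewrite big_seq [RHS]big_seq; apply: eq_bigr => j jJ.
    by case: eqP => // ejk; rewrite -ejk jJ in kJ'.
  have e2 : \prod_(j <- k :: J) law j (A' j) = q * law k B.
    rewrite big_cons /A' eqxx mulrC /q; congr (_ * _).
    rewrite big_seq [RHS]big_seq; apply: eq_bigr => j jJ.
    by case: eqP => // ejk; rewrite -ejk jJ in kJ'.
  under eq_Rintegral do rewrite e1 mulrA.
  rewrite e2 => ->; rewrite (indep_tail_int hH) ?bint_indic_RV//; last exact: bmf_indic.
  ring.
Qed.

End independence.

(** [1 - s <= exp (- s) <= 1 / (1 + s) <= 1 - s + s^2]. *)
Lemma expRN_quad {R : realType} (s : R) : 0 <= s -> `|expR (- s) - (1 - s)| <= s ^+ 2.
Proof.
move=> s0; have h1 : 1 - s <= expR (- s) by exact: expR_ge1Dx.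
rewrite ger0_norm ?subr_ge0// lerBlDr expRN.
have h2 : 1 + s <= expR s by exact: expR_ge1Dx.
have s1 : 0 < 1 + s by rewrite ltr_pwDl.
apply: (@le_trans _ _ (1 + s)^-1); first by rewrite lef_pV2// posrE expR_gt0.
rewrite -[leLHS]mul1r ler_pdivrMr// -subr_ge0.
rewrite (_ : _ - 1 = s ^+ 3); last by ring.
exact: exprn_ge0.
Qed.

Lemma near_div_sqrt_le {R : realType} (C e : R) : 0 <= C -> 0 < e ->
  \forall n \near \oo, C / Num.sqrt n%:R <= e.
Proof.
move=> C0 e0; near=> n.
have [->|n0] := posnP n; first by rewrite sqrtr0 invr0 mulr0 ltW.
have nR : 0 < n%:R :> R by rewrite ltr0n.
rewrite ler_pdivrMr ?sqrtr_gt0// mulrC -ler_pdivrMr//.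
rewrite -(@ler_pXn2r _ 2) ?nnegrE ?sqrtr_ge0 ?divr_ge0 ?(ltW e0)// sqr_sqrtr ?(ltW nR)//.
by near: n; exact: nbhs_infty_ger.
Unshelve. all: by end_near. Qed.

(** * Sums of bounded centered variables *)

Section central_limit.
Context {d : measure_display} {Omega : measurableType d} {R : realType}.
Variable P : probability Omega R.
Context {d' : measure_display} {E : measurableType d'}.
Variables (X : nat -> {RV P >-> E}) (g : E -> R) (B v : R).
Hypotheses (hind : independent_seq X) (bg : bmf g) (gB : forall x, `|g x| <= B).
Hypothesis mean0 : forall j, \int[P]_w g (X j w) = 0.
Hypothesis varv : forall j, \int[P]_w (g (X j w) ^+ 2) = v.

Let S n w : R := \sum_(j < n) g (X j w).

Lemma bmf_walk n : bmf (S n).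
Proof. by apply: bmf_sum => j _; exact: (bmf_RV X j bg). Qed.

Lemma indep_tail_walk n : indep_tail X n (S n).
Proof.
elim: n => [|n IH].
  have -> : S 0 = fun=> 0 by apply/funext => w; rewrite /S big_ord0.
  exact: indep_tail_cst.
have -> : S n.+1 = fun w => S n w + g (X n w).
  by apply/funext => w; rewrite /S big_ord_recr.
apply: indep_tailD; first exact: indep_tailS.
have -> : (fun w => g (X n w)) = (fun w => 1 * g (X n w)).
  by apply/funext => w; rewrite mul1r.
apply: indep_tailM => //; elim: n {IH} => [|n IH]; first exact: indep_tail_cst.
exact: indep_tailS.
Qed.

(** The cross terms vanish by independence and centering. *)
Lemma walk_sqr_int n : \int[P]_w (S n w ^+ 2) = n%:R * v.
Proof.
elim: n => [|n IH].
  rewrite mul0r -[RHS](bint_cst P 0); apply: eq_Rintegral => w _.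
  by rewrite /S big_ord0 expr0n.
have bS := bmf_walk n; have bgX := bmf_RV X n bg.
have -> : (fun w => S n.+1 w ^+ 2) =
    (fun w => S n w ^+ 2 + 2 * (S n w * g (X n w)) + g (X n w) ^+ 2).
  by apply/funext => w; rewrite /S big_ord_recr/=; ring.
rewrite !bintD; last 4 first.
- exact: bmfX.
- by apply: bmfZ; exact: bmfM.
- by apply: bmfD; [exact: bmfX|apply: bmfZ; exact: bmfM].
- exact: bmfX.
rewrite bintZ; last exact: bmfM.
by rewrite (indep_tail_int (indep_tail_walk n))// mean0 IH varv -natr1; ring.
Qed.

Lemma bmf_cos_affine {d1} {T : measurableType d1} (f : T -> R) c b :
  bmf f -> bmf (fun w => cos (c * f w + b)).
Proof.
move=> bf; apply: bmf_continuous; first exact: continuous_cos.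
by apply: bmfD; [exact: bmfZ|exact: bmf_cst].
Qed.

(* The sines are written as shifted cosines, so that a single induction over all
   [b] covers both. *)
Lemma cos_walkS c n b : (fun w => cos (c * S n.+1 w + b)) = (fun w =>
  cos (c * S n w + b) * cos (c * g (X n w) + 0) +
  (-1) * (cos (c * S n w + (b - pi / 2)) * cos (c * g (X n w) + - (pi / 2)))).
Proof.
apply/funext => w; rewrite addrA !cosBpihalf addr0 /S big_ord_recr/= mulrDr addrAC.
by rewrite cosD mulN1r.
Qed.

Lemma indep_tail_cos_walk c n b : indep_tail X n (fun w => cos (c * S n w + b)).
Proof.
elim: n b => [|n IH] b.
  have -> : (fun w => cos (c * S 0 w + b)) = fun=> cos (c * 0 + b).
    by apply/funext => w; rewrite /S big_ord0.
  exact: indep_tail_cst.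
rewrite cos_walkS.
apply: indep_tailD; last apply: indep_tailZ;
  apply: (@indep_tailM _ _ _ _ _ _ _ _ _ (fun x => cos (c * g x + _))) => //;
  exact: bmf_cos_affine.
Qed.

(* One step multiplies the characteristic function by [1 - c^2 v / 2] up to a cubic
   error, hence by the corresponding exponential. *)
Lemma cos_walk_step c n b : `|\int[P]_w cos (c * S n.+1 w + b) -
    expR (- (c ^+ 2 * v / 2)) * \int[P]_w cos (c * S n w + b)| <=
  2 * (`|c| * B) ^+ 4 + (`|c| * B) ^+ 3.
Proof.
have bS := bmf_walk n; have bgX := bmf_RV X n bg.
rewrite cos_walkS.
have bc b1 : bmf (fun w => cos (c * S n w + b1)) by exact: bmf_cos_affine.
have bcg b1 : bmf (fun w => cos (c * g (X n w) + b1)) by exact: bmf_cos_affine.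
have bcE b1 : bmf (fun x => cos (c * g x + b1)) by exact: bmf_cos_affine.
rewrite bintD; [|exact: bmfM|by apply: bmfZ; exact: bmfM].
rewrite bintZ; last exact: bmfM.
rewrite (indep_tail_int (indep_tail_cos_walk c n b) (bcE 0)).
rewrite (indep_tail_int (indep_tail_cos_walk c n _) (bcE (- (pi / 2)))).
have u1 b1 : `|\int[P]_w cos (c * S n w + b1)| <= 1.
  by apply: bint_norm_le => // w; rewrite ler_norml cos_geN1 cos_le1.
have := u1 b; have := u1 (b - pi / 2).
set u := \int[P]_w _; set u' := \int[P]_w cos (c * S n w + b) => hu hu'.
have cgB w : `|c * g (X n w)| <= `|c| * B by rewrite normrM ler_wpM2l.
have cB0 : 0 <= `|c| * B.
  by rewrite mulr_ge0//; apply: le_trans (normr_ge0 _) (gB point).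
have h1 : `|\int[P]_w cos (c * g (X n w) + 0) - (1 - c ^+ 2 * v / 2)| <= (`|c| * B) ^+ 4.
  have -> : \int[P]_w cos (c * g (X n w) + 0) - (1 - c ^+ 2 * v / 2) =
      \int[P]_w (cos (c * g (X n w) + 0) - 1 + c ^+ 2 / 2 * g (X n w) ^+ 2).
    rewrite bintD; [|by apply: bmfB => //; exact: bmf_cst|by apply: bmfZ; exact: bmfX].
    rewrite bintB//; last exact: bmf_cst.
    by rewrite bint_cst bintZ ?varv; [field|exact: bmfX].
  apply: bint_norm_le => [|w].
    by apply: bmfD; [apply: bmfB => //; exact: bmf_cst|apply: bmfZ; exact: bmfX].
  rewrite addr0 mulrAC -exprMn (le_trans (cos_quad_norm_le _))//.
  by rewrite lerXn2r ?nnegrE.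
have h2 : `|\int[P]_w cos (c * g (X n w) + - (pi / 2))| <= (`|c| * B) ^+ 3.
  have -> : \int[P]_w cos (c * g (X n w) + - (pi / 2)) =
      \int[P]_w (cos (c * g (X n w) + - (pi / 2)) - c * g (X n w)).
    by rewrite bintB//; [rewrite bintZ// mean0 mulr0 subr0|exact: bmfZ].
  apply: bint_norm_le => [|w]; first by apply: bmfB => //; exact: bmfZ.
  rewrite cosBpihalf (le_trans (sin_id_norm_le _))//.
  by rewrite lerXn2r ?nnegrE.
have v0 : 0 <= v by rewrite -(varv 0%N) bint_ge0// => w; exact: sqr_ge0.
have vB : v <= B ^+ 2.
  rewrite -(varv 0%N) -(bint_cst P (B ^+ 2)).
  have bg0 := bmf_RV X 0%N bg.
  apply: bint_le => [||w]; [exact: bmfX|exact: bmf_cst|].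
  rewrite -[leLHS]real_normK ?num_real// lerXn2r ?nnegrE//.
  exact: le_trans (normr_ge0 _) (gB point).
have s0 : 0 <= c ^+ 2 * v / 2 by rewrite divr_ge0// mulr_ge0// sqr_ge0.
have h3 := expRN_quad s0.
have h4 : (c ^+ 2 * v / 2) ^+ 2 <= (`|c| * B) ^+ 4.
  rewrite (_ : (`|c| * B) ^+ 4 = (c ^+ 2 * B ^+ 2) ^+ 2); last first.
    by rewrite -(real_normK (num_real c)); ring.
  rewrite lerXn2r ?nnegrE//; first by rewrite mulr_ge0// sqr_ge0.
  apply: (@le_trans _ _ (c ^+ 2 * v)).
    have cv0 : 0 <= c ^+ 2 * v by exact: mulr_ge0 (sqr_ge0 c) v0.
    by rewrite ler_pdivrMr// mulr_natr mulr2n lerDl.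
  by rewrite ler_wpM2l ?sqr_ge0.
move: h1 h2 h3; set A1 := \int[P]_w cos (c * g (X n w) + 0).
set A2 := \int[P]_w cos (c * g (X n w) + - (pi / 2)).
move=> h1 h2 h3.
(* One fourth-order error comes from the cosine of the step and the other from [expRN_quad]; the
   third-order one comes from its sine, whose linear part has mean 0. *)
rewrite (_ : u' * A1 + -1 * (u * A2) - _ * u' = u' * (A1 - (1 - c ^+ 2 * v / 2)) -
   u' * (expR (- (c ^+ 2 * v / 2)) - (1 - c ^+ 2 * v / 2)) - u * A2); last by ring.
have mle x y C : `|x| <= 1 -> `|y| <= C -> `|x * y| <= C.
  by move=> x1 yC; rewrite normrM (le_trans _ yC)// ler_piMl.
rewrite (le_trans (ler_normB _ _))// lerD//; last exact: mle.
rewrite (le_trans (ler_normB _ _))// mulr_natl mulr2n lerD//; first exact: mle.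
by apply: mle => //; exact: le_trans h4.
Qed.

(** The errors of the steps simply add up, because the factor of each step is at most 1. *)
Lemma cos_walk_bound c n b : `|\int[P]_w cos (c * S n w + b) -
    expR (- (n%:R * (c ^+ 2 * v / 2))) * cos b| <=
  n%:R * (2 * (`|c| * B) ^+ 4 + (`|c| * B) ^+ 3).
Proof.
elim: n => [|n IH].
  rewrite !mul0r oppr0 expR0 mul1r.
  have -> : \int[P]_w cos (c * S 0 w + b) = cos b.
    rewrite -[RHS](bint_cst P); apply: eq_Rintegral => w _.
    by rewrite /S big_ord0 mulr0 add0r.
  by rewrite subrr normr0.
have := cos_walk_step c n b.
set D := 2 * _ + _; set e := expR _; set u := \int[P]_w _; set u' := \int[P]_w _ => h.
have v0 : 0 <= v by rewrite -(varv 0%N) bint_ge0// => w; exact: sqr_ge0.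
have e1 : `|e| <= 1.
  rewrite gtr0_norm ?expR_gt0// /e -expR0 ler_expR oppr_le0 divr_ge0// mulr_ge0//.
  exact: sqr_ge0.
have -> : expR (- (n.+1%:R * (c ^+ 2 * v / 2))) = e * expR (- (n%:R * (c ^+ 2 * v / 2))).
  by rewrite /e -expRD; congr expR; rewrite -natr1; ring.
rewrite -[n.+1%:R]natr1 mulrDl mul1r [leRHS]addrC.
rewrite (_ : u - _ = (u - e * u') + e * (u' - expR (- (n%:R * (c ^+ 2 * v / 2))) * cos b)); last by ring.
rewrite (le_trans (ler_normD _ _))// lerD// normrM (le_trans _ IH)//.
exact: ler_piMl.
Qed.

Lemma cos_walk_clt a b : \int[P]_w cos (a * (S n w / Num.sqrt n%:R) + b) @[n --> \oo] -->
  expR (- (v * a ^+ 2 / 2)) * cos b.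
Proof.
have B0 : 0 <= B by apply: le_trans (normr_ge0 _) (gB point).
pose D := 2 * (`|a| * B) ^+ 4 + (`|a| * B) ^+ 3.
have aB0 : 0 <= `|a| * B by exact: mulr_ge0.
have D0 : 0 <= D by rewrite addr_ge0 ?mulr_ge0// exprn_ge0.
apply/cvgrPdist_le => e e0.
near=> n.
have n0 : (0 < n)%N by near: n; exists 1%N.
have h1 : D / Num.sqrt n%:R <= e by near: n; exact: near_div_sqrt_le.
have nR : 0 < n%:R :> R by rewrite ltr0n.
set r := Num.sqrt n%:R.
have rn : r ^+ 2 = n%:R by rewrite sqr_sqrtr// ltW.
have r0 : 0 < r by rewrite sqrtr_gt0.
have r1 : 1 <= r by rewrite -(expr_ge1 (n := 2)) ?(ltW r0)// rn ler1n.
have := cos_walk_bound (a / r) n b.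
have -> : n%:R * ((a / r) ^+ 2 * v / 2) = v * a ^+ 2 / 2 by rewrite -rn; field; rewrite gt_eqF.
rewrite distrC => h.
have -> : \int[P]_w cos (a * (S n w / r) + b) = \int[P]_w cos (a / r * S n w + b).
  by apply: eq_Rintegral => w _; congr (cos (_ + _)); rewrite mulrA mulrAC.
apply: (le_trans h); rewrite normrM normfV (gtr0_norm r0) -rn.
rewrite (_ : _ * _ = (2 * (`|a| * B) ^+ 4 / r + (`|a| * B) ^+ 3) / r); last first.
  by field; rewrite gt_eqF.
apply: le_trans h1; rewrite ler_wpM2r ?invr_ge0 ?(ltW r0)// lerD2r ler_pdivrMr//.
by rewrite ler_peMr// mulr_ge0// exprn_ge0.
Unshelve. all: by end_near. Qed.

End central_limit.

(** * The statistic *)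

Section statistic.
Context {R : realType} {p : nat}.
Variable lambda : R.
Hypothesis p1 : (1 < p)%N.
Let p0 := ltnW p1.
Variable nu : probability 'rV[R]_p R.
Hypothesis hnu : uniform_on_sphere nu.
Context {d : measure_display} {Omega : measurableType d}.
Variable P : probability Omega R.
Variable X : {RV P >-> 'rV[R]_p}.
Hypothesis hX : forall w, sphere (X w).

Let G (u : R) := lb_exp_kernel p lambda u.
Let pr := sproj (R := R) p0.
Let z s := kernel_mean lambda P X s.
Let zeta t := kernel_mean2 lambda p1 nu P X t.
Let tau := \int[nu]_x (z (pr x) ^+ 2).

Let mX : measurable_fun setT X := measurable_funPT X.
Let nu_sphere : nu sphere = 1%E := proj1 hnu.
Let spr x : sphere (pr x) := sphere_sproj p0 x.

Lemma dotpZl c (x y : 'rV[R]_p) : dotp (c *: x) y = c * dotp x y.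
Proof. by rewrite /dotp mulr_sumr; apply: eq_bigr => i _; rewrite mxE mulrA. Qed.

Lemma dotpDl (x x' y : 'rV[R]_p) : dotp (x + x') y = dotp x y + dotp x' y.
Proof. by rewrite /dotp -big_split; apply: eq_bigr => i _; rewrite mxE mulrDl. Qed.

Lemma mgf_int t : mgf X t = \int[P]_w expR (dotp t (X w)).
Proof. by rewrite /mgf unlock. Qed.

Lemma z_funE s : sphere s -> z_fun lambda X s = z s.
Proof.
move=> ss; rewrite /z_fun (laplace_beltrami_int (P := P) (lambda := lambda) mX hX (bmf_cst 1) ss).
  by apply: eq_Rintegral => w _; rewrite mul1r.
by move=> u su; rewrite mgf_int; apply: eq_Rintegral => w _; rewrite mul1r dotpZl.
Qed.

(** [exp (lambda (s + t).X)] factors: the operator in [t] acts with the weight [exp (lambda s.X)],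
    then the operator in [s] with the bounded weight [G (t.X)]. *)
Lemma K'_funE s t : sphere s -> sphere t ->
  K'_fun lambda X s t = \int[P]_w (G (dotp s (X w)) * G (dotp t (X w))) - z s * z t.
Proof.
move=> ss st; rewrite /K'_fun !z_funE//; congr (_ - _).
have bGt := bmf_kernel_RV lambda mX hX st.
rewrite (laplace_beltrami_int (P := P) (lambda := lambda) mX hX bGt ss).
  by apply: eq_Rintegral => w _; rewrite mulrC.
move=> u su; have bw : bmf (fun w => expR (lambda * dotp u (X w))).
  apply: (bmf_continuous (g := expR)); first exact: continuous_expR.
  by apply: bmfZ; exact: bmf_dotp.
rewrite (laplace_beltrami_int (P := P) (lambda := lambda) mX hX bw st).
  by apply: eq_Rintegral => w _; rewrite mulrC.
move=> v sv; rewrite mgf_int; apply: eq_Rintegral => w _.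
by rewrite dotpZl dotpDl mulrDr expRD.
Qed.

(** The formula for expectations, at the constant random vector [t]. *)
Lemma laplace_beltrami_exp (t x : 'rV[R]_p) : sphere t -> sphere x ->
  laplace_beltrami (fun y => expR (lambda * dotp t y)) x = G (dotp t x).
Proof.
move=> st sx.
rewrite (laplace_beltrami_int (P := P) (V := fun=> t) (lambda := lambda) _ _ (bmf_cst 1) sx)//.
  by rewrite bint_cst mul1r dotpC.
by move=> u su; rewrite bint_cst mul1r dotpC.
Qed.

Let bz : bmf (fun x => z (pr x)).
Proof. exact: (bmf_kernel_mean lambda p1 nu P mX hX). Qed.

Lemma tauE : sqnormL2 nu (z_fun lambda X) = tau.
Proof.
rewrite /sqnormL2 /tau -(sphere_Rintegral (p_gt0 := p0) nu_sphere (f := fun x => z x ^+ 2)); last exact: bmfX.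
by apply: eq_Rintegral => x /set_mem sx; rewrite z_funE.
Qed.

Let bzeta : bmf (fun w => zeta (X w)).
Proof. exact: (bmf_kernel_mean2 lambda p1 nu P mX hX). Qed.

Lemma bmf_kernel_mean2_sproj : bmf (fun x => zeta (pr x)).
Proof.
have msp : measurable_fun setT pr by exact: measurable_sproj.
have h : bmf (fun xy : 'rV[R]_p * 'rV[R]_p => G (dotp (pr xy.1) (pr xy.2)) * z (pr xy.2)).
  apply: bmfM; last exact: (bmf_comp _ bz).
  apply: bmf_kernel; split; first by apply: measurable_dotp; apply: measurableT_comp.
  by exists 1 => xy; exact: dotp_norm_le.
exact: (bmf_int2 nu nu h).
Qed.

Let Ezeta : \int[P]_w zeta (X w) = tau.
Proof. exact: (int_kernel_mean2 lambda p1 nu P mX hX). Qed.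

Let zeta_sym t : zeta t = \int[nu]_x (G (dotp (pr x) t) * z (pr x)).
Proof. by apply: eq_Rintegral => x _; rewrite dotpC. Qed.

(** Integrating [G (t.X) z t] over [t] gives [zeta X], and likewise over [s]; so the integral is the
    mean of [(zeta X)^2] minus [tau^2], and [zeta X] has mean [tau]. *)
Lemma sigma2E :
  4 * \int[nu]_(s in sphere) \int[nu]_(t in sphere)
    (K'_fun lambda X s t * z_fun lambda X s * z_fun lambda X t) =
  4 * \int[P]_w ((zeta (X w) - tau) ^+ 2).
Proof.
have bGX s : sphere s -> bmf (fun w => G (dotp s (X w))).
  exact: (bmf_kernel_RV lambda mX hX).
have bjoint := bmf_kernel_joint lambda p1 mX hX.
pose E2 s t := \int[P]_w (G (dotp s (X w)) * G (dotp t (X w))).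
have bE2 s : sphere s -> bmf (fun t => E2 s (pr t)).
  move=> ss; apply: (bmf_int2 nu P (h := fun t w => G (dotp s (X w)) * G (dotp (pr t) (X w)))).
  by apply: bmfM => //; exact: (bmf_comp _ (bGX s ss)).
have inner s : sphere s -> \int[nu]_(t in sphere)
    (K'_fun lambda X s t * z_fun lambda X s * z_fun lambda X t) =
    z s * (\int[P]_w (G (dotp s (X w)) * zeta (X w)) - z s * tau).
  move=> ss; transitivity (\int[nu]_(t in sphere) (z s * (E2 s t * z t - z s * z t ^+ 2))).
    apply: eq_Rintegral => t /set_mem st; rewrite K'_funE// !z_funE// -/(E2 s t).
    by move: (E2 s t) (z s) (z t) => a b c; ring.
  have b1 : bmf (fun t => E2 s (pr t) * z (pr t)) by apply: bmfM => //; exact: bE2.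
  have b2 : bmf (fun t => z s * z (pr t) ^+ 2) by apply: bmfZ; exact: bmfX.
  rewrite (sphere_Rintegral (p_gt0 := p0) nu_sphere (f := fun t => z s * (E2 s t * z t - z s * z t ^+ 2))); last first.
    by apply: bmfZ; apply: bmfB.
  rewrite bintZ ?bintB ?bintZ//; [|exact: bmfX|exact: bmfB].
  congr (_ * (_ - _)).
  pose h t w := G (dotp s (X w)) * (G (dotp (pr t) (X w)) * z (pr t)).
  have bh : bmf (fun tw : 'rV[R]_p * Omega => h tw.1 tw.2).
    apply: bmfM; first exact: (bmf_comp _ (bGX s ss)).
    by apply: bmfM => //; exact: (bmf_comp _ bz).
  transitivity (\int[nu]_t \int[P]_w h t w).
    apply: eq_Rintegral => t _; rewrite /E2 -bintZr; last by apply: bmfM; exact: bGX.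
    apply: eq_Rintegral => w _; exact: (esym (mulrA _ _ _)).
  rewrite (bfubini nu P bh); apply: eq_Rintegral => w _.
  rewrite bintZ; last first.
    apply: bmfM => //; have := bmf_kernel p lambda (bmf_dotp_sproj p1 (hX w)).
    by under eq_fun do rewrite dotpC.
  by rewrite zeta_sym.
pose J s := \int[P]_w (G (dotp s (X w)) * zeta (X w)).
have bJ : bmf (fun s => J (pr s)).
  apply: (bmf_int2 nu P (h := fun s w => G (dotp (pr s) (X w)) * zeta (X w))).
  by apply: bmfM => //; exact: (bmf_comp _ bzeta).
congr (4 * _); transitivity (\int[nu]_(s in sphere) (z s * (J s - z s * tau))).
  by apply: eq_Rintegral => s /set_mem ss; rewrite inner.
rewrite (sphere_Rintegral (p_gt0 := p0) nu_sphere (f := fun s => z s * (J s - z s * tau))); last first.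
  by apply: bmfM => //; apply: bmfB => //; apply: bmfM => //; exact: bmf_cst.
transitivity (\int[nu]_s (z (pr s) * J (pr s)) - tau * tau).
  rewrite -[X in _ = _ - X](bintZ _ _ (bmfX 2 bz)) -bintB; [|exact: bmfM|by apply: bmfZ; exact: bmfX].
  by apply: eq_Rintegral => s _; ring.
have -> : \int[nu]_s (z (pr s) * J (pr s)) = \int[P]_w (zeta (X w) ^+ 2).
  pose h s w := G (dotp (pr s) (X w)) * z (pr s) * zeta (X w).
  have bh : bmf (fun sw : 'rV[R]_p * Omega => h sw.1 sw.2).
    by apply: bmfM; [apply: bmfM => //; exact: (bmf_comp _ bz)|exact: (bmf_comp _ bzeta)].
  transitivity (\int[nu]_s \int[P]_w h s w).
    apply: eq_Rintegral => s _; rewrite /J -bintZ; last by apply: bmfM => //; exact: bGX.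
    by apply: eq_Rintegral => w _; rewrite /h mulrA [_ * G _]mulrC.
  rewrite (bfubini nu P bh); apply: eq_Rintegral => w _.
  rewrite bintZr; last first.
    apply: bmfM => //; have := bmf_kernel p lambda (bmf_dotp_sproj p1 (hX w)).
    by under eq_fun do rewrite dotpC.
  by rewrite -zeta_sym expr2.
have -> : (fun w => (zeta (X w) - tau) ^+ 2) =
    (fun w => zeta (X w) ^+ 2 - 2 * tau * zeta (X w) + tau ^+ 2).
  by apply/funext => w; ring.
rewrite bintD; [|by apply: bmfB; [exact: bmfX|exact: bmfZ]|exact: bmf_cst].
rewrite bintB; [|exact: bmfX|exact: bmfZ].
by rewrite bintZ// bint_cst Ezeta; ring.
Qed.

End statistic.

(** * The limit law of the statistic *)

Section statistic_limit.
Context {R : realType} {p : nat}.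
Variable lambda : R.
Hypothesis p1 : (1 < p)%N.
Let p0 := ltnW p1.
Variable nu : probability 'rV[R]_p R.
Hypothesis hnu : uniform_on_sphere nu.
Context {d : measure_display} {Omega : measurableType d}.
Variable P : probability Omega R.
Variable X : {RV P >-> 'rV[R]_p}.
Hypothesis hX : forall w, sphere (X w).
Variable Xs : nat -> {RV P >-> 'rV[R]_p}.
Hypotheses (hXs : forall j w, sphere (Xs j w)) (hind : independent_seq Xs)
  (hid : forall j, same_law (Xs j) X).

Let G (u : R) := lb_exp_kernel p lambda u.
Let pr := sproj (R := R) p0.
Let z s := kernel_mean lambda P X s.
Let zeta t := kernel_mean2 lambda p1 nu P X t.
Let tau := \int[nu]_x (z (pr x) ^+ 2).
(** Composed with [pr] so as to be bounded on the whole space; at the values of [X] and [Xs] this is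
    [zeta - tau]. *)
Let g x := zeta (pr x) - tau.
Let v := \int[P]_w ((zeta (X w) - tau) ^+ 2).
Let S n w : R := \sum_(j < n) g (Xs j w).

Let spr x : sphere (pr x) := sphere_sproj p0 x.

Lemma law_int j (f : 'rV[R]_p -> R) : bmf f -> \int[P]_w f (Xs j w) = \int[P]_w f (X w).
Proof. by move=> bf; apply: same_law_int => // A mA; exact: hid. Qed.

Let bz : bmf (fun x => z (pr x)).
Proof. exact: (bmf_kernel_mean lambda p1 nu P (measurable_funPT X) hX). Qed.

Let bg : bmf g.
Proof. by apply: bmfB; [exact: bmf_kernel_mean2_sproj|exact: bmf_cst]. Qed.

Let prX w : pr (X w) = X w. Proof. exact: sproj_id. Qed.
Let prXs j w : pr (Xs j w) = Xs j w. Proof. exact: sproj_id. Qed.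

Let g_mean0 j : \int[P]_w g (Xs j w) = 0.
Proof.
rewrite law_int// /g; under eq_Rintegral do rewrite prX.
rewrite bintB ?bint_cst; [|exact: (bmf_kernel_mean2 lambda p1 nu P (measurable_funPT X) hX)|exact: bmf_cst].
by rewrite (int_kernel_mean2 lambda p1 nu P (measurable_funPT X) hX) subrr.
Qed.

Let g_var j : \int[P]_w (g (Xs j w) ^+ 2) = v.
Proof.
rewrite (law_int j (bmfX 2 bg)); apply: eq_Rintegral => w _.
by rewrite /g prX.
Qed.

Let bG2 : bmf (fun xy : 'rV[R]_p * 'rV[R]_p => G (dotp (pr xy.1) (pr xy.2))).
Proof.
have msp : measurable_fun setT pr by exact: measurable_sproj.
apply: bmf_kernel; split; first by apply: measurable_dotp; apply: measurableT_comp.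
by exists 1 => xy; exact: dotp_norm_le.
Qed.

Let bGt t : sphere t -> bmf (fun x => G (dotp (pr x) t)).
Proof.
move=> st; have := bmf_kernel p lambda (bmf_dotp_sproj p1 st).
by under eq_fun do rewrite dotpC.
Qed.

Lemma T_statE n w : T_stat nu lambda Xs n w =
  n%:R * \int[nu]_x ((n%:R^-1 * \sum_(j < n) G (dotp (pr x) (Xs j w))) ^+ 2).
Proof.
rewrite /T_stat /sqnormL2; congr (_ * _).
rewrite -(sphere_Rintegral (p_gt0 := p0) (proj1 hnu)
  (f := fun t => (n%:R^-1 * \sum_(j < n) G (dotp t (Xs j w))) ^+ 2)); last first.
  by apply: bmfX; apply: bmfZ; apply: bmf_sum => j _; exact: bGt.
apply: eq_Rintegral => t /set_mem st; congr ((_ * _) ^+ 2); apply: eq_bigr => j _.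
exact: (laplace_beltrami_exp lambda P st (hXs j w)).
Qed.

Let W n w x := n%:R^-1 * \sum_(j < n) G (dotp (pr x) (Xs j w)) - z (pr x).

Let bW n : bmf (fun wx : Omega * 'rV[R]_p => W n wx.1 wx.2).
Proof.
have msp : measurable_fun setT pr by exact: measurable_sproj.
apply: bmfB; last exact: (bmf_comp _ bz).
apply: bmfZ; apply: bmf_sum => j _; apply: bmf_kernel; split.
  by apply: measurable_dotp; apply: measurableT_comp.
by exists 1 => wx; exact: dotp_norm_le.
Qed.

Let Rem n w := Num.sqrt n%:R * \int[nu]_x (W n w x ^+ 2).

Let bRem n : bmf (Rem n).
Proof.
apply: bmfZ; exact: (bmf_int2 P nu (h := fun w x => W n w x ^+ 2) (bmfX 2 (bW n))).
Qed.

Let Rem_ge0 n w : 0 <= Rem n w.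
Proof. by apply: mulr_ge0; rewrite ?sqrtr_ge0// bint_ge0// => x; exact: sqr_ge0. Qed.

Lemma statistic_decomposition n w :
  Num.sqrt n%:R * (T_stat nu lambda Xs n w / n%:R - tau) =
  2 * (S n w / Num.sqrt n%:R) + Rem n w.
Proof.
(* At [n = 0] both sides are 0, since [sqrt 0 = 0]. *)
have [->|n0] := posnP n; first by rewrite /Rem sqrtr0 !mul0r invr0 !mulr0 addr0.
have nR : 0 < n%:R :> R by rewrite ltr0n.
have nR0 : n%:R != 0 :> R by rewrite gt_eqF.
have bWw : bmf (W n w) by exact: (bmf_sec2 (h := W n) (bW n)).
have WzE : \int[nu]_x (W n w x * z (pr x)) = n%:R^-1 * S n w.
  rewrite /W; under eq_Rintegral do rewrite mulrBl -mulrA mulr_suml.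
  have bGz j : bmf (fun x => G (dotp (pr x) (Xs j w)) * z (pr x)).
    by apply: bmfM => //; exact: bGt.
  rewrite bintB; [|by apply: bmfZ; exact: bmf_sum|exact: bmfM].
  rewrite bintZ ?bint_sum//; last exact: bmf_sum.
  have SE : S n w = \sum_(j < n) zeta (Xs j w) - n%:R * tau.
    have -> : n%:R * tau = \sum_(j < n) tau by rewrite sumr_const card_ord mulr_natl.
    by rewrite -[RHS]sumrB; apply: eq_bigr => j _; rewrite /g prXs.
  have alg (N a t : R) : N != 0 -> N^-1 * (a - N * t) = N^-1 * a - t by move=> N0; field.
  have zz : \int[nu]_x (z (pr x) * z (pr x)) = tau.
    by apply: eq_Rintegral => x _; rewrite -expr2.
  have sumE : \sum_(j < n) \int[nu]_x (G (dotp (pr x) (Xs j w)) * z (pr x)) =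
      \sum_(j < n) zeta (Xs j w).
    by apply: eq_bigr => j _; apply: eq_Rintegral => x _; rewrite dotpC.
  by rewrite zz sumE SE; exact: (esym (alg _ _ _ nR0)).
have -> : T_stat nu lambda Xs n w / n%:R - tau =
    2 * (n%:R^-1 * S n w) + \int[nu]_x (W n w x ^+ 2).
  rewrite T_statE [n%:R * _]mulrC mulfK//.
  have -> : (fun x => (n%:R^-1 * \sum_(j < n) G (dotp (pr x) (Xs j w))) ^+ 2) =
      (fun x => 2 * (W n w x * z (pr x)) + W n w x ^+ 2 + z (pr x) ^+ 2).
    apply/funext => x; rewrite /W; move: (_ * _) (z _) => a b; ring.
  rewrite bintD; [|by apply: bmfD; [apply: bmfZ; exact: bmfM|exact: bmfX]|exact: bmfX].
  rewrite bintD; [|by apply: bmfZ; exact: bmfM|exact: bmfX].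
  by rewrite bintZ ?WzE ?addrK//; exact: bmfM.
have r0 : Num.sqrt n%:R != 0 :> R by rewrite gt_eqF ?sqrtr_gt0.
rewrite mulrDr /Rem; congr (_ + _).
rewrite -[in n%:R^-1](sqr_sqrtr (ltW nR)); field => //.
Qed.

(** For fixed [x], [W n w x] is the mean of [n] independent centered variables bounded by [2 M], so
    its second moment is at most [(2 M)^2 / n]; integrate over [x] by Fubini. *)
Let remainder_bound : exists2 C, 0 <= C &
  forall n, \int[P]_w Rem n w <= C / Num.sqrt n%:R.
Proof.
have [_ [M hM]] := bG2.
have M0 : 0 <= M by exact: le_trans (normr_ge0 _) (hM point).
have zM x : `|z (pr x)| <= M.
  apply: bint_norm_le => [|w]; first exact: (bmf_kernel_RV lambda (measurable_funPT X) hX (spr x)).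
  by rewrite -prX; exact: (hM (x, X w)).
exists ((2 * M) ^+ 2) => [|n]; first exact: sqr_ge0.
have [->|n0] := posnP n.
  rewrite sqrtr0 invr0 mulr0 -(bint_cst P 0); apply: bint_le => //; first exact: bmf_cst.
  by move=> w; rewrite /Rem sqrtr0 mul0r.
have nR : 0 < n%:R :> R by rewrite ltr0n.
have nR0 : n%:R != 0 :> R by rewrite gt_eqF.
have bW2 := bmfX 2 (bW n).
have bi : bmf (fun w => \int[nu]_x (W n w x ^+ 2)).
  exact: (bmf_int2 P nu (h := fun w x => W n w x ^+ 2) bW2).
rewrite bintZ// (bfubini P nu (h := fun w x => W n w x ^+ 2) bW2).
have key x : \int[P]_w (W n w x ^+ 2) <= (2 * M) ^+ 2 / n%:R.
  pose gx y := G (dotp (pr x) (pr y)) - z (pr x).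
  have bgx : bmf gx.
    by apply: bmfB; [exact: (bmf_sec2 (h := fun a b => G (dotp (pr a) (pr b))) bG2)|exact: bmf_cst].
  have gxM y : `|gx y| <= 2 * M.
    rewrite (le_trans (ler_normB _ _))// mulr_natl mulr2n lerD//; exact: (hM (x, y)).
  have gxX w : gx (X w) = G (dotp (pr x) (X w)) - z (pr x) by rewrite /gx prX.
  have m0 j : \int[P]_w gx (Xs j w) = 0.
    rewrite law_int//; under eq_Rintegral do rewrite gxX.
    by rewrite bintB ?bint_cst ?subrr//; [exact: (bmf_kernel_RV lambda (measurable_funPT X) hX (spr x))|exact: bmf_cst].
  have vx j : \int[P]_w (gx (Xs j w) ^+ 2) = \int[P]_w (gx (X w) ^+ 2).
    exact: (law_int j (bmfX 2 bgx)).
  have -> : \int[P]_w (W n w x ^+ 2) =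
      \int[P]_w (n%:R^-1 ^+ 2 * (\sum_(j < n) gx (Xs j w)) ^+ 2).
    apply: eq_Rintegral => w _; rewrite -exprMn; congr (_ ^+ 2).
    rewrite /W /gx sumrB sumr_const card_ord mulrBr -[z _ *+ _]mulr_natl mulrA mulVf// mul1r.
    by congr (_ * _ - _); apply: eq_bigr => j _; rewrite prXs.
  rewrite bintZ; last by apply: bmfX; apply: bmf_sum => j _; exact: (bmf_RV (Xs) j bgx).
  rewrite (walk_sqr_int hind bgx m0 vx) mulrA exprVn.
  have -> : (n%:R ^+ 2)^-1 * n%:R = n%:R^-1 :> R by field.
  rewrite mulrC ler_wpM2r ?invr_ge0 ?(ltW nR)// -(bint_cst P ((2 * M) ^+ 2)).
  apply: bint_le => [||w]; [|exact: bmf_cst|].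
    apply: bmfX; exact: (bmf_comp (measurable_funPT X) bgx).
  rewrite -[leLHS]real_normK ?num_real// lerXn2r ?nnegrE// mulr_ge0//.
apply: (@le_trans _ _ (Num.sqrt n%:R * ((2 * M) ^+ 2 / n%:R))).
  rewrite ler_wpM2l ?sqrtr_ge0// -[leRHS](bint_cst nu).
  apply: bint_le => //; last exact: bmf_cst.
  exact: (bmf_int1 P nu (h := fun w x => W n w x ^+ 2) bW2).
have r0 : Num.sqrt n%:R != 0 :> R by rewrite gt_eqF ?sqrtr_gt0.
rewrite le_eqVlt; apply/orP; left; apply/eqP.
rewrite -[in _ / n%:R](sqr_sqrtr (ltW nR)); field => //.
Qed.

Theorem statistic_clt : cvg_in_distribution P
  (fun n w => Num.sqrt n%:R * (T_stat nu lambda Xs n w / n%:R - tau))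
  (centered_normal (4 * v)).
Proof.
have [C C0 hC] := remainder_bound.
have [_ [B gB]] := bg.
have v0 : 0 <= v by apply: bint_ge0 => w; exact: sqr_ge0.
pose U n w := S n w / Num.sqrt n%:R.
have bS n : bmf (S n) by exact: bmf_walk.
have bU n : bmf (U n) by apply: bmfM => //; exact: bmf_cst.
under eq_fun => n do under eq_fun => w do rewrite statistic_decomposition -/(U n w).
have bZ n : bmf (fun w => 2 * U n w + Rem n w) by apply: bmfD => //; exact: bmfZ.
have C1 n : C / Num.sqrt n%:R <= C.
  have [->|n0] := posnP n; first by rewrite sqrtr0 invr0 mulr0.
  rewrite ler_piMr// invf_le1 ?sqrtr_gt0 ?ltr0n//.
  by rewrite -(expr_ge1 (n := 2)) ?sqrtr_ge0// sqr_sqrtr ?ler1n.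
(* The first moments are bounded by [|2 u| <= 1 + 4 u^2], with [E U^2 <= v] and [E Rem <= C]. *)
apply: (@cvg_in_distribution_cos _ _ _ _ _ _ (1 + 4 * v + C)) => //.
- move=> n.
  have bn := bmf_norm (bZ n).
  apply: (@le_trans _ _ (\int[P]_w (1 + 4 * U n w ^+ 2 + Rem n w))).
    apply: bint_le => //.
      by apply: bmfD => //; apply: bmfD; [exact: bmf_cst|apply: bmfZ; exact: bmfX].
    move=> w; rewrite (le_trans (ler_normD _ _))// (ger0_norm (Rem_ge0 n w)) lerD2r.
    move: (U n w) => u; rewrite ler_norml; apply/andP; split; rewrite -subr_ge0.
      rewrite (_ : _ - _ = (1/2 + 2 * u) ^+ 2 + 3 / 4); last by field.
      by rewrite addr_ge0 ?sqr_ge0// divr_ge0.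
    rewrite (_ : _ - _ = (2 * u - 1/2) ^+ 2 + 3 / 4); last by field.
    by rewrite addr_ge0 ?sqr_ge0// divr_ge0.
  rewrite bintD//; last by apply: bmfD; [exact: bmf_cst|apply: bmfZ; exact: bmfX].
  rewrite bintD; [|exact: bmf_cst|by apply: bmfZ; exact: bmfX].
  rewrite bint_cst lerD//; last exact: le_trans (hC n) (C1 n).
  rewrite lerD2l bintZ ?ler_wpM2l//; last exact: bmfX.
  rewrite /U; under eq_Rintegral do rewrite exprMn.
  rewrite bintZr; last exact: bmfX.
  rewrite (walk_sqr_int hind bg g_mean0 g_var) exprVn sqr_sqrtr//.
  rewrite mulrAC ler_piMl//; have [->|n0] := posnP n; first by rewrite mul0r.
  by rewrite divff// pnatr_eq0 -lt0n.
move=> a b; rewrite int_cos_centered_normal ?mulr_ge0//.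
(* The variance [4 v] at frequency [a] is the variance [v] at frequency [2 a], because the main term
   is [2 U]. *)
have -> : - (4 * v * a ^+ 2 / 2) = - (v * (a * 2) ^+ 2 / 2) by congr (- _); field.
have hclt : \int[P]_w cos (a * 2 * U n w + b) @[n --> \oo] -->
    expR (- (v * (a * 2) ^+ 2 / 2)) * cos b.
  exact: (cos_walk_clt hind bg gB g_mean0 g_var).
have bcos n : bmf (fun w => cos (a * (2 * U n w + Rem n w) + b)) by exact: bmf_cos_affine.
have bcos2 n : bmf (fun w => cos (a * 2 * U n w + b)) by exact: bmf_cos_affine.
apply/cvgrPdist_le => e e0; have e20 : 0 < e / 2 by rewrite divr_gt0.
have aC0 : 0 <= `|a| * C by exact: mulr_ge0.
have /cvgrPdist_le/(_ _ e20) := hclt.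
apply: filterS2 (near_div_sqrt_le aC0 e20) => n h1 h2.
rewrite -(subrKA (\int[P]_w cos (a * 2 * U n w + b))) (le_trans (ler_normD _ _))//.
rewrite [leRHS]splitr lerD// -bintB//.
apply: le_trans h1; rewrite -mulrA.
have bd : bmf (fun w => cos (a * 2 * U n w + b) - cos (a * (2 * U n w + Rem n w) + b)).
  exact: bmfB.
apply: (le_trans (bint_norm P bd)).
apply: (@le_trans _ _ (\int[P]_w (`|a| * Rem n w))).
  apply: bint_le => [||w]; [exact: bmf_norm|exact: bmfZ|].
  apply: (le_trans (cos_lipschitz _ _)).
  rewrite (_ : _ - _ = - (a * Rem n w)); last by ring.
  by rewrite normrN normrM (ger0_norm (Rem_ge0 n w)).
by rewrite bintZ// ler_wpM2l.
Qed.

End statistic_limit.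

Lemma multiplier_sqr {R : realType} (p k : nat) (lambda : R) : (1 < p)%N -> 0 < lambda ->
  gamma_coef p k * c_coef p k lambda = multiplier (p := p) lambda k ^+ 2.
Proof. by move=> p1 l0; rewrite gamma_c_coef// /multiplier mulNr sqrrN. Qed.

(** The convergence of the partial sums is part of the conclusion, as [limn] is only a default value
    for a divergent sequence. *)
Theorem theorem3p5 (R : realType) (p : nat) (hp : (2 <= p)%N)
  (lambda : R) (hlambda : 0 < lambda)
  (nu : probability 'rV[R]_p R) (hnu : uniform_on_sphere nu)
  (Y : forall k : nat, 'I_(sph_dim p k) -> 'rV[R]_p -> R)
  (hY : forall k : nat, is_orthonormal_sph_basis nu k (Y k))
  (d : measure_display) (Omega : measurableType d) (P : probability Omega R)
  (X : {RV P >-> 'rV[R]_p}) (hX : forall w, sphere (X w))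
  (q : 'rV[R]_p -> R) (hq : has_density nu sphere X q)
  (hq2 : nu.-integrable sphere (fun x => (q x ^+ 2)%:E))
  (Xs : nat -> {RV P >-> 'rV[R]_p}) (hXs : forall j w, sphere (Xs j w))
  (hind : independent_seq Xs) (hid : forall j, same_law (Xs j) X) :
  let z := z_fun lambda X in
  let tau := sqnormL2 nu z in
  let beta (k : nat) (r : 'I_(sph_dim p k)) :=
    \int[nu]_(x in sphere) (q x * Y k r x) in
  let partial_sum (w : Omega) (n : nat) : R :=
    \sum_(1 <= k < n) \sum_(r < sph_dim p k)
      gamma_coef p k * c_coef p k lambda * beta k r
        * (Y k r (X w) - beta k r) in
  let sigma2 : R :=
    4 * \int[nu]_(s in sphere) \int[nu]_(t in sphere)
          (K'_fun lambda X s t * z s * z t) in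
  [/\ cvg_in_distribution P
        (fun n w => Num.sqrt n%:R * (T_stat nu lambda Xs n w / n%:R - tau))
        (centered_normal sigma2),
      forall w, cvgn (partial_sum w) &
      (sigma2%:E = 4%:E * 'E_P[fun w => (limn (partial_sum w) ^+ 2)%R])%E].
Proof.
move=> z tau beta partial_sum sigma2.
have p1 : (1 < p)%N := hp.
have p0 : (0 < p)%N := ltnW p1.
have l0 := ltW hlambda.
have mX : measurable_fun setT X := measurable_funPT X.
have tE : tau = \int[nu]_x (kernel_mean lambda P X (sproj (ltnW p1) x) ^+ 2).
  exact: (tauE lambda p1 hnu hX).
pose v := \int[P]_w ((kernel_mean2 lambda p1 nu P X (X w) - tau) ^+ 2).
have sE : sigma2 = 4 * v by rewrite /v tE; exact: (sigma2E lambda p1 hnu hX).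
have betaE k r : beta k r = \int[P]_w Y k r (X w).
  rewrite /beta; transitivity (\int[nu]_(x in sphere) (q x * Y k r (sproj (ltnW p1) x))).
    by apply: eq_Rintegral => x /set_mem sx; rewrite sproj_id.
  rewrite (has_density_int (@measurable_sphere R p) hq (bmf_harmonic p1 hY r)).
  by apply: eq_Rintegral => w _; rewrite sproj_id.
have partialE w : partial_sum w = (fun n =>
    \sum_(k < n) \sum_(r < sph_dim p k)
      multiplier (p := p) lambda k ^+ 2 * \int[P]_w Y k r (X w) * Y k r (X w) -
    \sum_(k < n) \sum_(r < sph_dim p k)
      multiplier (p := p) lambda k ^+ 2 * (\int[P]_w Y k r (X w)) ^+ 2).
  apply/funext => n; rewrite /partial_sum.
  pose F (k : nat) := \sum_(r < sph_dim p k) multiplier (p := p) lambda k ^+ 2 *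
    beta k r * (Y k r (X w) - beta k r).
  transitivity (\sum_(k < n) F k).
    case: n => [|n]; first by rewrite big_geq// big_ord0.
    (* The term of degree 0 can be added, because [multiplier] vanishes there. *)
    rewrite -(big_mkord xpredT F) [RHS]big_ltn// [F 0%N]big1 ?add0r.
      by apply: eq_bigr => k _; apply: eq_bigr => r _; rewrite multiplier_sqr.
    by move=> r _; rewrite /multiplier !mul0r oppr0 mul0r expr0n/= !mul0r.
  rewrite -sumrB; apply: eq_bigr => k _; rewrite -sumrB; apply: eq_bigr => r _.
  by rewrite betaE; ring.
have pcvg w : partial_sum w @ \oo --> kernel_mean2 lambda p1 nu P X (X w) - tau.
  rewrite partialE tE; apply: cvgB.
    exact: (harmonic_series_cvg l0 hnu hY mX hX).
  exact: (sum_coef_sqr_cvg l0 hnu hY mX hX).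
split.
- rewrite sE /v tE; exact: (statistic_clt lambda p1 hnu hX hXs hind hid).
- by move=> w; apply/cvg_ex; exists (kernel_mean2 lambda p1 nu P X (X w) - tau).
- rewrite sE unlock; under eq_integral => w _ do rewrite (cvg_lim _ (pcvg w))//.
  have bzeta := bmf_kernel_mean2 lambda p1 nu P mX hX.
  by rewrite bintE//; apply: bmfX; apply: bmfB => //; exact: bmf_cst.
Qed.
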